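(* Let $H$ be a quasitriangular Hopf algebra in the category $\mathcal{A}$, and let $R \in H\otimes H$ be its $R$-matrix. Then the inner automorphism $\mathrm{Ad}(R)\colon H\otimes H\to H\otimes H$, $x\mapsto R\cdot x\cdot R^{-1}$, restricts to an automorphism of $H'\otimes H'$. Consequently the pair $\big(H',\ \mathrm{Ad}(R)|_{H'\otimes H'}\big)$ is a braided Hopf algebra in the category $\mathcal{A}$.
   Context: $k$ is a field of characteristic zero. Category $\mathcal{A}$: objects are the topologically free $k[[h]]$-modules that are complete in the $h$-adic sense; morphisms are the continuous $k[[h]]$-linear maps. For $V,W$ in $\mathcal{A}$, $V\otimes W$ is the projective limit of the $k[[h]]/(h^n)$-modules $(V/h^nV)\otimes_{k[[h]]/(h^n)}(W/h^nW)$. This makes $\mathcal{A}$ a tensor category; Hopf algebras in $\mathcal{A}$ are taken with respect to this $\otimes$. Quasitriangular: a Hopf algebra $H$ is quasitriangular if there is an invertible $R\in H\otimes H$ (called the $R$-matrix) with $R\,\Delta(a)\,R^{-1}=\Delta^{\mathrm{op}}(a)$ for all $a\in H$, $(\Delta\otimes \mathrm{Id})(R)=R_{13}R_{23}$ and $(\mathrm{Id}\otimes\Delta)(R)=R_{13}R_{12}$, where $\Delta^{\mathrm{op}}=\sigma\circ\Delta$, $\sigma(a\otimes b)=b\otimes a$, $R_{12}=R\otimes1$, $R_{23}=1\otimes R$, $R_{13}=(\sigma\otimes\mathrm{Id})(R_{23})$. Braided: a Hopf algebra $H$ is braided if there is an algebra automorphism $\mathfrak{R}$ of $H\otimes H$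 (the braiding operator), different from the flip $\sigma$, such that $\mathfrak{R}\circ\Delta=\Delta^{\mathrm{op}}$, $(\Delta\otimes\mathrm{Id})\circ\mathfrak{R}=\mathfrak{R}_{13}\circ\mathfrak{R}_{23}\circ(\Delta\otimes\mathrm{Id})$ and $(\mathrm{Id}\otimes\Delta)\circ\mathfrak{R}=\mathfrak{R}_{13}\circ\mathfrak{R}_{12}\circ(\mathrm{Id}\otimes\Delta)$, where $\mathfrak{R}_{12}=\mathfrak{R}\otimes\mathrm{Id}$, $\mathfrak{R}_{23}=\mathrm{Id}\otimes\mathfrak{R}$, $\mathfrak{R}_{13}=(\sigma\otimes\mathrm{Id})\circ(\mathrm{Id}\otimes\mathfrak{R})\circ(\sigma\otimes\mathrm{Id})$ on $H^{\otimes 3}$. The subspace $H'$: for a Hopf algebra $H$ in $\mathcal{A}$ put $\Delta^0=\epsilon$, $\Delta^1=\mathrm{Id}_H$, $\Delta^n=(\Delta\otimes\mathrm{Id}_H^{\otimes(n-2)})\circ\Delta^{n-1}\colon H\to H^{\otimes n}$ for $n\ge2$. For $\Sigma=\{i_1<\dots<i_m\}\subseteq\{1,\dots,n\}$ let $j_\Sigma\colon H^{\otimes m}\to H^{\otimes n}$ be the homomorphism placing the $l$-th tensor factor in position $i_l$ and $1$ in all positions not in $\Sigma$, and let $\Delta_\Sigma=j_\Sigma\circ\Delta^m$. Let $\delta_n=\sum_{\Sigma\subseteq\{1,\dots,n\}}(-1)^{n-|\Sigma|}\Delta_\Sigma\colon H\to H^{\otimes n}$. Then $H'=\{a\in H\mid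 \delta_n(a)\in h^nH^{\otimes n}\ \text{for all } n\ge 1\}$, with the induced topology. It is a known result of Drinfeld that $H'$ is a Hopf algebra in $\mathcal{A}$ (sub-Hopf structure induced from $H$). Applying the same construction to the Hopf algebra $H\otimes H$, with the tensor product convention used one has $(H\otimes H)'=H'\otimes H'$.
   Formalization: The R-matrix is assumed to satisfy R = 1⊗1 mod h (the claim fails without it); ''different from the flip'' is asserted only when H' is not k[[h]]1; H' has the induced topology and H'⊗H' is completed for it. *)

(* Defs.v *)
From HB Require Import structures.
From mathcomp Require Import all_boot all_order all_algebra.
From mathcomp Require Import boolp.

Set Implicit Arguments.
Unset Strict Implicit.
Unset Printing Implicit Defensive.

Import GRing.Theory.
Local Open Scope ring_scope.
Local Open Scope quotient_scope.

Record fps (k : fieldType) := Fps { coef : nat -> k }.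

Section PowerSeries.
Variable k : fieldType.
Implicit Types f g : fps k.

HB.instance Definition _ := gen_eqMixin (fps k).
HB.instance Definition _ := gen_choiceMixin (fps k).

Lemma fpsP f g : (forall n, coef f n = coef g n) -> f = g.
Proof. by case: f g => [f] [g] /= /funext ->. Qed.

Definition fps_zero : fps k := Fps (fun=> 0).
Definition fps_one : fps k := Fps (fun n => (n == 0%N)%:R).
Definition fps_opp f : fps k := Fps (fun n => - coef f n).
Definition fps_add f g : fps k := Fps (fun n => coef f n + coef g n).
Definition fps_mul f g : fps k :=
  Fps (fun n => \sum_(i < n.+1) coef f i * coef g (n - i)).

Lemma fps_addA : associative fps_add.
Proof. by move=> f g e; apply: fpsP => n; rewrite /= addrA. Qed.
Lemma fps_addC : commutative fps_add.
Proof. by move=> f g; apply: fpsP => n; rewrite /= addrC. Qed.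
Lemma fps_add0 : left_id fps_zero fps_add.
Proof. by move=> f; apply: fpsP => n; rewrite /= add0r. Qed.
Lemma fps_addN : left_inverse fps_zero fps_opp fps_add.
Proof. by move=> f; apply: fpsP => n; rewrite /= addNr. Qed.

HB.instance Definition _ :=
  GRing.isZmodule.Build (fps k) fps_addA fps_addC fps_add0 fps_addN.

Let tr N f : {poly k} := \poly_(i < N) coef f i.

Let coef_mul_tr f g n N : (n < N)%N ->
  coef (fps_mul f g) n = (tr N f * tr N g)`_n.
Proof.
move=> nN; rewrite coefM; apply: eq_bigr => i _; rewrite !coef_poly.
rewrite (leq_ltn_trans _ nN) ?(leq_ltn_trans (leq_subr _ _) nN) //.
by rewrite -ltnS.
Qed.

Let coefM_eq (p p' q q' : {poly k}) n :
  (forall i, (i <= n)%N -> p`_i = p'`_i) ->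
  (forall i, (i <= n)%N -> q`_i = q'`_i) -> (p * q)`_n = (p' * q')`_n.
Proof.
move=> pp qq; rewrite !coefM; apply: eq_bigr => i _.
by rewrite pp ?qq ?leq_subr // -ltnS.
Qed.

Lemma fps_mulA : associative fps_mul.
Proof.
move=> f g e; apply: fpsP => n; rewrite !(@coef_mul_tr _ _ n n.+1) //.
rewrite -[RHS](@coefM_eq (tr n.+1 f * tr n.+1 g) _ (tr n.+1 e)) //; last first.
  by move=> i ni; rewrite coef_poly ltnS ni (@coef_mul_tr _ _ i n.+1).
rewrite -mulrA; apply: coefM_eq => // i ni.
by rewrite coef_poly ltnS ni (@coef_mul_tr _ _ i n.+1).
Qed.

Lemma fps_mulC : commutative fps_mul.
Proof.
by move=> f g; apply: fpsP => n; rewrite !(@coef_mul_tr _ _ n n.+1) // mulrC.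
Qed.

Lemma fps_mul1 : left_id fps_one fps_mul.
Proof.
move=> f; apply: fpsP => n /=; rewrite big_ord_recl /= mul1r subn0 big1 ?addr0//.
by move=> i _; rewrite mul0r.
Qed.

Lemma fps_mulDl : left_distributive fps_mul fps_add.
Proof.
move=> f g e; apply: fpsP => n /=; rewrite -big_split /=.
by apply: eq_bigr => i _; rewrite mulrDl.
Qed.

Lemma fps_one_neq0 : fps_one != 0.
Proof.
apply/eqP => /(congr1 (fun f => coef f 0)) /= /eqP.
by rewrite oner_eq0.
Qed.

HB.instance Definition _ := GRing.Zmodule_isComNzRing.Build (fps k)
  fps_mulA fps_mulC fps_mul1 fps_mulDl fps_one_neq0.

Definition hvar : fps k := Fps (fun n => (n == 1%N)%:R).

Lemma coef_hM f n : coef (hvar * f) n = if n is n'.+1 then coef f n' else 0.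
Proof.
case: n => [|n]; first by rewrite /= big_ord1 /= mul0r.
rewrite /= 2!big_ord_recl /= mul0r add0r mul1r subn1 big1 ?addr0 // => i _.
by rewrite mul0r.
Qed.

Lemma coef_hXM m f n :
  coef (hvar ^+ m * f) n = if (n < m)%N then 0 else coef f (n - m).
Proof.
elim: m n => [|m IH] n; first by rewrite expr0 mul1r subn0.
by rewrite exprS -mulrA coef_hM; case: n => // n; rewrite IH ltnS subSS.
Qed.

End PowerSeries.

Arguments hvar {k}.

Record submod (A : comNzRingType) (V : lmodType A) (P : V -> Prop) : Prop :=
  Submod { submod0 : P 0;
           submodD : forall x y, P x -> P y -> P (x + y);
           submodZ : forall a x, P x -> P (a *: x) }.

Section SubmodTheory.
Variables (A : comNzRingType) (V : lmodType A) (P : V -> Prop).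
Hypothesis PV : submod P.

Lemma submodN x : P x -> P (- x).
Proof. by rewrite -scaleN1r; apply: submodZ PV _ _. Qed.
Lemma submodB x y : P x -> P y -> P (x - y).
Proof. by move=> Px /submodN; apply: submodD PV _ _ Px. Qed.
Lemma submodBC x y : P (x - y) -> P (y - x).
Proof. by move=> /submodN; rewrite opprB. Qed.
Lemma submodBT y x z : P (x - y) -> P (y - z) -> P (x - z).
Proof. by move=> Pxy Pyz; rewrite -(subrK y x) -addrA; apply: submodD. Qed.
Lemma submod_sum I (s : seq I) (F : I -> V) :
  (forall i, P (F i)) -> P (\sum_(i <- s) F i).
Proof. by move=> PF; apply: big_ind => //; [apply: submod0|apply: submodD]. Qed.
End SubmodTheory.

Section QuotientModule.
Variables (A : comNzRingType) (V : lmodType A) (P : V -> Prop) (PV : submod P).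

Definition quot_rel (x y : V) : bool := `[< P (x - y) >].

Lemma quot_rel_refl : reflexive quot_rel.
Proof. by move=> x; apply/asboolP; rewrite subrr; apply: submod0. Qed.
Lemma quot_rel_sym : symmetric quot_rel.
Proof. by move=> x y; apply/asboolP/asboolP; apply: submodBC. Qed.
Lemma quot_rel_trans : transitive quot_rel.
Proof.
move=> y x z /asboolP xy /asboolP yz; apply/asboolP; exact: submodBT xy yz.
Qed.

Definition quot_equiv := EquivRel quot_rel quot_rel_refl quot_rel_sym quot_rel_trans.

(* V / P; the proof PV is an argument so that the module structure can be     *)
(* inferred from the type.                                                    *)
Definition quotmod := {eq_quot quot_equiv}.

HB.instance Definition _ := Choice.on quotmod.
HB.instance Definition _ := EqQuotient.on quotmod.

Definition qcl (x : V) : quotmod := \pi_quotmod x.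

Lemma qclP x y : qcl x = qcl y <-> P (x - y).
Proof. by split => [/eqmodP /asboolP|Pxy] //; apply/eqmodP/asboolP. Qed.

Lemma qcl_surj (c : quotmod) : exists x, qcl x = c.
Proof. by exists (repr c); rewrite /qcl reprK. Qed.

Lemma repr_qcl x : P (repr (qcl x) - x).
Proof. by apply/qclP; rewrite {1}/qcl reprK. Qed.

Definition quot_add (c d : quotmod) := qcl (repr c + repr d).
Definition quot_opp (c : quotmod) := qcl (- repr c).
Definition quot_scale (a : A) (c : quotmod) := qcl (a *: repr c).

Lemma quot_addE x y : quot_add (qcl x) (qcl y) = qcl (x + y).
Proof. by apply/qclP; rewrite opprD addrACA; apply: submodD => //; exact: repr_qcl. Qed.
Lemma quot_oppE x : quot_opp (qcl x) = qcl (- x).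
Proof. by apply/qclP; rewrite -opprD; apply: submodN => //; exact: repr_qcl. Qed.
Lemma quot_scaleE a x : quot_scale a (qcl x) = qcl (a *: x).
Proof. by apply/qclP; rewrite -scalerBr; apply: submodZ => //; exact: repr_qcl. Qed.

Lemma quot_addA : associative quot_add.
Proof.
move=> c d e; have [x <-] := qcl_surj c; have [y <-] := qcl_surj d.
by have [z <-] := qcl_surj e; rewrite !quot_addE addrA.
Qed.
Lemma quot_addC : commutative quot_add.
Proof.
move=> c d; have [x <-] := qcl_surj c; have [y <-] := qcl_surj d.
by rewrite !quot_addE addrC.
Qed.
Lemma quot_add0 : left_id (qcl 0) quot_add.
Proof. by move=> c; have [x <-] := qcl_surj c; rewrite quot_addE add0r. Qed.
Lemma quot_addN : left_inverse (qcl 0) quot_opp quot_add.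
Proof.
by move=> c; have [x <-] := qcl_surj c; rewrite quot_oppE quot_addE addNr.
Qed.

HB.instance Definition _ :=
  GRing.isZmodule.Build quotmod quot_addA quot_addC quot_add0 quot_addN.

Lemma quot_scaleA a b c : quot_scale a (quot_scale b c) = quot_scale (a * b) c.
Proof. by have [x <-] := qcl_surj c; rewrite !quot_scaleE scalerA. Qed.
Lemma quot_scale1 : left_id 1 quot_scale.
Proof. by move=> c; have [x <-] := qcl_surj c; rewrite quot_scaleE scale1r. Qed.
Lemma quot_scaleDr : right_distributive quot_scale +%R.
Proof.
move=> a c d; have [x <-] := qcl_surj c; have [y <-] := qcl_surj d.
by rewrite [_ + _]quot_addE !quot_scaleE [RHS]quot_addE scalerDr.
Qed.
Lemma quot_scaleDl c : {morph quot_scale^~ c : a b / a + b}.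
Proof.
move=> a b; have [x <-] := qcl_surj c.
by rewrite !quot_scaleE [RHS]quot_addE scalerDl.
Qed.

HB.instance Definition _ := GRing.Zmodule_isLmodule.Build A quotmod
  quot_scaleA quot_scale1 quot_scaleDr quot_scaleDl.

Lemma qcl_is_linear : linear qcl.
Proof.
by move=> a x y; rewrite (quot_scaleE a x : a *: qcl x = _) [RHS]quot_addE.
Qed.
HB.instance Definition _ := GRing.isLinear.Build A V quotmod *:%R qcl qcl_is_linear.

End QuotientModule.

Record bilin (A : comNzRingType) (M N X : lmodType A) (b : M -> N -> X) : Prop :=
  Bilin { bilinDl : forall m m' n, b (m + m') n = b m n + b m' n;
          bilinDr : forall m n n', b m (n + n') = b m n + b m n';
          bilinZl : forall a m n, b (a *: m) n = a *: b m n;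
          bilinZr : forall a m n, b m (a *: n) = a *: b m n }.

Section BilinTheory.
Variables (A : comNzRingType) (M N X : lmodType A) (b : M -> N -> X).
Hypothesis bb : bilin b.
Lemma bilin0l n : b 0 n = 0.
Proof. by rewrite -(scale0r 0) bilinZl // scale0r. Qed.
Lemma bilin0r m : b m 0 = 0.
Proof. by rewrite -(scale0r 0) bilinZr // scale0r. Qed.
Lemma bilinNl m n : b (- m) n = - b m n.
Proof. by rewrite -scaleN1r bilinZl // scaleN1r. Qed.
Lemma bilinNr m n : b m (- n) = - b m n.
Proof. by rewrite -scaleN1r bilinZr // scaleN1r. Qed.
End BilinTheory.

Section TensorProduct.
Variables (A : comNzRingType) (M N : lmodType A).

(* Formal sums of pairs; [:: (m_1, n_1); ...] stands for                      *)
(* m_1 (x) n_1 + ... and the relation below is the congruence generated by    *)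
(* the bilinearity relations.                                                 *)
Inductive tens_rel : seq (M * N) -> seq (M * N) -> Prop :=
| tens_refl s : tens_rel s s
| tens_sym s t : tens_rel s t -> tens_rel t s
| tens_trans s t u : tens_rel s t -> tens_rel t u -> tens_rel s u
| tens_cat s s' t t' :
    tens_rel s s' -> tens_rel t t' -> tens_rel (s ++ t) (s' ++ t')
| tens_comm s t : tens_rel (s ++ t) (t ++ s)
| tens_zero n : tens_rel [:: (0, n)] [::]
| tens_addl m m' n : tens_rel [:: (m + m', n)] [:: (m, n); (m', n)]
| tens_addr m n n' : tens_rel [:: (m, n + n')] [:: (m, n); (m, n')]
| tens_scale a m n : tens_rel [:: (a *: m, n)] [:: (m, a *: n)].

Definition tens_relb s t : bool := `[< tens_rel s t >].

Lemma tens_relb_refl : reflexive tens_relb.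
Proof. by move=> s; apply/asboolP; exact: tens_refl. Qed.
Lemma tens_relb_sym : symmetric tens_relb.
Proof. by move=> s t; apply/asboolP/asboolP; exact: tens_sym. Qed.
Lemma tens_relb_trans : transitive tens_relb.
Proof.
by move=> t s u /asboolP st /asboolP tu; apply/asboolP; exact: tens_trans st tu.
Qed.

Definition tens_equiv :=
  EquivRel tens_relb tens_relb_refl tens_relb_sym tens_relb_trans.

Definition tens := {eq_quot tens_equiv}.

HB.instance Definition _ := Choice.on tens.
HB.instance Definition _ := EqQuotient.on tens.

Definition tcl (s : seq (M * N)) : tens := \pi_tens s.

Lemma tclP s t : tcl s = tcl t <-> tens_rel s t.
Proof. by split => [/eqmodP /asboolP|st] //; apply/eqmodP/asboolP. Qed.

Lemma tcl_surj (c : tens) : exists s, tcl s = c.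
Proof. by exists (repr c); rewrite /tcl reprK. Qed.

Lemma repr_tcl s : tens_rel (repr (tcl s)) s.
Proof. by apply/tclP; rewrite {1}/tcl reprK. Qed.

Let scl (a : A) (s : seq (M * N)) := [seq (a *: p.1, p.2) | p <- s].

Lemma tens_rel_scale a s t : tens_rel s t -> tens_rel (scl a s) (scl a t).
Proof.
elim=> {s t} [s|s t _|s t u _ st _|s s' t t' _ IH _ IH'|s t|n|m m' n|m n n'|b m n].
- exact: tens_refl.
- exact: tens_sym.
- exact: tens_trans st.
- by rewrite /scl !map_cat; exact: tens_cat.
- by rewrite /scl !map_cat; exact: tens_comm.
- by rewrite /= scaler0; exact: tens_zero.
- by rewrite /= scalerDr; exact: tens_addl.
- exact: tens_addr.
- by rewrite /= scalerA mulrC -scalerA; exact: tens_scale.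
Qed.

Definition tens_add (c d : tens) := tcl (repr c ++ repr d).
Definition tens_scl (a : A) (c : tens) := tcl (scl a (repr c)).
Definition tens_opp := tens_scl (-1).

Lemma tens_addE s t : tens_add (tcl s) (tcl t) = tcl (s ++ t).
Proof. by apply/tclP; apply: tens_cat; exact: repr_tcl. Qed.
Lemma tens_sclE a s : tens_scl a (tcl s) = tcl (scl a s).
Proof. by apply/tclP; apply: tens_rel_scale; exact: repr_tcl. Qed.

Lemma tens_addA : associative tens_add.
Proof.
move=> c d e; have [x <-] := tcl_surj c; have [y <-] := tcl_surj d.
by have [z <-] := tcl_surj e; rewrite !tens_addE catA.
Qed.
Lemma tens_addC : commutative tens_add.
Proof.
move=> c d; have [x <-] := tcl_surj c; have [y <-] := tcl_surj d.
by rewrite !tens_addE; apply/tclP; exact: tens_comm.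
Qed.
Lemma tens_add0 : left_id (tcl [::]) tens_add.
Proof. by move=> c; have [x <-] := tcl_surj c; rewrite tens_addE. Qed.

Let scl_add a b s : tens_rel (scl (a + b) s) (scl a s ++ scl b s).
Proof.
elim: s => [|[m n] s IH] /=; first exact: tens_refl.
set p := (_, n); set u := scl a s; set v := scl b s.
set pa := (a *: m, n); set pb := (b *: m, n).
have pE : tens_rel [:: p] [:: pa; pb] by rewrite /p scalerDl; exact: tens_addl.
apply: tens_trans (tens_cat pE IH) _ => /=.
apply: (@tens_cat [:: pa] [:: pa] (pb :: u ++ v) (u ++ pb :: v)).
  exact: tens_refl.
rewrite (_ : u ++ pb :: v = (u ++ [:: pb]) ++ v); last by rewrite -catA.
exact: (@tens_cat (pb :: u) _ v v (tens_comm [:: pb] u) (tens_refl v)).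
Qed.

Let scl0 s : tens_rel (scl 0 s) [::].
Proof.
elim: s => [|[m n] s IH] /=; first exact: tens_refl.
apply/tclP; rewrite -cat1s -tens_addE; move/tclP: IH => ->.
by rewrite tens_addE cats0 scale0r; apply/tclP; exact: tens_zero.
Qed.

Let scl1 s : scl 1 s = s.
Proof. by rewrite /scl -[RHS]map_id; apply: eq_map => -[m n] /=; rewrite scale1r. Qed.

Lemma tens_addN : left_inverse (tcl [::]) tens_opp tens_add.
Proof.
move=> c; have [s <-] := tcl_surj c; rewrite /tens_opp tens_sclE tens_addE.
rewrite -{2}(scl1 s); apply/tclP; apply: tens_trans (tens_sym _) (scl0 s).
by rewrite -(addNr 1); exact: scl_add.
Qed.

HB.instance Definition _ :=
  GRing.isZmodule.Build tens tens_addA tens_addC tens_add0 tens_addN.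

Lemma tens_sclA a b c : tens_scl a (tens_scl b c) = tens_scl (a * b) c.
Proof.
have [s <-] := tcl_surj c; rewrite !tens_sclE /scl -map_comp.
by congr tcl; apply: eq_map => -[m n] /=; rewrite scalerA.
Qed.
Lemma tens_scl1 : left_id 1 tens_scl.
Proof. by move=> c; have [s <-] := tcl_surj c; rewrite tens_sclE scl1. Qed.
Lemma tens_sclDr : right_distributive tens_scl +%R.
Proof.
move=> a c d; have [s <-] := tcl_surj c; have [t <-] := tcl_surj d.
by rewrite [_ + _]tens_addE !tens_sclE [RHS]tens_addE /scl map_cat.
Qed.
Lemma tens_sclDl c : {morph tens_scl^~ c : a b / a + b}.
Proof.
move=> a b; have [s <-] := tcl_surj c.
by rewrite !tens_sclE [RHS]tens_addE; apply/tclP; exact: scl_add.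
Qed.

HB.instance Definition _ := GRing.Zmodule_isLmodule.Build A tens
  tens_sclA tens_scl1 tens_sclDr tens_sclDl.

Lemma tcl_cat s t : tcl (s ++ t) = tcl s + tcl t.
Proof. by rewrite [RHS]tens_addE. Qed.
Lemma tcl_scale a s : tcl [seq (a *: p.1, p.2) | p <- s] = a *: tcl s.
Proof. by rewrite [RHS]tens_sclE. Qed.

Definition tpure (m : M) (n : N) : tens := tcl [:: (m, n)].

Lemma tcl_sum s : tcl s = \sum_(p <- s) tpure p.1 p.2.
Proof.
elim: s => [|[m n] s IH]; first by rewrite big_nil.
by rewrite big_cons -cat1s tcl_cat IH.
Qed.

Lemma tpure_bilin : bilin tpure.
Proof.
split=> [m m' n|m n n'|a m n|a m n].
- by rewrite -tcl_cat; apply/tclP; exact: tens_addl.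
- by rewrite -tcl_cat; apply/tclP; exact: tens_addr.
- by rewrite /tpure -tcl_scale.
- rewrite /tpure -tcl_scale; apply/tclP; apply: tens_sym; exact: tens_scale.
Qed.

Lemma tens_rel_sum (X : lmodType A) (b : M -> N -> X) : bilin b ->
  forall s t, tens_rel s t -> \sum_(p <- s) b p.1 p.2 = \sum_(p <- t) b p.1 p.2.
Proof.
move=> bb s t.
elim=> {s t} [s|s t _|s t u _ st _|s s' t t' _ IH _ IH'|s t|n|m m' n|m n n'|a m n] //.
- by rewrite st.
- by rewrite !big_cat IH IH'.
- by rewrite !big_cat /= addrC.
- by rewrite big_seq1 big_nil /= bilin0l.
- by rewrite big_seq1 !big_cons big_nil addr0 /= bilinDl.
- by rewrite big_seq1 !big_cons big_nil addr0 /= bilinDr.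
- by rewrite !big_seq1 /= bilinZl // bilinZr.
Qed.

End TensorProduct.

(* A complete separated linearly topologized k[[h]]-module: the submodules    *)
(* filt n form a basis of neighbourhoods of 0.  The objects of the category A *)
(* are the cmods with filt n = h^n V that are topologically free, see in_A.   *)
(* The general notion is needed for H', which carries the topology induced by *)
(* the h-adic topology of H: e.g. for H = U(g)[[h]] the coproduct of H' does  *)
(* not take values in the tensor product completed with respect to the powers *)
(* h^n H', but in the one completed with respect to the subspaces H' :&: h^n H*)
(* that define the induced topology.                                          *)
Record cmod (k : fieldType) := Cmod {
  cmod_mod :> lmodType (fps k);
  filt : nat -> cmod_mod -> Prop;
  filt_submod : forall n, submod (filt n);
  filt_le : forall n x, filt n.+1 x -> filt n x;
  filt_hX : forall n x, filt n (hvar ^+ n *: x);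
  filt_sep : forall x, (forall n, filt n x) -> x = 0;
  filt_compl : forall u : nat -> cmod_mod,
    (forall n, filt n (u n.+1 - u n)) -> exists x, forall n, filt n (x - u n)
}.
Arguments filt {k} V n x : rename.

Section CmodTheory.
Variables (k : fieldType) (V : cmod k).
Implicit Types x y : V.

Lemma filt0 n : filt V n 0. Proof. exact: submod0 (filt_submod _ _). Qed.
Lemma filtD n x y : filt V n x -> filt V n y -> filt V n (x + y).
Proof. exact: submodD (filt_submod _ _) _ _. Qed.
Lemma filtZ n a x : filt V n x -> filt V n (a *: x).
Proof. exact: submodZ (filt_submod _ _) _ _. Qed.
Lemma filtB n x y : filt V n x -> filt V n y -> filt V n (x - y).
Proof. exact: submodB (filt_submod _ _) _ _. Qed.
Lemma filtBC n x y : filt V n (x - y) -> filt V n (y - x).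
Proof. exact: submodBC (filt_submod _ _) _ _. Qed.
Lemma filtBT n x y z : filt V n (x - y) -> filt V n (y - z) -> filt V n (x - z).
Proof. exact: submodBT (filt_submod _ _) _ _ _. Qed.
Lemma filt_sum n I (s : seq I) (F : I -> V) :
  (forall i, filt V n (F i)) -> filt V n (\sum_(i <- s) F i).
Proof. exact: (submod_sum (filt_submod V n)). Qed.
Lemma filt_leq m n x : (m <= n)%N -> filt V n x -> filt V m x.
Proof.
elim: n => [|n IH]; first by rewrite leqn0 => /eqP ->.
by rewrite leq_eqVlt => /predU1P[-> //|mn] /filt_le; exact: IH.
Qed.
Lemma filt_eq x y : (forall n, filt V n (x - y)) -> x = y.
Proof. by move=> /filt_sep /eqP; rewrite subr_eq0 => /eqP. Qed.
End CmodTheory.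

Record chom (k : fieldType) (V W : cmod k) := Chom {
  chom_map :> {linear V -> W};
  chom_cont : forall n, exists m, forall x, filt V m x -> filt W n (chom_map x)
}.

Definition is_modulus (k : fieldType) (V W X : cmod k) (b : V -> W -> X) n m :=
  (forall v w, filt V m v -> filt X n (b v w)) /\
  (forall v w, filt W m w -> filt X n (b v w)).

Record bihom (k : fieldType) (V W X : cmod k) := Bihom {
  bihom_map :> V -> W -> X;
  bihom_bilin : bilin bihom_map;
  bihom_cont : forall n, exists m, is_modulus bihom_map n m
}.

Section Homs.
Variable k : fieldType.
Implicit Types V W X Y : cmod k.

Definition mk_chom V W (f : V -> W) (lf : linear f)
    (cf : forall n, exists m, forall x, filt V m x -> filt W n (f x)) : chom V W :=
  @Chom k V W (HB.pack f (GRing.isLinear.Build _ V W *:%R f lf)) cf.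

Lemma chom_id_linear V : linear (fun x : V => x). Proof. by []. Qed.
Lemma chom_id_cont V n : exists m, forall x, filt V m x -> filt V n x.
Proof. by exists n. Qed.
Definition chom_id V : chom V V := mk_chom (@chom_id_linear V) (@chom_id_cont V).

Lemma chom_comp_linear V W X (f : chom W X) (g : chom V W) :
  linear (fun x => f (g x)).
Proof. by move=> a x y; rewrite !linearP. Qed.
Lemma chom_comp_cont V W X (f : chom W X) (g : chom V W) n :
  exists m, forall x, filt V m x -> filt X n (f (g x)).
Proof.
have [m fm] := chom_cont f n; have [p gp] := chom_cont g m.
by exists p => x /gp /fm.
Qed.
Definition chom_comp V W X (f : chom W X) (g : chom V W) : chom V X :=
  mk_chom (chom_comp_linear f g) (chom_comp_cont f g).

Lemma chom_idE V (x : V) : chom_id V x = x. Proof. by []. Qed.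
Lemma chom_compE V W X (f : chom W X) (g : chom V W) x :
  chom_comp f g x = f (g x).
Proof. by []. Qed.

Lemma chom_add_linear V W (f g : chom V W) : linear (fun x => f x + g x).
Proof. by move=> a x y /=; rewrite !linearD !linearZ /= addrACA. Qed.
Lemma chom_add_cont V W (f g : chom V W) n :
  exists m, forall x, filt V m x -> filt W n (f x + g x).
Proof.
have [m fm] := chom_cont f n; have [p gp] := chom_cont g n.
exists (maxn m p) => x xmp; apply: filtD.
  by apply: fm; apply: filt_leq xmp; exact: leq_maxl.
by apply: gp; apply: filt_leq xmp; exact: leq_maxr.
Qed.
Definition chom_add V W (f g : chom V W) : chom V W :=
  mk_chom (chom_add_linear f g) (chom_add_cont f g).

Lemma chom_scale_linear V W a (f : chom V W) : linear (fun x => a *: f x).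
Proof. by move=> b x y /=; rewrite linearD linearZ /= scalerDr !scalerA mulrC. Qed.
Lemma chom_scale_cont V W a (f : chom V W) n :
  exists m, forall x, filt V m x -> filt W n (a *: f x).
Proof.
by have [m fm] := chom_cont f n; exists m => x /fm; exact: filtZ.
Qed.
Definition chom_scale V W a (f : chom V W) : chom V W :=
  mk_chom (chom_scale_linear a f) (chom_scale_cont a f).

Lemma bihom_comp_bilin V W X V' W' (b : bihom V W X) (f : chom V' V)
  (g : chom W' W) : bilin (fun v w => b (f v) (g w)).
Proof.
by have bb := bihom_bilin b; split=> *; rewrite ?linearD ?linearZ /=
  ?bilinDl ?bilinDr ?bilinZl ?bilinZr.
Qed.
Lemma bihom_comp_cont V W X V' W' (b : bihom V W X) (f : chom V' V)
  (g : chom W' W) n : exists m, is_modulus (fun v w => b (f v) (g w)) n m.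
Proof.
have [m [bm bm']] := bihom_cont b n.
have [p fp] := chom_cont f m; have [q gq] := chom_cont g m.
exists (maxn p q); split=> v w vw.
  by apply: bm; apply: fp; apply: filt_leq vw; exact: leq_maxl.
by apply: bm'; apply: gq; apply: filt_leq vw; exact: leq_maxr.
Qed.
Definition bihom_comp V W X V' W' (b : bihom V W X) (f : chom V' V)
    (g : chom W' W) : bihom V' W' X :=
  Bihom (bihom_comp_bilin b f g) (bihom_comp_cont b f g).

Lemma bihom_swap_bilin V W X (b : bihom V W X) : bilin (fun w v => b v w).
Proof.
by have bb := bihom_bilin b; split=> *;
  rewrite ?bilinDl ?bilinDr ?bilinZl ?bilinZr.
Qed.
Lemma bihom_swap_cont V W X (b : bihom V W X) n :
  exists m, is_modulus (fun w v => b v w) n m.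
Proof. by have [m [bl br]] := bihom_cont b n; exists m; split=> *; auto. Qed.
Definition bihom_swap V W X (b : bihom V W X) : bihom W V X :=
  Bihom (bihom_swap_bilin b) (bihom_swap_cont b).

Lemma bihom_app_linear V W X (b : bihom V W X) v : linear (b v).
Proof.
by move=> a x y; rewrite (bilinDr (bihom_bilin b)) (bilinZr (bihom_bilin b)).
Qed.
Lemma bihom_app_cont V W X (b : bihom V W X) v n :
  exists m, forall w, filt W m w -> filt X n (b v w).
Proof. by have [m [_ bm]] := bihom_cont b n; exists m => w; exact: bm. Qed.
Definition bihom_app V W X (b : bihom V W X) v : chom W X :=
  mk_chom (bihom_app_linear b v) (bihom_app_cont b v).

End Homs.

Section CompletedTensor.
Variables (k : fieldType) (V W : cmod k).

Definition lev (U : cmod k) n : lmodType (fps k) := quotmod (filt_submod U n).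
Definition lcl (U : cmod k) n (x : U) : lev U n := qcl (filt_submod U n) x.

(* (V / filt n) (x) (W / filt n).  Both factors are killed by h^n, so that the*)
(* tensor product over k[[h]] is the tensor product over k[[h]]/(h^n).        *)
Definition ltens n : lmodType (fps k) := tens (lev V n) (lev W n).

Definition lev_tr (U : cmod k) n (c : lev U n.+1) : lev U n := lcl n (repr c).
Definition ltens_tr n (c : ltens n.+1) : ltens n :=
  tcl [seq (lev_tr p.1, lev_tr p.2) | p <- repr c].

Lemma lev_trE (U : cmod k) n (x : U) : lev_tr (lcl n.+1 x) = lcl n x.
Proof. by apply/qclP; apply: filt_le; exact: repr_qcl. Qed.

Lemma lcl_surj (U : cmod k) n (c : lev U n) : exists x, lcl n x = c.
Proof. exact: qcl_surj. Qed.
Lemma lclP (U : cmod k) n (x y : U) : lcl n x = lcl n y <-> filt U n (x - y).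
Proof. exact: qclP. Qed.
Lemma lclD (U : cmod k) n (x y : U) : lcl n (x + y) = lcl n x + lcl n y.
Proof. exact: linearD. Qed.
Lemma lclZ (U : cmod k) n a (x : U) : lcl n (a *: x) = a *: lcl n x.
Proof. exact: linearZ. Qed.

Lemma lcl0 (U : cmod k) n : lcl n 0 = 0 :> lev U n.
Proof. exact: linear0. Qed.
Lemma lcl_eq0 (U : cmod k) n (x : U) : filt U n x -> lcl n x = 0.
Proof. by move=> xn; rewrite -lcl0; apply/lclP; rewrite subr0. Qed.

Lemma lev_trD (U : cmod k) n (c d : lev U n.+1) :
  lev_tr (c + d) = lev_tr c + lev_tr d.
Proof.
have [x <-] := lcl_surj c; have [y <-] := lcl_surj d.
by rewrite -lclD !lev_trE lclD.
Qed.
Lemma lev_trZ (U : cmod k) n a (c : lev U n.+1) : lev_tr (a *: c) = a *: lev_tr c.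
Proof. by have [x <-] := lcl_surj c; rewrite -lclZ !lev_trE lclZ. Qed.

Lemma ltens_tr_bilin n :
  bilin (fun (c : lev V n.+1) (d : lev W n.+1) => tpure (lev_tr c) (lev_tr d)).
Proof.
have bb := tpure_bilin (lev V n) (lev W n).
by split=> *; rewrite ?lev_trD ?lev_trZ ?bilinDl ?bilinDr ?bilinZl ?bilinZr.
Qed.

Lemma ltens_trE n s :
  ltens_tr (tcl s : ltens n.+1) = \sum_(p <- s) tpure (lev_tr p.1) (lev_tr p.2).
Proof.
rewrite /ltens_tr tcl_sum big_map /=.
exact: (tens_rel_sum (ltens_tr_bilin n)) (repr_tcl s).
Qed.

Lemma ltens_trD n (c d : ltens n.+1) : ltens_tr (c + d) = ltens_tr c + ltens_tr d.
Proof.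
have [s <-] := tcl_surj c; have [t <-] := tcl_surj d.
by rewrite -tcl_cat !ltens_trE big_cat.
Qed.
Lemma ltens_trZ n a (c : ltens n.+1) : ltens_tr (a *: c) = a *: ltens_tr c.
Proof.
have [s <-] := tcl_surj c; rewrite -tcl_scale !ltens_trE big_map scaler_sumr.
by apply: eq_bigr => p _ /=; rewrite (bilinZl (ltens_tr_bilin n)).
Qed.
Lemma ltens_tr0 n : ltens_tr (0 : ltens n.+1) = 0.
Proof. by rewrite -(scale0r 0) ltens_trZ scale0r. Qed.
Lemma ltens_trN n (c : ltens n.+1) : ltens_tr (- c) = - ltens_tr c.
Proof. by rewrite -scaleN1r ltens_trZ scaleN1r. Qed.
Lemma ltens_tr_pure n v w :
  ltens_tr (tpure (lcl n.+1 v) (lcl n.+1 w)) = tpure (lcl n v) (lcl n w).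
Proof. by rewrite /tpure ltens_trE big_seq1 !lev_trE. Qed.

(* The projective limit of the modules ltens n. *)
Record ctens_mod := CtensMod {
  ct_at : forall n, ltens n;
  ct_tr : forall n, ltens_tr (ct_at n.+1) = ct_at n
}.

HB.instance Definition _ := gen_eqMixin ctens_mod.
HB.instance Definition _ := gen_choiceMixin ctens_mod.

Lemma ctP x y : (forall n, ct_at x n = ct_at y n) -> x = y.
Proof.
case: x y => [x xP] [y yP] /= xy.
have {}xy : x = y by exact: functional_extensionality_dep.
by case: _ / xy yP => yP; congr CtensMod; exact: Prop_irrelevance.
Qed.

Definition ct_zero : ctens_mod := @CtensMod (fun n => 0) (fun n => ltens_tr0 n).
Lemma ct_add_tr x y n :
  ltens_tr (ct_at x n.+1 + ct_at y n.+1) = ct_at x n + ct_at y n.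
Proof. by rewrite ltens_trD !ct_tr. Qed.
Definition ct_add x y := CtensMod (ct_add_tr x y).
Lemma ct_opp_tr x n : ltens_tr (- ct_at x n.+1) = - ct_at x n.
Proof. by rewrite ltens_trN !ct_tr. Qed.
Definition ct_opp x := CtensMod (ct_opp_tr x).
Lemma ct_scale_tr a x n : ltens_tr (a *: ct_at x n.+1) = a *: ct_at x n.
Proof. by rewrite ltens_trZ !ct_tr. Qed.
Definition ct_scale a x := CtensMod (ct_scale_tr a x).

Lemma ct_addA : associative ct_add.
Proof. by move=> x y z; apply: ctP => n; rewrite /= addrA. Qed.
Lemma ct_addC : commutative ct_add.
Proof. by move=> x y; apply: ctP => n; rewrite /= addrC. Qed.
Lemma ct_add0 : left_id ct_zero ct_add.
Proof. by move=> x; apply: ctP => n; rewrite /= add0r. Qed.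
Lemma ct_addN : left_inverse ct_zero ct_opp ct_add.
Proof. by move=> x; apply: ctP => n; rewrite /= addNr. Qed.
HB.instance Definition _ :=
  GRing.isZmodule.Build ctens_mod ct_addA ct_addC ct_add0 ct_addN.

Lemma ct_scaleA a b x : ct_scale a (ct_scale b x) = ct_scale (a * b) x.
Proof. by apply: ctP => n; rewrite /= scalerA. Qed.
Lemma ct_scale1 : left_id 1 ct_scale.
Proof. by move=> x; apply: ctP => n; rewrite /= scale1r. Qed.
Lemma ct_scaleDr : right_distributive ct_scale +%R.
Proof. by move=> a x y; apply: ctP => n; rewrite /= scalerDr. Qed.
Lemma ct_scaleDl x : {morph ct_scale^~ x : a b / a + b}.
Proof. by move=> a b; apply: ctP => n; rewrite /= scalerDl. Qed.
HB.instance Definition _ := GRing.Zmodule_isLmodule.Build (fps k) ctens_mod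
  ct_scaleA ct_scale1 ct_scaleDr ct_scaleDl.

Definition ctens_filt n (x : ctens_mod) : Prop := ct_at x n = 0.

Lemma ctens_filt_submod n : submod (ctens_filt n).
Proof.
rewrite /ctens_filt; split=> [//|x y /= -> ->|a x /= ->]; first exact: addr0.
exact: scaler0.
Qed.
Lemma ctens_filt_le n x : ctens_filt n.+1 x -> ctens_filt n x.
Proof. by rewrite /ctens_filt -[in X in _ -> X]ct_tr => ->; exact: ltens_tr0. Qed.

Lemma ltens_hX n (c : ltens n) : hvar ^+ n *: c = 0.
Proof.
have [s <-] := tcl_surj c; rewrite tcl_sum scaler_sumr big1 // => -[x y] _ /=.
have bb := tpure_bilin (lev V n) (lev W n).
rewrite -(bilinZl bb); have [v <-] := lcl_surj x.
by rewrite -lclZ (lcl_eq0 (filt_hX _ _)) (bilin0l bb).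
Qed.
Lemma ctens_filt_hX n x : ctens_filt n (hvar ^+ n *: x).
Proof. exact: ltens_hX. Qed.
Lemma ctens_filt_sep x : (forall n, ctens_filt n x) -> x = 0.
Proof. by move=> x0; apply: ctP. Qed.
Lemma ctens_filt_compl (u : nat -> ctens_mod) :
  (forall n, ctens_filt n (u n.+1 - u n)) ->
  exists x, forall n, ctens_filt n (x - u n).
Proof.
move=> uP; have uE n : ct_at (u n.+1) n = ct_at (u n) n.
  by apply/eqP; rewrite -subr_eq0; apply/eqP; exact: uP.
have xP n : ltens_tr (ct_at (u n.+1) n.+1) = ct_at (u n) n.
  by rewrite ct_tr uE.
by exists (CtensMod xP) => n; rewrite /ctens_filt /=; exact: subrr.
Qed.

Definition ctens : cmod k := @Cmod k ctens_mod ctens_filt ctens_filt_submod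
  ctens_filt_le ctens_filt_hX ctens_filt_sep ctens_filt_compl.

Definition otimes (v : V) (w : W) : ctens :=
  @CtensMod (fun n => tpure (lcl n v) (lcl n w)) (fun n => ltens_tr_pure n v w).

Lemma otimes_bilin : bilin otimes.
Proof.
by split=> *; apply: ctP => n /=; have bb := tpure_bilin (lev V n) (lev W n);
  rewrite ?lclD ?lclZ ?bilinDl ?bilinDr ?bilinZl ?bilinZr.
Qed.
Lemma otimes_modulus n : is_modulus otimes n n.
Proof.
have bb := tpure_bilin (lev V n) (lev W n).
by split=> v w vw; rewrite /filt /= /ctens_filt /= (lcl_eq0 vw)
  ?(bilin0l bb) ?(bilin0r bb).
Qed.
Lemma otimes_cont n : exists m, is_modulus otimes n m.
Proof. by exists n; exact: otimes_modulus. Qed.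
Definition otimes_bihom : bihom V W ctens := Bihom otimes_bilin otimes_cont.

Definition osum (s : seq (V * W)) : ctens := \sum_(p <- s) otimes p.1 p.2.

Lemma osum_at s n : ct_at (osum s) n = tcl [seq (lcl n p.1, lcl n p.2) | p <- s].
Proof.
rewrite tcl_sum big_map /osum.
elim: s => [|p s IH]; first by rewrite !big_nil.
by rewrite !big_cons -IH.
Qed.

Lemma osum_dense (x : ctens) n : exists s, filt ctens n (x - osum s).
Proof.
have [s xs] := tcl_surj (ct_at x n).
exists [seq (repr p.1, repr p.2) | p <- s].
rewrite /filt /= /ctens_filt; apply/eqP; rewrite subr_eq0; apply/eqP.
rewrite osum_at -map_comp -xs; congr tcl.
rewrite -[LHS]map_id; apply: eq_map => -[c d] /=.
by rewrite /lcl /qcl !reprK.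
Qed.

End CompletedTensor.

Lemma osum_submod (k : fieldType) (V W : cmod k) (X : lmodType (fps k))
    (P : X -> Prop) (PX : submod P) (b : V -> W -> X) (bb : bilin b) m :
  (forall v w, filt V m v -> P (b v w)) ->
  (forall v w, filt W m w -> P (b v w)) ->
  forall s, filt (ctens V W) m (osum s) -> P (\sum_(p <- s) b p.1 p.2).
Proof.
move=> bl br s; rewrite /filt /= /ctens_filt osum_at => s0.
have {s0} /tclP := s0 : tcl _ = tcl [::].
pose q (c : lev V m) (d : lev W m) : quotmod PX := qcl PX (b (repr c) (repr d)).
have qE v w : q (lcl m v) (lcl m w) = qcl PX (b v w).
  apply/qclP; apply: (submodBT PX (y := b v (repr (lcl m w)))).
    by rewrite -(bilinNl bb) -(bilinDl bb); apply: bl; exact: repr_qcl.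
  by rewrite -(bilinNr bb) -(bilinDr bb); apply: br; exact: repr_qcl.
have qb : bilin q.
  split=> [c c' d|c d d'|a c d|a c d]; have [v <-] := lcl_surj c;
    have [w <-] := lcl_surj d.
  - have [v' <-] := lcl_surj c'.
    by rewrite -lclD !qE (bilinDl bb) linearD.
  - have [w' <-] := lcl_surj d'.
    by rewrite -lclD !qE (bilinDr bb) linearD.
  - by rewrite -lclZ !qE (bilinZl bb) linearZ.
  - by rewrite -lclZ !qE (bilinZr bb) linearZ.
move/(tens_rel_sum qb); rewrite big_nil big_map /= => qs.
suff /qclP : qcl PX (\sum_(p <- s) b p.1 p.2) = qcl PX 0 by rewrite subr0.
rewrite [RHS]linear0 -qs linear_sum.
by apply: eq_bigr => p _; rewrite qE.
Qed.

Section Lift.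
Variables (k : fieldType) (V W X : cmod k) (b : bihom V W X).
Let T := ctens V W.
Let bsum (s : seq (V * W)) : X := \sum_(p <- s) b p.1 p.2.

Let osum0_bsum n m s : is_modulus b n m -> filt T m (osum s) -> filt X n (bsum s).
Proof.
move=> [bl br]; exact: (osum_submod (filt_submod X n) (bihom_bilin b) bl br).
Qed.

Let scl (a : fps k) (s : seq (V * W)) : seq (V * W) := [seq (a *: p.1, p.2) | p <- s].
Let osumD (s t : seq (V * W)) : osum (s ++ t) = osum s + osum t.
Proof. exact: big_cat. Qed.
Let osumZ a s : osum (scl a s) = a *: osum s.
Proof.
rewrite /osum big_map scaler_sumr; apply: eq_bigr => p _ /=.
exact: (bilinZl (otimes_bilin V W)).
Qed.
Let bsumD s t : bsum (s ++ t) = bsum s + bsum t.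
Proof. exact: big_cat. Qed.
Let bsumZ a s : bsum (scl a s) = a *: bsum s.
Proof.
rewrite /bsum big_map scaler_sumr; apply: eq_bigr => p _ /=.
exact: (bilinZl (bihom_bilin b)).
Qed.

Let osum_bsum n m s t :
  is_modulus b n m -> filt T m (osum s - osum t) -> filt X n (bsum s - bsum t).
Proof.
move=> mn; rewrite -!scaleN1r -osumZ -osumD -bsumZ -bsumD; exact: osum0_bsum.
Qed.

Definition lift_spec (x : T) (y : X) := forall n, exists m, forall s,
  filt T m (x - osum s) -> filt X n (y - \sum_(p <- s) b p.1 p.2).

Lemma lift_spec_uniq x y y' : lift_spec x y -> lift_spec x y' -> y = y'.
Proof.
move=> xy xy'; apply: filt_eq => n; have [m ym] := xy n; have [m' ym'] := xy' n.
have [s xs] := osum_dense x (maxn m m').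
apply: (@filtBT _ _ _ _ (bsum s)).
  by apply: ym; apply: filt_leq xs; exact: leq_maxl.
by apply: filtBC; apply: ym'; apply: filt_leq xs; exact: leq_maxr.
Qed.

Lemma lift_spec_ex x : exists y, lift_spec x y.
Proof.
have /choice[m mP] := bihom_cont b.
have /choice[s sP] := osum_dense x.
pose M n := \max_(i < n.+1) m i.
have mM n : (m n <= M n)%N by exact: (leq_bigmax (ord_max : 'I_n.+1)).
have MS n : (M n <= M n.+1)%N by rewrite /M [X in (_ <= X)%N]big_ord_recr /= leq_maxl.
pose u n := bsum (s (M n)).
have [|y yP] := @filt_compl k X u.
  move=> n; apply: osum_bsum (mP n) _; apply: filt_leq (mM n) _.
  by apply: filtBT (sP _); apply: filtBC; apply: filt_leq (MS n) _.
exists y => n; exists (M n) => t xt; apply: filtBT (yP n) _.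
apply: osum_bsum (mP n) _; apply: filt_leq (mM n) _.
by apply: filtBT xt; apply: filtBC.
Qed.

Definition lift_fun (x : T) : X := projT1 (cid (lift_spec_ex x)).

Lemma lift_funP x : lift_spec x (lift_fun x).
Proof. exact: projT2 (cid (lift_spec_ex x)). Qed.

Lemma lift_linear : linear lift_fun.
Proof.
move=> a x y; apply: lift_spec_uniq (lift_funP _) _ => n.
have [mx xP] := lift_funP x n; have [my yP] := lift_funP y n.
have [m mP] := bihom_cont b n.
pose M := maxn m (maxn mx my); exists M => s sP.
have [sx xs] := osum_dense x M; have [sy ys] := osum_dense y M.
have {}xP : filt X n (lift_fun x - bsum sx).
  by apply: xP; apply: filt_leq xs; rewrite /M !leq_max leqnn !orbT.
have {}yP : filt X n (lift_fun y - bsum sy).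
  by apply: yP; apply: filt_leq ys; rewrite /M !leq_max leqnn !orbT.
apply: (@filtBT _ _ _ _ (bsum (scl a sx ++ sy))).
  rewrite bsumD bsumZ opprD addrACA -scalerBr; apply: filtD => //; exact: filtZ.
apply: osum_bsum mP _; apply: (@filt_leq _ _ m M); first exact: leq_maxl.
apply: filtBT sP; apply: filtBC; rewrite osumD osumZ opprD addrACA -scalerBr.
by apply: filtD => //; exact: filtZ.
Qed.

Lemma lift_modulus n m x : is_modulus b n m -> filt T m x -> filt X n (lift_fun x).
Proof.
move=> mP xm; have [p xP] := lift_funP x n.
have [s xs] := osum_dense x (maxn m p).
rewrite -(subrK (bsum s) (lift_fun x)); apply: filtD.
  by apply: xP; apply: filt_leq xs; exact: leq_maxr.
apply: osum0_bsum mP _; rewrite -(subKr x (osum s)); apply: filtB => //.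
by apply: filt_leq xs; exact: leq_maxl.
Qed.

Lemma lift_cont n : exists m, forall x, filt T m x -> filt X n (lift_fun x).
Proof.
by have [m mP] := bihom_cont b n; exists m => x; exact: lift_modulus.
Qed.

(* The continuous linear map with v (x) w |-> b v w, see lift_otimes. *)
Definition lift : chom (ctens V W) X := mk_chom lift_linear lift_cont.

Lemma lift_filt n m x : is_modulus b n m -> filt T m x -> filt X n (lift x).
Proof. exact: lift_modulus. Qed.

Lemma lift_otimes v w : lift (otimes v w) = b v w.
Proof.
apply: lift_spec_uniq (lift_funP _) _ => n.
have [m mP] := bihom_cont b n; exists m => s sP.
rewrite (_ : b v w = bsum [:: (v, w)]); last by rewrite /bsum big_seq1.
by apply: osum_bsum mP _; rewrite {1}/osum big_seq1.
Qed.

End Lift.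
Global Opaque lift.

Lemma ctens_ext (k : fieldType) (V W X : cmod k) (f g : chom (ctens V W) X) :
  (forall v w, f (otimes v w) = g (otimes v w)) -> f =1 g.
Proof.
move=> fg x; apply: filt_eq => n.
have [m fm] := chom_cont f n; have [p gp] := chom_cont g n.
have [s xs] := osum_dense x (maxn m p).
apply: (@filtBT _ _ _ _ (f (osum s))).
  rewrite -linearB; apply: fm; apply: filt_leq xs; exact: leq_maxl.
have -> : f (osum s) = g (osum s).
  by rewrite /osum !linear_sum; apply: eq_bigr => q _; exact: fg.
rewrite -linearB; apply: gp; apply: filtBC; apply: filt_leq xs; exact: leq_maxr.
Qed.

Section TensorStructure.
Variable k : fieldType.
Implicit Types U V W : cmod k.

Definition tmap V V' W W' (f : chom V V') (g : chom W W') :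
    chom (ctens V W) (ctens V' W') :=
  lift (bihom_comp (otimes_bihom V' W') f g).

Lemma tmapE V V' W W' (f : chom V V') (g : chom W W') v w :
  tmap f g (otimes v w) = otimes (f v) (g w).
Proof. exact: lift_otimes. Qed.

Definition flip V W : chom (ctens V W) (ctens W V) :=
  lift (bihom_swap (otimes_bihom W V)).

Lemma flipE V W (v : V) (w : W) : flip V W (otimes v w) = otimes w v.
Proof. exact: lift_otimes. Qed.

Definition assoc_aux V W U (u : U) : chom (ctens V W) (ctens V (ctens W U)) :=
  lift (bihom_comp (otimes_bihom V (ctens W U)) (chom_id V)
          (bihom_app (bihom_swap (otimes_bihom W U)) u)).

Lemma assoc_auxE V W U (u : U) v w :
  @assoc_aux V W U u (otimes v w) = otimes v (otimes w u).
Proof. exact: lift_otimes. Qed.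

Lemma assoc_bilin V W U : bilin (fun t u => @assoc_aux V W U u t).
Proof.
have bb := otimes_bilin W U; have bb' := otimes_bilin V (ctens W U).
split=> [t t' u|t u u'|a t u|a t u]; rewrite ?linearD ?linearZ //.
- rewrite -[RHS]/(chom_add (assoc_aux V W u) (assoc_aux V W u') t).
  move: t; apply: ctens_ext => v w /=.
  by rewrite !assoc_auxE (bilinDr bb) (bilinDr bb').
- rewrite -[RHS]/(chom_scale a (assoc_aux V W u) t).
  move: t; apply: ctens_ext => v w /=.
  by rewrite !assoc_auxE (bilinZr bb) (bilinZr bb').
Qed.

Lemma assoc_cont V W U n :
  exists m, is_modulus (fun t u => @assoc_aux V W U u t) n m.
Proof.
have [o1 o2] := otimes_modulus V (ctens W U) n.
have [p1 p2] := otimes_modulus W U n.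
have aP (u : U) t : filt _ n t -> filt _ n (assoc_aux V W u t).
  by apply: lift_filt; split=> v w vw; [exact: o1|apply: o2; exact: p1].
exists n; split=> t u tu; first exact: aP.
have [s ts] := osum_dense t n; rewrite -(subrK (osum s) t) linearD.
apply: filtD; first exact: aP.
rewrite linear_sum; apply: filt_sum => p; rewrite assoc_auxE.
by apply: o2; apply: p2.
Qed.

Definition assoc V W U : chom (ctens (ctens V W) U) (ctens V (ctens W U)) :=
  lift (Bihom (assoc_bilin V W U) (@assoc_cont V W U)).

Lemma assocE V W U (v : V) (w : W) (u : U) :
  assoc V W U (otimes (otimes v w) u) = otimes v (otimes w u).
Proof. by rewrite /assoc lift_otimes [LHS]assoc_auxE. Qed.

Definition assocV V W U : chom (ctens V (ctens W U)) (ctens (ctens V W) U) :=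
  chom_comp (tmap (flip W V) (chom_id U))
  (chom_comp (flip U (ctens W V))
  (chom_comp (assoc U W V)
  (chom_comp (tmap (flip W U) (chom_id V)) (flip V (ctens W U))))).

Lemma assocVE V W U (v : V) (w : W) (u : U) :
  assocV V W U (otimes v (otimes w u)) = otimes (otimes v w) u.
Proof.
by rewrite /assocV /= flipE tmapE flipE assocE flipE tmapE flipE.
Qed.

Opaque assocV.

Definition tmid V W V' W' :
    chom (ctens (ctens V W) (ctens V' W')) (ctens (ctens V V') (ctens W W')) :=
  chom_comp (assoc (ctens V V') W W')
  (chom_comp (tmap (assocV V V' W) (chom_id W'))
  (chom_comp (tmap (tmap (chom_id V) (flip W V')) (chom_id W'))
  (chom_comp (tmap (assoc V W V') (chom_id W')) (assocV (ctens V W) V' W')))).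

Lemma tmidE V W V' W' (v : V) (w : W) (v' : V') (w' : W') :
  tmid V W V' W' (otimes (otimes v w) (otimes v' w')) =
  otimes (otimes v v') (otimes w w').
Proof.
by rewrite /tmid !chom_compE !(tmapE, assocVE, assocE, flipE, chom_idE).
Qed.

End TensorStructure.

Section CategoryA.
Variable k : fieldType.
Implicit Types V W : cmod k.

Definition hdvd (M : lmodType (fps k)) n (x : M) : Prop :=
  exists y, x = hvar ^+ n *: y.

Lemma hdvd_submod (M : lmodType (fps k)) n : submod (@hdvd M n).
Proof.
split=> [|x y [x' ->] [y' ->]|a x [x' ->]]; first by exists 0; rewrite scaler0.
  by exists (x' + y'); rewrite scalerDr.
by exists (a *: x'); rewrite !scalerA mulrC.
Qed.

Definition hadic V : Prop := forall n x, filt V n x <-> hdvd n x.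

(* M is isomorphic to M0[[h]] for some k-vector space M0. *)
Definition topfree (M : lmodType (fps k)) : Prop :=
  exists (M0 : lmodType k) (phi : M -> nat -> M0),
    [/\ bijective phi,
        forall x y n, phi (x + y) n = phi x n + phi y n &
        forall a x n, phi (a *: x) n = \sum_(i < n.+1) coef a i *: phi x (n - i)%N].

(* For such V every k[[h]]-linear map is continuous. *)
Definition in_A V : Prop := hadic V /\ topfree V.

(* Thus iterated tensor products of objects of A are again taken with respect *)
(* to the h-adic topologies.                                                  *)
Lemma ctens_hadic V W : hadic V -> hadic W -> hadic (ctens V W).
Proof.
move=> hV hW n x; split; last by case=> y ->; exact: filt_hX.
have step m (z : ctens V W) :
    exists t, filt _ m z -> filt _ m.+1 (z - hvar ^+ m *: t).
  have [s zs] := osum_dense z m.+1.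
  have [zm|zm] := pselect (filt _ m z); last by exists 0.
  have os := osum_submod (hdvd_submod (ctens V W) m) (otimes_bilin V W) (m := m).
  have [|||t st] := os _ _ s.
  - move=> v w /hV[v' ->]; exists (otimes v' w).
    exact: (bilinZl (otimes_bilin V W)).
  - move=> v w /hW[w' ->]; exists (otimes v w').
    exact: (bilinZr (otimes_bilin V W)).
  - by rewrite -(subKr z (osum s)); apply: filtB => //; exact: filt_le.
  by exists t => _; rewrite -st.
have {step} /choice[g gP] : forall p : nat * ctens V W, exists t,
    filt _ p.1 p.2 -> filt _ p.1.+1 (p.2 - hvar ^+ p.1 *: t).
  by move=> p; exact: step.
move=> xn.
pose r := fix r i : ctens V W :=
  if i is j.+1 then r j - hvar ^+ (n + j) *: g (n + j, r j)%N else x.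
have rP i : filt _ (n + i) (r i).
  elim: i => [|i IH]; first by rewrite addn0.
  by rewrite addnS; exact: (gP (n + i, r i)%N).
pose u i := \sum_(j < i) hvar ^+ j *: g (n + j, r j)%N.
have rE i : r i = x - hvar ^+ n *: u i.
  elim: i => [|i IH]; first by rewrite /u big_ord0 scaler0 subr0.
  by rewrite /u big_ord_recr /= scalerDr opprD addrA -IH scalerA exprD.
have [y yP] : exists y, forall i, filt _ i (y - u i).
  apply: filt_compl => i; rewrite /u big_ord_recr /= addrAC subrr add0r.
  exact: (@filt_hX _ (ctens V W)).
exists y; apply: filt_eq => i.
rewrite -(subrK (hvar ^+ n *: u i) x) -rE -addrA -scalerBr; apply: filtD.
  by apply: filt_leq (rP i); exact: leq_addl.
by apply: filtZ; apply: filtBC; exact: yP.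
Qed.

Lemma hdvdP n (a : (fps k)^o) : hdvd n a <-> forall i, (i < n)%N -> coef a i = 0.
Proof.
split=> [[b ->] i ilt|an]; first by rewrite [LHS](coef_hXM n b i) ilt.
exists (Fps (fun i => coef a (n + i))); apply: fpsP => i.
by rewrite [RHS]coef_hXM; case: ltnP => [/an //|ni]; rewrite /= subnKC.
Qed.

Lemma cunit_le n (a : (fps k)^o) : hdvd n.+1 a -> hdvd n a.
Proof. by move=> /hdvdP aP; apply/hdvdP => i ilt; apply: aP; exact: ltnW. Qed.
Lemma cunit_hX n (a : (fps k)^o) : hdvd n (hvar ^+ n *: a).
Proof. by exists a. Qed.
Lemma cunit_sep (a : (fps k)^o) : (forall n, hdvd n a) -> a = 0.
Proof. by move=> aP; apply: fpsP => n; have /hdvdP -> := aP n.+1. Qed.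
Lemma cunit_compl (u : nat -> (fps k)^o) : (forall n, hdvd n (u n.+1 - u n)) ->
  exists x, forall n, hdvd n (x - u n).
Proof.
move=> uP; exists (Fps (fun i => coef (u i.+1) i)) => n; apply/hdvdP => i ilt.
have uE m : (i < m)%N -> coef (u m) i = coef (u i.+1) i.
  elim: m => // m IH; rewrite ltnS leq_eqVlt => /predU1P[-> //|im].
  rewrite -IH //; apply/eqP; rewrite -subr_eq0; apply/eqP.
  exact: (hdvdP _ _).1 (uP m) i im.
by rewrite /= uE // subrr.
Qed.

Definition cunit : cmod k := @Cmod k (fps k)^o (fun n => @hdvd _ n)
  (@hdvd_submod _) cunit_le cunit_hX cunit_sep cunit_compl.

Lemma cscale_bilin V : bilin (fun (c : cunit) (v : V) => (c : fps k) *: v).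
Proof.
split=> [c c' v|c v v'|a c v|a c v].
- exact: scalerDl.
- exact: scalerDr.
- by rewrite -scalerA.
- by rewrite !scalerA mulrC.
Qed.
Lemma cscale_cont V n :
  exists m, is_modulus (fun (c : cunit) (v : V) => (c : fps k) *: v) n m.
Proof.
exists n; split=> [c v [d ->]|c v]; last exact: filtZ.
by rewrite -scalerA; exact: filt_hX.
Qed.
Definition cscale V : bihom cunit V V := Bihom (cscale_bilin V) (@cscale_cont V).

End CategoryA.

Record alg_ops (k : fieldType) (V : cmod k) := AlgOps {
  amul : chom (ctens V V) V;
  aone : V
}.

Definition aprod (k : fieldType) (V : cmod k) (A : alg_ops V) (x y : V) : V :=
  amul A (otimes x y).

Record is_alg (k : fieldType) (V : cmod k) (A : alg_ops V) : Prop := IsAlg {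
  aprodA : associative (aprod A);
  aprod1l : left_id (aone A) (aprod A);
  aprod1r : right_id (aone A) (aprod A)
}.

Definition is_alg_hom (k : fieldType) (V W : cmod k) (A : alg_ops V)
    (B : alg_ops W) (f : V -> W) : Prop :=
  {morph f : x y / aprod A x y >-> aprod B x y} /\ f (aone A) = aone B.

Definition is_alg_aut (k : fieldType) (V : cmod k) (A : alg_ops V)
    (f : chom V V) : Prop :=
  is_alg_hom A A f /\ exists g : chom V V, cancel f g /\ cancel g f.

Definition alg_tens (k : fieldType) (V W : cmod k) (A : alg_ops V)
    (B : alg_ops W) : alg_ops (ctens V W) :=
  AlgOps (chom_comp (tmap (amul A) (amul B)) (tmid V W V W))
         (otimes (aone A) (aone B)).

Lemma aprod_tens (k : fieldType) (V W : cmod k) (A : alg_ops V) (B : alg_ops W)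
    v w v' w' :
  aprod (alg_tens A B) (otimes v w) (otimes v' w') =
  otimes (aprod A v v') (aprod B w w').
Proof. by rewrite /aprod chom_compE tmidE tmapE. Qed.

Record hopf (k : fieldType) (H : cmod k) := Hopf {
  hopf_alg :> alg_ops H;
  comul : chom H (ctens H H);
  counit : chom H (cunit k);
  antipode : chom H H;
  hopf_algP : is_alg hopf_alg;
  comul_alg : is_alg_hom hopf_alg (alg_tens hopf_alg hopf_alg) comul;
  counitM : forall x y,
    counit (aprod hopf_alg x y) = (counit x : fps k) * (counit y : fps k);
  counit1 : counit (aone hopf_alg) = (1 : fps k);
  comulA : forall x, assoc H H H (tmap comul (chom_id H) (comul x)) =
                     tmap (chom_id H) comul (comul x);
  comul1l : forall x,
    tmap counit (chom_id H) (comul x) = otimes (1 : cunit k) x;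
  comul1r : forall x,
    tmap (chom_id H) counit (comul x) = otimes x (1 : cunit k);
  antipodel : forall x, amul hopf_alg (tmap antipode (chom_id H) (comul x)) =
                        (counit x : fps k) *: aone hopf_alg;
  antipoder : forall x, amul hopf_alg (tmap (chom_id H) antipode (comul x)) =
                        (counit x : fps k) *: aone hopf_alg
}.

Definition is_hopf_hom (k : fieldType) (H K : cmod k) (S : hopf H) (T : hopf K)
    (f : chom H K) : Prop :=
  [/\ is_alg_hom S T f,
      forall x, comul T (f x) = tmap f f (comul S x),
      forall x, counit T (f x) = counit S x &
      forall x, antipode T (f x) = f (antipode S x)].

Section Braidings.
Variables (k : fieldType) (H : cmod k) (S : hopf H).

Definition tens2 := ctens H H.
Definition tens3 := ctens (ctens H H) H.
Definition alg2 : alg_ops tens2 := alg_tens S S.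
Definition alg3 : alg_ops tens3 := alg_tens (alg_tens S S) S.

Definition comul_id : chom tens2 tens3 := tmap (comul S) (chom_id H).
Definition id_comul : chom tens2 tens3 :=
  chom_comp (assocV H H H) (tmap (chom_id H) (comul S)).

Definition flip12 : chom tens3 tens3 := tmap (flip H H) (chom_id H).

Definition elt12 (R : tens2) : tens3 := otimes R (aone S).
Definition elt23 (R : tens2) : tens3 := assocV H H H (otimes (aone S) R).
Definition elt13 (R : tens2) : tens3 := flip12 (elt23 R).

Record is_Rmatrix (R Rinv : tens2) : Prop := IsRmatrix {
  Rmatrix_invr : aprod alg2 R Rinv = aone alg2;
  Rmatrix_invl : aprod alg2 Rinv R = aone alg2;
  Rmatrix_comul : forall a,
    aprod alg2 (aprod alg2 R (comul S a)) Rinv = flip H H (comul S a);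
  Rmatrix_comul_id : comul_id R = aprod alg3 (elt13 R) (elt23 R);
  Rmatrix_id_comul : id_comul R = aprod alg3 (elt13 R) (elt12 R)
}.

Definition Ad (R Rinv x : tens2) : tens2 := aprod alg2 (aprod alg2 R x) Rinv.

Definition op12 (B : chom tens2 tens2) : chom tens3 tens3 := tmap B (chom_id H).
Definition op23 (B : chom tens2 tens2) : chom tens3 tens3 :=
  chom_comp (assocV H H H) (chom_comp (tmap (chom_id H) B) (assoc H H H)).
Definition op13 (B : chom tens2 tens2) : chom tens3 tens3 :=
  chom_comp flip12 (chom_comp (op23 B) flip12).

(* The conditions on a braiding operator other than being different from the  *)
(* flip.                                                                      *)
Record braiding_identities (B : chom tens2 tens2) : Prop := BraidingIdentities {
  braiding_aut : is_alg_aut alg2 B;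
  braiding_comul : forall a, B (comul S a) = flip H H (comul S a);
  braiding_comul_id : forall x,
    comul_id (B x) = op13 B (op23 B (comul_id x));
  braiding_id_comul : forall x,
    id_comul (B x) = op13 B (op12 B (id_comul x))
}.

Definition is_braiding (B : chom tens2 tens2) : Prop :=
  braiding_identities B /\ ~ (B =1 flip H H).

End Braidings.

Section Delta.
Variables (k : fieldType) (H : cmod k) (S : hopf H).

(* H^{(x) n}, bracketed to the left; tpow 0 = k[[h]], tpow 1 = H. *)
Fixpoint tpow n : cmod k :=
  if n is n'.+1 then (if n' is 0 then H else ctens (tpow n') H) else cunit k.

Definition snoc n : bihom (tpow n) H (tpow n.+1) :=
  match n with
  | 0 => cscale H
  | n'.+1 => otimes_bihom (tpow n'.+1) H
  end.

Definition snoc1 n : chom (tpow n) (tpow n.+1) :=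
  bihom_app (bihom_swap (snoc n)) (aone S).

(* f (x) Id *)
Definition snoc_map m n : chom (tpow m) (tpow n) -> chom (tpow m.+1) (tpow n.+1) :=
  match m with
  | 0 => fun f => bihom_app (snoc n) (f (1 : cunit k))
  | m'.+1 => fun f => lift (bihom_comp (snoc n) f (chom_id H))
  end.

Fixpoint pcount (p : pred nat) n : nat :=
  if n is n'.+1 then
    if p n' then (pcount p n').+1 else pcount p n'
  else 0%N.

(* j_Sigma for Sigma = {i < n | p i}, of cardinal pcount p n; positions are   *)
(* numbered from 0.                                                           *)
Fixpoint place (p : pred nat) n : chom (tpow (pcount p n)) (tpow n) :=
  match n with
  | 0 => chom_id (cunit k)
  | n'.+1 =>
    match p n' as b return
      chom (tpow (if b then (pcount p n').+1 else pcount p n')) (tpow n'.+1) with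
    | true => snoc_map (place p n')
    | false => chom_comp (snoc1 n') (place p n')
    end
  end.

(* Delta (x) Id^{(x) n} *)
Fixpoint comul_first n : chom (tpow n.+1) (tpow n.+2) :=
  match n with
  | 0 => comul S
  | n'.+1 => tmap (comul_first n') (chom_id H)
  end.

Fixpoint comul_iter n : chom H (tpow n) :=
  match n with
  | 0 => counit S
  | n'.+1 =>
    match n' return chom H (tpow n') -> chom H (tpow n'.+1) with
    | 0 => fun _ => chom_id H
    | n''.+1 => fun f => chom_comp (comul_first n'') f
    end (comul_iter n')
  end.

Definition mem_nat n (s : {set 'I_n}) : pred nat :=
  fun i => if insub i is Some j then j \in s else false.

Lemma pcount_mem n (s : {set 'I_n}) : pcount (mem_nat s) n = #|s|.
Proof.
have pE m p : pcount p m = (\sum_(i < m) p i)%N.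
  elim: m => [|m IH]; first by rewrite big_ord0.
  by rewrite big_ord_recr /= -IH; case: (p m); rewrite ?addn1 ?addn0.
rewrite pE -sum1_card [RHS]big_mkcond /=; apply: eq_bigr => i _.
by rewrite /mem_nat valK; case: (i \in s).
Qed.

Definition comul_set n (s : {set 'I_n}) : chom H (tpow n) :=
  chom_comp (place (mem_nat s) n) (comul_iter (pcount (mem_nat s) n)).

Definition delta n (a : H) : tpow n :=
  \sum_(s : {set 'I_n}) (-1) ^+ (n - #|s|)%N *: comul_set s a.

Definition in_Hprime (a : H) : Prop :=
  forall n, (0 < n)%N -> hdvd n (delta n a).

Lemma delta_linear n : linear (@delta n).
Proof.
move=> c a b; rewrite /delta scaler_sumr -big_split /=; apply: eq_bigr => s _.
by rewrite !linearD !linearZ /= !scalerA [X in X *: _]mulrC.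
Qed.

Lemma delta0 n : delta n 0 = 0.
Proof.
by have := delta_linear n (-1) 0 0; rewrite scaler0 addr0 scaleN1r addNr.
Qed.

Lemma in_Hprime_submod : submod in_Hprime.
Proof.
have dP n := @hdvd_submod k (tpow n) n.
split=> [n _|a b aP bP n n0|c a aP n n0].
- by rewrite delta0; exact: submod0 (dP n).
- rewrite -(scale1r a) delta_linear scale1r; apply: submodD (dP n) _ _ _ _; auto.
- rewrite -(addr0 (c *: a)) delta_linear delta0 addr0.
  by apply: submodZ (dP n) _ _ _; auto.
Qed.

Record Hprime_mod := HprimeMod { Hprime_val : H; Hprime_valP : in_Hprime Hprime_val }.

HB.instance Definition _ := gen_eqMixin Hprime_mod.
HB.instance Definition _ := gen_choiceMixin Hprime_mod.

Lemma Hprime_val_inj : injective Hprime_val.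
Proof.
move=> [x xP] [y yP] /= xy.
by case: _ / xy yP => yP; congr HprimeMod; exact: Prop_irrelevance.
Qed.

Definition Hprime_zero := HprimeMod (submod0 in_Hprime_submod).
Definition Hprime_add x y :=
  HprimeMod (submodD in_Hprime_submod (Hprime_valP x) (Hprime_valP y)).
Definition Hprime_opp x := HprimeMod (submodN in_Hprime_submod (Hprime_valP x)).
Definition Hprime_scale a x := HprimeMod (submodZ in_Hprime_submod a (Hprime_valP x)).

Lemma Hprime_addA : associative Hprime_add.
Proof. by move=> x y z; apply: Hprime_val_inj; rewrite /= addrA. Qed.
Lemma Hprime_addC : commutative Hprime_add.
Proof. by move=> x y; apply: Hprime_val_inj; rewrite /= addrC. Qed.
Lemma Hprime_add0 : left_id Hprime_zero Hprime_add.
Proof. by move=> x; apply: Hprime_val_inj; rewrite /= add0r. Qed.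
Lemma Hprime_addN : left_inverse Hprime_zero Hprime_opp Hprime_add.
Proof. by move=> x; apply: Hprime_val_inj; rewrite /= addNr. Qed.
HB.instance Definition _ :=
  GRing.isZmodule.Build Hprime_mod Hprime_addA Hprime_addC Hprime_add0 Hprime_addN.

Lemma Hprime_scaleA a b x : Hprime_scale a (Hprime_scale b x) = Hprime_scale (a * b) x.
Proof. by apply: Hprime_val_inj; rewrite /= scalerA. Qed.
Lemma Hprime_scale1 : left_id 1 Hprime_scale.
Proof. by move=> x; apply: Hprime_val_inj; rewrite /= scale1r. Qed.
Lemma Hprime_scaleDr : right_distributive Hprime_scale +%R.
Proof. by move=> a x y; apply: Hprime_val_inj; rewrite /= scalerDr. Qed.
Lemma Hprime_scaleDl x : {morph Hprime_scale^~ x : a b / a + b}.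
Proof. by move=> a b; apply: Hprime_val_inj; rewrite /= scalerDl. Qed.
HB.instance Definition _ := GRing.Zmodule_isLmodule.Build (fps k) Hprime_mod
  Hprime_scaleA Hprime_scale1 Hprime_scaleDr Hprime_scaleDl.

Definition Hprime_filt n (x : Hprime_mod) : Prop := filt H n (Hprime_val x).

Lemma Hprime_filt_submod n : submod (Hprime_filt n).
Proof.
split=> [|x y xP yP|a x xP]; [exact: filt0|exact: filtD|exact: filtZ].
Qed.
Lemma Hprime_filt_le n x : Hprime_filt n.+1 x -> Hprime_filt n x.
Proof. exact: filt_le. Qed.
Lemma Hprime_filt_hX n x : Hprime_filt n (hvar ^+ n *: x).
Proof. exact: filt_hX. Qed.
Lemma Hprime_filt_sep x : (forall n, Hprime_filt n x) -> x = 0.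
Proof. by move=> xP; apply: Hprime_val_inj; exact: filt_sep. Qed.

Hypothesis HA : in_A H.

Lemma Hprime_filt_compl (u : nat -> Hprime_mod) :
  (forall n, Hprime_filt n (u n.+1 - u n)) ->
  exists x, forall n, Hprime_filt n (x - u n).
Proof.
move=> uP; have [x xP] := @filt_compl k H (fun n => Hprime_val (u n)) uP.
have xH' : in_Hprime x.
  move=> n n0; have [y xy] := (HA.1 n (x - Hprime_val (u n))).1 (xP n).
  have dP := @hdvd_submod k (tpow n) n.
  rewrite -(subrK (Hprime_val (u n)) x) xy delta_linear; apply: (submodD dP).
    by exists (delta n y).
  exact: Hprime_valP.
by exists (HprimeMod xH') => n; exact: xP.
Qed.

Definition Hprime : cmod k := @Cmod k Hprime_mod Hprime_filt Hprime_filt_submod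
  Hprime_filt_le Hprime_filt_hX Hprime_filt_sep Hprime_filt_compl.

Lemma Hprime_incl_linear : linear (fun x : Hprime => Hprime_val x : H).
Proof. by []. Qed.
Lemma Hprime_incl_cont n :
  exists m, forall x : Hprime, filt Hprime m x -> filt H n (Hprime_val x).
Proof. by exists n. Qed.

Definition Hprime_incl : chom Hprime H := mk_chom Hprime_incl_linear Hprime_incl_cont.

End Delta.

(* Main.v *)
(* Let u = eta eps + h(id - eta eps), called shrink below: an injective map   *)
(* H -> H with image k1 + hH.  Expanding the iterated coproduct along         *)
(* H = k1 + ker eps shows that a lies in H' if and only if Delta^n(a) lies in *)
(* the image of u^(x n) for all n >= 1.  Hence H' is the largest subcoalgebra *)
(* of H contained in k1 + hH, which makes it stable under products and the    *)
(* antipode.  The space V of x in H (x) H with (Delta^m (x) Delta^n)(x) in    *)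
(* the image of u^(x m) (x) u^(x n) for all m, n is the completed tensor      *)
(* product H' (x) H', by approximation with bases of H adapted to H'.  As     *)
(* R = 1 mod h, Ad(R) is the identity mod h and fixes 1 (x) 1, so it          *)
(* preserves the image of u (x) u; the braiding identities express            *)
(* (Delta^m (x) Delta^n) o Ad(R) as a product of copies of Ad(R) acting on    *)
(* two legs each, after Delta^m (x) Delta^n.  Hence Ad(R) and its inverse     *)
(* preserve V = H' (x) H'.                                                    *)

From HB Require Import structures.
From mathcomp Require Import all_boot all_order all_algebra.
From mathcomp Require Import boolp zify.
From mathcomp Require classical_sets.
Require Import Defs.

Set Implicit Arguments.
Unset Strict Implicit.
Unset Printing Implicit Defensive.

Import GRing.Theory.
Local Open Scope ring_scope.

(** * Topologically free modules *)

(** Write u for [shrink], which is the identity on constants and multiplication by h on ker eps. The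
    definition of [H'] is a divisibility condition on each delta_n(a); [in_HprimeP] replaces it by
    the condition that all iterated coproducts of a lie in the images of the powers u^(x n). In this
    form it is inherited through every operation that is compatible with coproducts and preserves
    those images.

    The criterion for tensors is [tensor_in_Hprime]. It needs analysis, because H' (x) H' is
    completed for the topology induced from H and H / H' may have h-torsion. [adapted_approx] plays
    the role of the elementary divisor theorem: it gives vectors e_a and forms mu_a with h^(i_a) e_a
    in H' and mu_a(H') in h^(i_a) k[[h]]. Contracting with such forms, [tensor_image] recognises the
    elements of H' (x) H', and [emb_tmap] shows that this space embeds in H (x) H.

    The Hopf structure of H' ([Hprime_hopf]) follows: the coproduct from the tensor criterion,
    product and unit from [subcoalgebra_in_Hprime], the antipode by successive approximation.

    By [R1], Ad(R) = id + h N, and Ad(R) fixes 1 (x) 1, so it preserves the image of u (x) u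
    ([deform_shrink]). The braiding identities of Ad(R) ([Adc_braiding]) spread this to all pairs of
    tensor powers ([transported_comul_iter]), whence [braiding_Hprime] for Ad(R) and its inverse.
    The identities restrict by injectivity ([restrict_braiding_identities]), and reduction modulo h
    separates Ad(R) from the flip on nonscalar elements ([deform_not_flip]). *)

Section Subspaces.
Variables (K : fieldType) (M : lmodType K).
Implicit Types P : M -> Prop.

Lemma subspace_complement P : submod P -> exists Q : M -> Prop,
  [/\ submod Q, forall x, P x -> Q x -> x = 0 &
      forall x, exists2 y, Q y & P (x - y)].
Proof.
move=> PP.
pose good (Q : classical_sets.set M) := (forall a x y, Q x -> Q y -> Q (a *: x + y)) /\
  (forall x, P x -> Q x -> x = 0).
have [|A [[Alin AP] Amax]] := @classical_sets.Zorn_bigcup M good.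
  move=> F Fgood Ftot; split=> [a x y [X FX Xx] [Y FY Yy]|x Px [X FX Xx]].
    have [XY|YX] := Ftot _ _ FX FY.
      by exists Y => //; apply: (Fgood _ FY).1 => //; exact: XY.
    by exists X => //; apply: (Fgood _ FX).1 => //; exact: YX.
  exact: (Fgood _ FX).2.
have maxA (B : classical_sets.set M) : good B -> (forall x, A x -> B x) -> forall x, B x -> A x.
  move=> gB AB x Bx; apply: contrapT => nAx.
  by apply: (Amax B _ gB); split => // BA; apply: nAx; exact: BA.
(* The empty set is [good] (it is the union of the empty chain), so [A 0] has to be extracted from
   maximality. *)
have A0 : A 0.
  apply: (maxA (fun x => A x \/ x = 0)); [split|by left|by right].
    move=> a x y [Ax|->] [Ay|->]; [by left; exact: Alin| | |].
    - by left; rewrite addr0 -[a](subrK 1) scalerDl scale1r; exact: Alin.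
    - by left; rewrite scaler0 add0r.
    - by right; rewrite scaler0 addr0.
  by move=> x Px [Ax|//]; exact: AP.
have AZ a x : A x -> A (a *: x) by move=> Ax; rewrite -[_ *: _]addr0; exact: Alin.
have AD x y : A x -> A y -> A (x + y).
  by move=> Ax Ay; rewrite -[x]scale1r; exact: Alin.
have AN x : A x -> A (- x) by rewrite -scaleN1r; exact: AZ.
exists A; split => // x; apply: contrapT => nx.
(* Adjoin x to A. An element z + b x of P with b nonzero would put x in A + P, against the choice of
   x. *)
pose B : classical_sets.set M := fun z => exists a y, A y /\ z = y + a *: x.
suff Ax : A x by apply: nx; exists x => //; rewrite subrr; exact: submod0.
apply: (maxA B); first split.
- move=> a _ _ [b [y [Ay ->]]] [c [z [Az ->]]].
  exists (a * b + c), (a *: y + z); split; first exact: Alin.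
  by rewrite scalerDr scalerDl addrACA scalerA.
- move=> w Pz [b [z [Az zE]]].
  have [a0|a0] := eqVneq b 0.
    by move: Pz; rewrite zE a0 scale0r addr0 => Pz; exact: AP.
  case: nx; exists (- b^-1 *: z); first exact: AZ.
  rewrite scaleNr opprK -[x]scale1r -(mulVf a0) -scalerA -scalerDr addrC.
  by apply: submodZ => //; rewrite -zE.
- by move=> y Ay; exists 0, y; rewrite scale0r addr0.
- by exists 1, 0; rewrite scale1r add0r.
Qed.

Lemma subspace_projection P : submod P -> exists r : M -> M,
  [/\ linear r, forall x, P (x - r x) & forall x, P x -> r x = 0].
Proof.
move=> PP; have [Q [QQ PQ PQs]] := subspace_complement PP.
have /choice[r rP] : forall x, exists y, Q y /\ P (x - y).
  by move=> x; have [y] := PQs x; exists y.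
have uniq x y y' : Q y -> Q y' -> P (x - y) -> P (x - y') -> y = y'.
  move=> Qy Qy' xy xy'; apply/eqP; rewrite -subr_eq0; apply/eqP.
  apply: PQ; last exact: submodB.
  by apply: (submodBT PP (y := x)) => //; exact: submodBC.
exists r; split=> [a x y|x|x Px]; last 2 first.
- exact: (rP x).2.
- apply: (uniq x) (rP x).1 _ (rP x).2 _; first exact: submod0.
  by rewrite subr0.
- apply: (uniq (a *: x + y)) (rP _).1 _ (rP _).2 _.
    by apply: submodD => //; [apply: submodZ => //|]; exact: (rP _).1.
  rewrite opprD addrACA -scalerBr.
  by apply: submodD => //; [apply: submodZ => //|]; exact: (rP _).2.
Qed.

(** The coordinate along w in a decomposition of M into the line K w and a complement. *)
Lemma linear_form_one (w : M) : w != 0 ->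
  exists nu : M -> K, (forall a x y, nu (a *: x + y) = a * nu x + nu y) /\ nu w = 1.
Proof.
move=> w0; have LP : submod (fun x => exists c, x = c *: w).
  split=> [|x y [c ->] [d ->]|a x [c ->]]; first by exists 0; rewrite scale0r.
    by exists (c + d); rewrite scalerDl.
  by exists (a * c); rewrite scalerA.
have [r [rl rP r0]] := subspace_projection LP.
have /choice[nu nuP] := rP.
have winj c d : c *: w = d *: w -> c = d.
  move=> /eqP; rewrite -subr_eq0 -scalerBl scaler_eq0 (negPf w0) orbF subr_eq0.
  by move=> /eqP.
exists nu; split=> [a x y|]; apply: winj; last first.
  by rewrite -nuP r0 ?subr0 ?scale1r //; exists 1; rewrite scale1r.
by rewrite scalerDl -scalerA -!nuP rl scalerBr opprD addrACA.
Qed.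
End Subspaces.

Section FormalSeries.
Variable k : fieldType.
Implicit Types (a b : k) (f u : fps k).

Definition fps_const a : fps k := Fps (fun n => if n is 0 then a else 0).
Definition fps_shift f : fps k := Fps (fun n => coef f n.+1).

Lemma fps_constM : {morph fps_const : a b / a * b}.
Proof.
move=> a b; apply: fpsP => n /=; rewrite big_ord_recl /= subn0 big1 ?addr0.
  by case: n; rewrite ?mulr0.
by move=> i _; rewrite mul0r.
Qed.
Lemma fps_constD : {morph fps_const : a b / a + b}.
Proof. by move=> a b; apply: fpsP => -[|n] //=; rewrite addr0. Qed.
Lemma fps_const1 : fps_const 1 = 1.
Proof. by apply: fpsP => -[]. Qed.
Lemma fps_const_shift f : f = fps_const (coef f 0) + hvar * fps_shift f.
Proof.
apply: fpsP => n; change (coef f n = coef (fps_const (coef f 0)) n +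
  coef (hvar * fps_shift f) n); rewrite coef_hM.
by case: n => [|n]; rewrite /= ?addr0 ?add0r.
Qed.

(** Geometric series in - h w, summed by the completeness of [cunit]. *)
Lemma fps_inverse u : coef u 0 = 1 -> exists v, v * u = 1.
Proof.
move=> u0; pose w := fps_shift u.
have uE : u = 1 + hvar * w by rewrite {1}(fps_const_shift u) u0 fps_const1.
pose s n : cunit k := \sum_(i < n) (- (hvar * w)) ^+ i.
have hd n : hdvd n ((- (hvar * w)) ^+ n : (fps k)^o).
  by exists ((- w) ^+ n); rewrite -mulrN exprMn.
have sE n : s n * u = 1 - (- (hvar * w)) ^+ n.
  by rewrite -[RHS]opprB subrX1 -mulNr opprB mulrC uE opprK.
have [v vP] : exists v, forall n, filt (cunit k) n (v - s n).
  by apply: filt_compl => n; rewrite /s big_ord_recr /= addrAC subrr add0r; exact: hd.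
exists v; apply: (@filt_eq _ (cunit k)) => n; apply: (@filtBT k (cunit k) n (v * u) (s n * u) 1).
  by rewrite -mulrBl mulrC; exact: filtZ (vP n).
rewrite sE addrAC subrr add0r; apply: (submodN (filt_submod (cunit k) n)); exact: hd.
Qed.
End FormalSeries.

(** Divisibility is taken inside L. For a submodule of some V this is the submodule's own h-adic
    topology, which can be finer than the induced one. *)
Record hcomplete (k : fieldType) (L : lmodType (fps k)) : Prop := HComplete {
  htorsionfree : forall x : L, hvar *: x = 0 -> x = 0;
  hseparated : forall x : L, (forall n, hdvd n x) -> x = 0;
  hlimit : forall u : nat -> L,
    (forall n, hdvd n (u n.+1 - u n)) -> exists x, forall n, hdvd n (x - u n)
}.

Section Restriction.
Variables (k : fieldType) (L : lmodType (fps k)).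

Definition kres : Type := L.
HB.instance Definition _ := GRing.Zmodule.on kres.

Definition kscale (a : k) (x : kres) : kres := fps_const a *: (x : L).
Lemma kscaleA a b x : kscale a (kscale b x) = kscale (a * b) x.
Proof. by rewrite /kscale scalerA fps_constM. Qed.
Lemma kscale1 : left_id 1 kscale.
Proof. by move=> x; rewrite /kscale fps_const1 scale1r. Qed.
Lemma kscaleDr : right_distributive kscale +%R.
Proof. by move=> a x y; rewrite /kscale [LHS]scalerDr. Qed.
Lemma kscaleDl x : {morph kscale^~ x : a b / a + b}.
Proof. by move=> a b; rewrite /kscale fps_constD [LHS]scalerDl. Qed.
HB.instance Definition _ :=
  GRing.Zmodule_isLmodule.Build k kres kscaleA kscale1 kscaleDr kscaleDl.

Lemma hdvd1_ksubmod : submod (fun x : kres => hdvd 1 (x : L)).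
Proof.
have P := @hdvd_submod k L 1.
by split=> [|x y|a x]; [exact: (submod0 P)|exact: (submodD P)|exact: (submodZ P)].
Qed.
End Restriction.

Section Topfree.
Variables (k : fieldType) (L : lmodType (fps k)).
Hypothesis LP : hcomplete L.

Lemma hinj n (x y : L) : hvar ^+ n *: x = hvar ^+ n *: y -> x = y.
Proof.
move=> /eqP; rewrite -subr_eq0 -scalerBr => /eqP xy.
apply/eqP; rewrite -subr_eq0; apply/eqP; elim: n xy => [|n IH].
  by rewrite expr0 scale1r.
by rewrite exprS -scalerA => /(htorsionfree LP).
Qed.

(* L/hL has a k-linear section sigma, and every x has a unique expansion      *)
(* sum_n h^n sigma(c_n): c_0 is the class of x, and T x is the rest.          *)
Lemma hcomplete_topfree : topfree L.
Proof.
have [r [rD rZ rP r0]] : exists r : L -> L,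
    [/\ forall x y, r (x + y) = r x + r y,
        forall a x, r (fps_const a *: x) = fps_const a *: r x,
        forall x, hdvd 1 (x - r x) & forall x, hdvd 1 x -> r x = 0].
  have [r [rl rP r0]] := subspace_projection (@hdvd1_ksubmod k L).
  have rZD a (x y : L) :
      r (fps_const a *: x + y) = (fps_const a *: (r x : L) + r y :> L) by exact: rl.
  have r00 : r 0 = 0 by apply: r0; exists 0; rewrite scaler0.
  exists r; split => // [x y|a x].
    by have := rZD 1 x y; rewrite fps_const1 !scale1r.
  by have := rZD a x 0; rewrite r00 !addr0.
have /choice[T TP] : forall x : L, exists y : L, x - r x = hvar *: y.
  by move=> x; have [y yE] := rP x; exists y; rewrite yE expr1.
have rT (x y z : L) : r z = r x -> z - r x = hvar *: y -> T z = y.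
  by move=> rzx xy; apply: (@hinj 1); rewrite expr1 -TP -xy rzx.
have rh (x : L) : r (hvar *: x) = 0 by apply: r0; exists x; rewrite expr1.
have rr (x : L) : r (r x) = r x.
  by have := rD (x - r x) (r x); rewrite subrK (r0 _ (rP x)) add0r => /esym.
pose M0 := quotmod (@hdvd1_ksubmod k L).
pose cl (x : L) : M0 := qcl (@hdvd1_ksubmod k L) x.
pose sg (c : M0) : L := r (repr c).
have clD (x y : L) : cl (x + y) = cl x + cl y by exact: linearD.
have clZ a (x : L) : cl (fps_const a *: x) = a *: cl x.
  by rewrite /cl -linearZ.
have clr (x : L) : cl (r x) = cl x.
  by apply/qclP; apply: (submodBC (@hdvd1_ksubmod k L)); exact: rP.
have cl0r (x : L) : cl x = 0 -> r x = 0.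
  move=> x0; apply: r0; suff : hdvd 1 (x - 0) by rewrite subr0.
  by apply/(qclP (@hdvd1_ksubmod k L)); rewrite [RHS]linear0.
have clsg c : cl (sg c) = c.
  by rewrite clr /cl /qcl reprK.
have rsg c : r (sg c) = sg c by exact: rr.
have clh (x : L) : cl (hvar *: x) = 0.
  by rewrite -clr rh /cl linear0.
have TD (x y : L) : T (x + y) = T x + T y.
  apply: (rT (x + y)) => //; rewrite rD opprD addrACA !TP scalerDr //.
have TZ a (x : L) : T (fps_const a *: x) = fps_const a *: T x.
  apply: (rT (fps_const a *: x)) => //.
  by rewrite rZ -scalerBr TP !scalerA mulrC.
have Th (x : L) : T (hvar *: x) = x.
  by apply: (rT (hvar *: x)) => //; rewrite rh subr0.
pose phi x n := cl (iter n T x).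
have phiS x n : phi x n.+1 = phi (T x) n by rewrite /phi iterSr.
have phiD x y n : phi (x + y) n = phi x n + phi y n.
  by rewrite /phi; elim: n x y => [|n IH] x y; [exact: clD|rewrite !iterSr TD].
have phiC a x n : phi (fps_const a *: x) n = a *: phi x n.
  by rewrite /phi; elim: n x => [|n IH] x; [exact: clZ|rewrite !iterSr TZ].
have phiZ n a x : phi (a *: x) n = \sum_(i < n.+1) coef a i *: phi x (n - i)%N.
  elim: n a x => [|n IH] a x.
    rewrite big_ord1 /phi /= {1}(fps_const_shift a) scalerDl clD clZ.
    by rewrite -scalerA clh addr0.
  have -> : a *: x = fps_const (coef a 0) *: x + hvar *: (fps_shift a *: x).
    by rewrite scalerA -scalerDl -fps_const_shift.
  by rewrite phiD phiC [phi (hvar *: _) _]phiS Th IH [RHS]big_ord_recl.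
have phi0 x : (forall n, phi x n = 0) -> x = 0.
  move=> x0; apply: (hseparated LP) => n; exists (iter n T x).
  elim: n => [|n IH]; first by rewrite scale1r.
  by rewrite exprSr -scalerA -TP cl0r ?subr0 //; exact: x0.
have phi_inj : injective phi.
  move=> x y xy; apply/eqP; rewrite -subr_eq0; apply/eqP; apply: phi0 => n.
  rewrite -[x](subrK y) in xy; have := congr1 (@^~ n) xy; rewrite phiD.
  by move=> /eqP; rewrite -subr_eq0 addrK => /eqP.
have lim (c : nat -> M0) : exists x : L, forall n,
    hdvd n (x - \sum_(i < n) hvar ^+ i *: sg (c i)).
  apply: (hlimit LP) => n; rewrite big_ord_recr /= addrAC subrr add0r.
  by exists (sg (c n)).
have /choice[l lP] := lim.
(* Splitting off the first term gives the recursion that [T] undoes, so [phi (l c) = c] follows by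
   induction on the index. *)
have lS c : l c = sg (c 0%N) + hvar *: l (c \o succn).
  apply/eqP; rewrite -subr_eq0; apply/eqP; apply: (hseparated LP) => n.
  have -> : l c - (sg (c 0%N) + hvar *: l (c \o succn)) =
      (l c - \sum_(i < n.+1) hvar ^+ i *: sg (c i)) -
      hvar *: (l (c \o succn) - \sum_(i < n) hvar ^+ i *: sg (c i.+1)).
    rewrite big_ord_recl expr0 scale1r scalerBr scaler_sumr.
    under [X in _ = _ - (_ - X)]eq_bigr do rewrite scalerA -exprS.
    by rewrite opprB !opprD !addrA subrK.
  have [z ->] := lP c n.+1; have [y ->] := lP (c \o succn) n.
  exists (hvar *: z - hvar *: y).
  by rewrite scalerBr !scalerA exprSr [hvar * _]mulrC.
have phil c : phi (l c) = c.
  apply: funext => n; elim: n c => [|n IH] c; rewrite lS.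
    by rewrite phiD /phi /= clh addr0 clsg.
  have Tsg : T (sg (c 0%N)) = 0.
    by apply: (rT (sg (c 0%N))) => //; rewrite rsg subrr scaler0.
  by rewrite phiS TD Tsg Th add0r IH.
exists M0, phi; split => //.
by exists l => // x; apply: phi_inj.
Qed.

(** The leading coefficient of w in M0 is nonzero. A k-linear form equal to 1 on it, applied to all
    coefficients, is a k[[h]]-form whose value at w has constant term 1; dividing by this unit
    normalises it. *)
Lemma topfree_linear_form (w : L) : ~ hdvd 1 w ->
  exists mu : L -> (fps k)^o, linear mu /\ mu w = 1.
Proof.
have [M0 [phi [[psi phiK psiK] phiD phiZ]]] := hcomplete_topfree => w1.
have phih x n : phi (hvar *: x) n = if n is m.+1 then phi x m else 0.
  rewrite phiZ; case: n => [|n]; first by rewrite big_ord1 /= scale0r.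
  rewrite !big_ord_recl /= scale0r add0r scale1r subn1 big1 ?addr0 // => i _.
  by rewrite scale0r.
have w0 : phi w 0%N != 0.
  apply/eqP => w0; apply: w1; exists (psi (fun n => phi w n.+1)); rewrite expr1.
  apply: (can_inj phiK); apply: funext => n.
  by rewrite phih; case: n => [|n]; rewrite ?psiK.
have [nu [nuP nuw]] := linear_form_one w0.
have nu0 : nu 0 = 0 by have := nuP (-1) 0 0; rewrite scaler0 addr0 mulN1r addNr.
have nuD x y : nu (x + y) = nu x + nu y by have := nuP 1 x y; rewrite scale1r mul1r.
have nuZ a x : nu (a *: x) = a * nu x by have := nuP a x 0; rewrite nu0 !addr0.
pose mu x : (fps k)^o := Fps (fun n => nu (phi x n)).
have mul : linear mu.
  move=> a x y; apply: fpsP => n /=; rewrite phiD phiZ nuD; congr (_ + _).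
  by rewrite (big_morph nu nuD nu0); apply: eq_bigr => i _; rewrite nuZ.
have [v vmu] : exists v : fps k, v * mu w = 1 by apply: fps_inverse; exact: nuw.
exists (fun x => v *: mu x); split => // a x y.
by rewrite mul scalerDr !scalerA mulrC.
Qed.
End Topfree.

Definition good (k : fieldType) (V : cmod k) : Prop :=
  hadic V /\ forall x : V, hvar *: x = 0 -> x = 0.

Section Good.
Variables (k : fieldType) (V : cmod k).

Lemma in_A_good : in_A V -> good V.
Proof.
move=> [hV [M0 [phi [[psi phiK psiK] phiD phiZ]]]]; split=> // x hx0.
have phi0 n : phi 0 n = 0.
  by apply: (addrI (phi 0 n)); rewrite -phiD !addr0.
apply: (can_inj phiK); apply: funext => n; rewrite phi0.
have := phi0 n.+1; rewrite -hx0 phiZ !big_ord_recl /= scale0r add0r scale1r subn1.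
by rewrite big1 ?addr0 // => i _; rewrite scale0r.
Qed.

Hypothesis gV : good V.

Lemma good_inj n (x y : V) : hvar ^+ n *: x = hvar ^+ n *: y -> x = y.
Proof.
move=> /eqP; rewrite -subr_eq0 -scalerBr => /eqP xy.
apply/eqP; rewrite -subr_eq0; apply/eqP; elim: n xy => [|n IH].
  by rewrite expr0 scale1r.
by rewrite exprS -scalerA => /gV.2.
Qed.

Lemma hadic_cont (W : cmod k) (f : V -> W) : linear f ->
  forall n, exists m, forall x, filt V m x -> filt W n (f x).
Proof.
move=> lf n; exists n => x /gV.1[y ->].
have f0 : f 0 = 0 by have := lf (-1) 0 0; rewrite scaler0 addr0 scaleN1r addNr.
by have := lf (hvar ^+ n) y 0; rewrite f0 !addr0 => ->; exact: filt_hX.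
Qed.

Definition closed (P : V -> Prop) : Prop :=
  forall x, (forall n, exists2 y, P y & filt V n (x - y)) -> P x.

(** A limit x in V of the u_n is not enough: x - u_n must be h^n times an element of L. If u_(n+1) -
    u_n = h^n y_n, this quotient is the tail sum of the h^i y_(n+i), which lies in L because the
    image is closed. *)
Lemma closed_image_hcomplete (L : lmodType (fps k)) (j : {linear L -> V}) :
  injective j -> closed (fun v => exists x, v = j x) -> hcomplete L.
Proof.
move=> jinj jcl; split=> [x hx|x xP|u uP].
- by apply: jinj; rewrite linear0; apply: gV.2; rewrite -linearZ hx linear0.
- apply: jinj; rewrite linear0; apply: filt_sep => n; have [y ->] := xP n.
  by rewrite linearZ; exact: filt_hX.
have /choice[y yP] := uP.
have [x xP] : exists x : V, forall n, filt V n (x - j (u n)).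
  by apply: filt_compl => n; rewrite -linearB yP linearZ; exact: filt_hX.
pose s n m := \sum_(i < m) hvar ^+ i *: y (n + i)%N.
have /choice[z zP] : forall n, exists z : L, forall m, filt V m (j z - j (s n m)).
  move=> n; have [z zP] : exists z : V, forall m, filt V m (z - j (s n m)).
    apply: filt_compl => m; rewrite /s big_ord_recr /= linearD addrAC subrr add0r.
    by rewrite linearZ; exact: filt_hX.
  have [|z' zE] := jcl z; last by exists z' => m; rewrite -zE.
  by move=> m; exists (j (s n m)) => //; exists (s n m).
have us n m : u (n + m)%N - u n = hvar ^+ n *: s n m.
  rewrite /s scaler_sumr; elim: m => [|m IH]; first by rewrite addn0 subrr big_ord0.
  by rewrite big_ord_recr /= -IH scalerA -exprD -yP addnS [RHS]addrC addrA subrK.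
have xE n : x - j (u n) = hvar ^+ n *: j (z n).
  apply: filt_eq => m.
  have -> : x - j (u n) - hvar ^+ n *: j (z n) =
      (x - j (u (n + m)%N)) - hvar ^+ n *: (j (z n) - j (s n m)).
    have jus : hvar ^+ n *: j (s n m) = j (u (n + m)%N) - j (u n).
      by rewrite -linearB us linearZ.
    by rewrite scalerBr jus opprB addrA subrKA addrAC.
  apply: filtB; last by apply: filtZ.
  by apply: filt_leq (xP _); exact: leq_addl.
exists (u 0%N + z 0%N) => n; exists (z n); apply: jinj.
rewrite linearB linearD linearZ /= -xE; congr (_ - _).
by have := xE 0%N; rewrite scale1r => <-; rewrite addrC subrK.
Qed.
End Good.

Section Submodules.
Variables (A : comNzRingType) (V : lmodType A) (P : V -> Prop) (PP : submod P).

Record subm := Subm { subm_val : V; subm_valP : P subm_val }.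

HB.instance Definition _ := gen_eqMixin subm.
HB.instance Definition _ := gen_choiceMixin subm.

Lemma subm_val_inj : injective subm_val.
Proof.
move=> [x xP] [y yP] /= xy.
by case: _ / xy yP => yP; congr Subm; exact: Prop_irrelevance.
Qed.

(** The proof of [submod P] is an argument so that the module structure can be inferred from the
    type. *)
Definition subm_of of submod P := subm.
HB.instance Definition _ := Choice.on (subm_of PP).
Local Notation T := (subm_of PP).

Definition subm_zero : T := Subm (submod0 PP).
Definition subm_add (x y : T) : T := Subm (submodD PP (subm_valP x) (subm_valP y)).
Definition subm_opp (x : T) : T := Subm (submodN PP (subm_valP x)).
Definition subm_scale a (x : T) : T := Subm (submodZ PP a (subm_valP x)).

Lemma subm_addA : associative subm_add.
Proof. by move=> x y z; apply: subm_val_inj; rewrite /= addrA. Qed.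
Lemma subm_addC : commutative subm_add.
Proof. by move=> x y; apply: subm_val_inj; rewrite /= addrC. Qed.
Lemma subm_add0 : left_id subm_zero subm_add.
Proof. by move=> x; apply: subm_val_inj; rewrite /= add0r. Qed.
Lemma subm_addN : left_inverse subm_zero subm_opp subm_add.
Proof. by move=> x; apply: subm_val_inj; rewrite /= addNr. Qed.
HB.instance Definition _ :=
  GRing.isZmodule.Build T subm_addA subm_addC subm_add0 subm_addN.

Lemma subm_scaleA a b x : subm_scale a (subm_scale b x) = subm_scale (a * b) x.
Proof. by apply: subm_val_inj; rewrite /= scalerA. Qed.
Lemma subm_scale1 : left_id 1 subm_scale.
Proof. by move=> x; apply: subm_val_inj; rewrite /= scale1r. Qed.
Lemma subm_scaleDr : right_distributive subm_scale +%R.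
Proof. by move=> a x y; apply: subm_val_inj; rewrite /= scalerDr. Qed.
Lemma subm_scaleDl x : {morph subm_scale^~ x : a b / a + b}.
Proof. by move=> a b; apply: subm_val_inj; rewrite /= scalerDl. Qed.
HB.instance Definition _ := GRing.Zmodule_isLmodule.Build A T
  subm_scaleA subm_scale1 subm_scaleDr subm_scaleDl.

Definition subm_incl (x : T) : V := subm_val x.
Lemma subm_incl_linear : linear subm_incl.
Proof. by []. Qed.
HB.instance Definition _ :=
  GRing.isLinear.Build A T V *:%R subm_incl subm_incl_linear.
End Submodules.

(** * Vectors and linear forms adapted to a submodule *)

Section Forms.
Variables (k : fieldType) (V : cmod k) (gV : good V).

(* A linear form on the topologically free module L, precomposed with         *)
(* multiplication by h^i.                                                     *)
Lemma open_submodule_form i (L : V -> Prop) (LL : submod L) (e : V) :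
  (forall v, L (hvar ^+ i *: v)) -> (forall z, L z -> hvar ^+ i *: e <> hvar *: z) ->
  exists mu : chom V (cunit k), mu e = 1 /\ forall x, L x -> hdvd i (mu x).
Proof.
move=> Lh eh.
pose T := subm_of LL.
have Tc : hcomplete T.
  apply: (@closed_image_hcomplete _ _ gV T (@subm_incl _ _ _ LL)).
    exact: subm_val_inj.
  (* L contains h^i V, hence is open and therefore closed. *)
  move=> x /(_ i)[y [[z Lz] ->]] /gV.1[v xv]; have Lx : L x.
    by rewrite -[x](subrK z) xv; apply: submodD.
  by exists (Subm Lx).
have [|mu [lmu mu1]] := topfree_linear_form Tc (w := Subm (Lh e) : T).
  move=> [[z Lz]]; rewrite expr1 => /(congr1 (fun x : T => subm_val x)) /=.
  exact: eh.
pose f (x : V) : cunit k := mu (Subm (Lh x) : T).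
have lf : linear f.
  move=> a x y; rewrite /f -lmu; congr mu; apply: subm_val_inj => /=.
  by rewrite scalerDr !scalerA mulrC.
exists (mk_chom lf (hadic_cont gV lf)); split => // x Lx.
exists (mu (Subm Lx)).
have mu0 : mu 0 = 0 by have := lmu (-1) 0 0; rewrite scaler0 addr0 scaleN1r addNr.
have := lmu (hvar ^+ i) (Subm Lx : T) 0; rewrite mu0 !addr0 => <-.
by congr mu; apply: subm_val_inj.
Qed.

Variables (P : V -> Prop) (PP : submod P).

Let proj r (e : nat -> V) (mu : nat -> chom V (cunit k)) x : V :=
  \sum_(a < r) (mu a x : fps k) *: e a.

(** The two conditions make each operator x |-> mu_a(x) e_a, hence [proj], preserve P, although e_a
    itself need not lie in P. *)
Definition adapted (i : nat -> nat) (e : nat -> V) (mu : nat -> chom V (cunit k)) :=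
  forall a, P (hvar ^+ i a *: e a) /\ forall x, P x -> hdvd (i a) (mu a x).

Let projP r i e mu x : adapted i e mu -> P x -> P (proj r e mu x).
Proof.
move=> ad Px; apply: (submod_sum PP) => a; have [Pe] := ad a.
by move=> /(_ x Px)[c ->]; rewrite [_ *: c]mulrC -scalerA; exact: submodZ.
Qed.

Let proj_linear r e mu : linear (proj r e mu).
Proof.
move=> c x y; rewrite /proj scaler_sumr -big_split /=; apply: eq_bigr => a _.
by rewrite linearP /= scalerDl scalerA.
Qed.

(* Elimination step.  If x - p x = h^m w with w not in hV, the new vector     *)
(* f = w mod h is chosen with h^j f in P and j minimal; by minimality h^j f   *)
(* is not in h(P + h^j V), whence a form mu with mu f = 1 and mu(P) in        *)
(* h^j k[[h]].                                                                *)
Let adapted_step r i e mu (s : seq V) N x m : adapted i e mu ->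
  (forall y, proj r e mu (proj r e mu y) = proj r e mu y) ->
  (forall y, y \in s -> hdvd N (y - proj r e mu y)) ->
  P x -> hdvd m (x - proj r e mu x) ->
  exists r' i' e' mu', [/\ adapted i' e' mu',
    forall y, proj r' e' mu' (proj r' e' mu' y) = proj r' e' mu' y,
    forall y, y \in s -> hdvd N (y - proj r' e' mu' y) &
    hdvd m.+1 (x - proj r' e' mu' x)].
Proof.
move=> ad; set p := proj r e mu => pp ps Px [w xw].
have [[v wv]|w1] := pselect (hdvd 1 w).
  by exists r, i, e, mu; split => //; exists v; rewrite xw wv scalerA -exprD addn1.
have pL : linear p by exact: proj_linear.
have pD a y z : p (a *: y + z) = a *: p y + p z by exact: pL.
have p0 : p 0 = 0 by have := pD (-1) 0 0; rewrite scaler0 addr0 scaleN1r addNr.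
have pZ a y : p (a *: y) = a *: p y by have := pD a y 0; rewrite p0 !addr0.
have pB y z : p (y - z) = p y - p z by rewrite addrC -scaleN1r pD scaleN1r addrC.
have pw : p w = 0.
  by apply: (good_inj gV (n := m)); rewrite -pZ -xw pB pp subrr scaler0.
pose wit j := `[< exists2 f, P (hvar ^+ j *: f) & hdvd 1 (f - w) >].
have ex : exists j, wit j.
  exists m; apply/asboolP; exists w; last by exists 0; rewrite subrr scaler0.
  by rewrite -xw; apply: submodB => //; exact: projP.
have [j /asboolP[f0 Pf0 [z0 fw0]] jmin] := ex_minnP ex.
pose f := f0 - p f0.
have pf : p f = 0 by rewrite /f pB pp subrr.
have Pf : P (hvar ^+ j *: f).
  by rewrite scalerBr -pZ; apply: submodB => //; exact: projP.
have [z fw] : exists z, f - w = hvar *: z.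
  exists (z0 - p z0); rewrite scalerBr -pZ -[hvar]expr1 -fw0 pB pw subr0.
  by rewrite /f addrAC.
pose L y := exists u v, P u /\ y = u + hvar ^+ j *: v.
have LL : submod L.
  split=> [|_ _ [u [v [Pu ->]]] [u' [v' [Pu' ->]]]|a _ [u [v [Pu ->]]]].
  - by exists 0, 0; rewrite scaler0 addr0; split => //; exact: submod0.
  - by exists (u + u'), (v + v'); rewrite scalerDr addrACA; split => //; exact: submodD.
  - exists (a *: u), (a *: v); rewrite scalerDr !scalerA mulrC; split => //.
    exact: submodZ.
have [||nu [nuf nuL]] := @open_submodule_form j L LL f.
- by move=> v; exists 0, v; rewrite add0r; split => //; exact: submod0.
(* If h^j f = h (u + h^j v) with u in P, then for j > 0 the vector f - h v is a witness for j - 1,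
   and for j = 0 the vector w lies in hV. *)
- move=> _ [u [v [Pu ->]]] fE; case: (posnP j) => [j0|jpos].
    apply: w1; move: fE; rewrite j0 expr0 !scale1r => fE.
    by exists (u + v - z); rewrite expr1 scalerBr -fE -fw subKr.
  move: fE; rewrite -(prednK jpos) exprS -!scalerA => fE.
  have {}fE : hvar ^+ j.-1 *: f = u + hvar *: (hvar ^+ j.-1 *: v).
    by apply: (good_inj gV (n := 1)); rewrite expr1.
  suff /jmin : wit j.-1 by rewrite -ltnS prednK // ltnn.
  apply/asboolP; exists (f - hvar *: v).
    by rewrite scalerBr fE scalerA mulrC -scalerA addrK.
  by exists (z - v); rewrite expr1 scalerBr -fw addrAC.
(* Composition with id - p kills the image of p; together with p f = 0 this keeps the enlarged
   operator idempotent. *)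
pose g y : cunit k := nu (y - p y).
have lg : linear g.
  move=> a y y'; rewrite /g pD opprD addrACA -scalerBr; exact: linearP.
pose mu1 := mk_chom lg (hadic_cont gV lg).
pose i' a := if a == r then j else i a.
pose e' a := if a == r then f else e a.
pose mu' a := if a == r then mu1 else mu a.
have p'E y : proj r.+1 e' mu' y = p y + (nu (y - p y) : fps k) *: f.
  rewrite /proj big_ord_recr /= /mu' /e' eqxx; congr (_ + _).
  by apply: eq_bigr => a _; rewrite (ltn_eqF (ltn_ord a)).
exists r.+1, i', e', mu'; split.
- move=> a; rewrite /i' /e' /mu'; case: eqP => _; last exact: ad.
  split=> // y Py; apply: nuL; exists (y - p y), 0; rewrite scaler0 addr0; split => //.
  by apply: submodB => //; exact: projP.
- move=> y; rewrite !p'E; set c := nu (y - p y).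
  have -> : p (p y + (c : fps k) *: f) = p y by rewrite addrC pD pf scaler0 add0r pp.
  rewrite [p y + (c : fps k) *: f - p y]addrAC subrr add0r linearZ nuf.
  by congr (p y + _); congr (_ *: f); exact: mulr1.
- move=> y /ps[y' yE]; rewrite p'E opprD addrA yE; exists (y' - (nu y' : fps k) *: f).
  by rewrite [nu _]linearZ [RHS]scalerBr [in RHS]scalerA.
- exists ((nu z : fps k) *: f - z); rewrite p'E opprD addrA xw [nu _]linearZ /=.
  have wE : w = f - hvar *: z by rewrite -fw subKr.
  have -> : nu w = (1 - hvar *: nu z : cunit k) by rewrite wE linearB nuf linearZ.
  rewrite wE exprSr -!scalerA -scalerBr; congr (_ *: _).
  have -> : (1 - hvar *: nu z : fps k) *: f = f - hvar *: ((nu z : fps k) *: f).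
    by rewrite scalerBl scale1r scalerA.
  by rewrite [RHS]scalerBr opprB [LHS]addrC subrKA.
Qed.

(** Induction on s, and for each new vector on the precision m: an elimination step gains a power of
    h on that vector and keeps the precision h^N on the earlier ones. *)
Lemma adapted_approx N (s : seq V) : (forall x, x \in s -> P x) ->
  exists r i e mu, adapted i e mu /\
    forall x, x \in s -> hdvd N (x - \sum_(a < r) (mu a x : fps k) *: e a).
Proof.
move=> sP; suff [r [i [e [mu [ad _ sx]]]]] : exists r i e mu, [/\ adapted i e mu,
    forall y, proj r e mu (proj r e mu y) = proj r e mu y &
    forall y, y \in s -> hdvd N (y - proj r e mu y)].
  by exists r, i, e, mu.
elim: s sP => [|x s IH] sP.
  have l0 : linear (fun _ : V => 0 : cunit k) by move=> a x y; rewrite scaler0 addr0.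
  exists 0%N, (fun=> 0%N), (fun=> 0), (fun=> mk_chom l0 (hadic_cont gV l0)).
  split=> [a|y|//]; last by rewrite /proj !big_ord0.
    split=> [|x _]; first by rewrite scaler0; exact: submod0.
    by exists 0; rewrite scaler0.
have /IH[r [i [e [mu [ad pp ps]]]]] : forall y, y \in s -> P y.
  by move=> y ys; apply: sP; rewrite inE ys orbT.
have Px : P x by apply: sP; rewrite mem_head.
suff H m : exists r i e mu, [/\ adapted i e mu,
    forall y, proj r e mu (proj r e mu y) = proj r e mu y,
    forall y, y \in s -> hdvd N (y - proj r e mu y) & hdvd m (x - proj r e mu x)].
  have [r' [i' [e' [mu' [ad' pp' ps' px]]]]] := H N.
  by exists r', i', e', mu'; split => // y; rewrite inE => /predU1P[->|/ps'].
elim: m => [|m [r' [i' [e' [mu' [ad' pp' ps' px]]]]]].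
  by exists r, i, e, mu; split => //; exists (x - proj r e mu x); rewrite scale1r.
exact: (adapted_step ad' pp' ps' Px px).
Qed.

End Forms.

Lemma chomZ (k : fieldType) (V W : cmod k) (f : chom V W) a x : f (a *: x) = a *: f x.
Proof. exact: linearZ. Qed.
Lemma chomD (k : fieldType) (V W : cmod k) (f : chom V W) x y : f (x + y) = f x + f y.
Proof. exact: linearD. Qed.

(** * Completed tensor products *)

Section Functoriality.
Variable k : fieldType.
Implicit Types U V W X Y : cmod k.

Lemma ctens_ext2 V W X Y Y' (f : chom Y X) (g : chom (ctens V W) Y)
    (f' : chom Y' X) (g' : chom (ctens V W) Y') :
  (forall v w, f (g (otimes v w)) = f' (g' (otimes v w))) ->
  forall x, f (g x) = f' (g' x).
Proof. by move=> fg; apply: (ctens_ext (f := chom_comp f g) (g := chom_comp f' g')). Qed.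

Lemma ctens_ext1 V W X Y (f : chom Y X) (g : chom (ctens V W) Y)
    (f' : chom (ctens V W) X) :
  (forall v w, f (g (otimes v w)) = f' (otimes v w)) -> forall x, f (g x) = f' x.
Proof. exact: (@ctens_ext2 _ _ _ _ _ f g (chom_id _) f'). Qed.

Lemma ctens3_ext U V W X (f g : chom (ctens (ctens U V) W) X) :
  (forall u v w, f (otimes (otimes u v) w) = g (otimes (otimes u v) w)) -> f =1 g.
Proof.
move=> fg; apply: ctens_ext => t w.
pose ob := bihom_app (bihom_swap (otimes_bihom (ctens U V) W)) w.
by move: t; apply: (@ctens_ext2 _ _ _ _ _ f ob g ob) => u v; exact: fg.
Qed.

Lemma ctens3_ext2 U V W X Y Y' (f : chom Y X) (g : chom (ctens (ctens U V) W) Y)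
    (f' : chom Y' X) (g' : chom (ctens (ctens U V) W) Y') :
  (forall u v w, f (g (otimes (otimes u v) w)) = f' (g' (otimes (otimes u v) w))) ->
  forall x, f (g x) = f' (g' x).
Proof. by move=> fg; apply: (ctens3_ext (f := chom_comp f g) (g := chom_comp f' g')). Qed.

Lemma ctens3r_ext U V W X (f g : chom (ctens U (ctens V W)) X) :
  (forall u v w, f (otimes u (otimes v w)) = g (otimes u (otimes v w))) -> f =1 g.
Proof.
move=> fg; apply: ctens_ext => u t; pose ob := bihom_app (otimes_bihom U (ctens V W)) u.
by move: t; apply: (@ctens_ext2 _ _ _ _ _ f ob g ob) => v w; exact: fg.
Qed.

Lemma ctens3r_ext2 U V W X Y Y' (f : chom Y X) (g : chom (ctens U (ctens V W)) Y)
    (f' : chom Y' X) (g' : chom (ctens U (ctens V W)) Y') :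
  (forall u v w, f (g (otimes u (otimes v w))) = f' (g' (otimes u (otimes v w)))) ->
  forall x, f (g x) = f' (g' x).
Proof. by move=> fg; apply: (ctens3r_ext (f := chom_comp f g) (g := chom_comp f' g')). Qed.

Lemma ctens4_ext U V W X Y (f g : chom (ctens (ctens U V) (ctens W X)) Y) :
  (forall u v w x, f (otimes (otimes u v) (otimes w x)) =
                   g (otimes (otimes u v) (otimes w x))) -> f =1 g.
Proof.
move=> fg; apply: ctens3_ext => u v t.
pose ob := bihom_app (otimes_bihom (ctens U V) (ctens W X)) (otimes u v).
by move: t; apply: (@ctens_ext2 _ _ _ _ _ f ob g ob) => w x; exact: fg.
Qed.

Lemma tmap_square V V' V1 V1' W W' W1 W1' (f : chom V' V1') (i : chom V V')
    (j : chom V1 V1') (g : chom V V1) (f' : chom W' W1') (i' : chom W W')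
    (j' : chom W1 W1') (g' : chom W W1) :
  (forall x, f (i x) = j (g x)) -> (forall x, f' (i' x) = j' (g' x)) ->
  forall z, tmap f f' (tmap i i' z) = tmap j j' (tmap g g' z).
Proof.
by move=> fi fi'; apply: ctens_ext2 => v w; rewrite !tmapE fi fi'.
Qed.

Lemma eq_tmap V V' W W' (f g : chom V V') (f' g' : chom W W') :
  f =1 g -> f' =1 g' -> tmap f f' =1 tmap g g'.
Proof.
by move=> fg fg'; apply: ctens_ext => v w; rewrite !tmapE fg fg'.
Qed.

Lemma tmap_id V W : tmap (chom_id V) (chom_id W) =1 id.
Proof.
by apply: (@ctens_ext _ _ _ _ _ (chom_id (ctens V W))) => v w; rewrite tmapE.
Qed.

Lemma tmap_comp V V' V'' W W' W'' (f : chom V' V'') (g : chom V V')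
    (f' : chom W' W'') (g' : chom W W') x :
  tmap f f' (tmap g g' x) = tmap (chom_comp f g) (chom_comp f' g') x.
Proof. by move: x; apply: ctens_ext1 => v w; rewrite !tmapE. Qed.

Lemma tmap_cancel V V' W W' (f : chom V' V) (g : chom V V')
    (f' : chom W' W) (g' : chom W W') :
  cancel g f -> cancel g' f' -> cancel (tmap g g') (tmap f f').
Proof.
move=> gK gK' x; rewrite tmap_comp -[RHS]tmap_id.
by apply: eq_tmap => y; [exact: gK|exact: gK'].
Qed.

Lemma flipK V W : cancel (flip V W) (flip W V).
Proof. by apply: (@ctens_ext1 _ _ _ _ _ _ (chom_id _)) => v w; rewrite !flipE. Qed.

Lemma flip_natural V V' W W' (f : chom V V') (g : chom W W') x :
  flip V' W' (tmap f g x) = tmap g f (flip V W x).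
Proof. by move: x; apply: ctens_ext2 => v w; rewrite tmapE !flipE tmapE. Qed.

Lemma assoc_natural U U' V V' W W' (f : chom U U') (g : chom V V') (e : chom W W') x :
  assoc U' V' W' (tmap (tmap f g) e x) = tmap f (tmap g e) (assoc U V W x).
Proof. by move: x; apply: ctens3_ext2 => u v w; rewrite !(tmapE, assocE). Qed.

Lemma assocV_natural U U' V V' W W' (f : chom U U') (g : chom V V') (e : chom W W') x :
  assocV U' V' W' (tmap f (tmap g e) x) = tmap (tmap f g) e (assocV U V W x).
Proof. by move: x; apply: ctens3r_ext2 => u v w; rewrite !(tmapE, assocVE). Qed.

Lemma assocK U V W : cancel (assoc U V W) (assocV U V W).
Proof.
by apply: (@ctens3_ext2 _ _ _ _ _ _ _ _ (chom_id _) (chom_id _)) => u v w;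
  rewrite assocE assocVE.
Qed.

Lemma assocVK U V W : cancel (assocV U V W) (assoc U V W).
Proof.
by apply: (@ctens3r_ext2 _ _ _ _ _ _ _ _ (chom_id _) (chom_id _)) => u v w;
  rewrite assocVE assocE.
Qed.

Lemma tmid_natural U U' V V' W W' X X' (f : chom U U') (g : chom V V')
    (f' : chom W W') (g' : chom X X') z :
  tmid U' V' W' X' (tmap (tmap f g) (tmap f' g') z) =
  tmap (tmap f f') (tmap g g') (tmid U V W X z).
Proof.
move: z; apply: (@ctens4_ext _ _ _ _ _
  (chom_comp (tmid U' V' W' X') (tmap (tmap f g) (tmap f' g')))
  (chom_comp (tmap (tmap f f') (tmap g g')) (tmid U V W X))) => u v w x.
by rewrite [LHS]chom_compE [RHS]chom_compE !(tmapE, tmidE).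
Qed.
End Functoriality.

(** * Topological embeddings *)

Definition emb (k : fieldType) (V W : cmod k) (f : chom V W) : Prop :=
  forall n, exists m, forall v, filt W m (f v) -> filt V n v.

Section Embeddings.
Variable k : fieldType.
Implicit Types U V W X Y : cmod k.

Lemma emb_inj V W (f : chom V W) : emb f -> injective f.
Proof.
move=> ef x y fxy; apply: filt_eq => n; have [m mP] := ef n.
by apply: mP; rewrite linearB fxy subrr; exact: filt0.
Qed.

Lemma emb_id V : emb (chom_id V).
Proof. by move=> n; exists n. Qed.

(** The source is complete: if the f(u_n) converge to w, a subsequence of the u_n is Cauchy, since
    small images have small arguments. *)
Lemma emb_closed V W (f : chom V W) : emb f -> closed (fun w => exists v, w = f v).
Proof.
move=> ef w wP; have /choice[m mP] := ef.
pose M n := \max_(i < n.+1) maxn i (m i).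
have nM n : (n <= M n)%N.
  by apply: leq_trans (leq_bigmax (ord_max : 'I_n.+1)); exact: leq_maxl.
have mM n : (m n <= M n)%N.
  by apply: leq_trans (leq_bigmax (ord_max : 'I_n.+1)); exact: leq_maxr.
have MS n : (M n <= M n.+1)%N by rewrite /M [X in (_ <= X)%N]big_ord_recr /= leq_maxl.
have /choice[u uP] : forall n, exists v, filt W n (w - f v).
  by move=> n; have [_ [v ->] vP] := wP n; exists v.
have [v vP] : exists v, forall n, filt V n (v - u (M n)).
  apply: (@filt_compl _ _ (fun n => u (M n))) => n.
  apply: mP; apply: filt_leq (mM n) _; rewrite linearB.
  exact: filtBT (filtBC (filt_leq (MS n) (uP _))) (uP _).
exists v; apply: filt_eq => n; have [p pP] := chom_cont f n.
pose q := maxn n p; apply: (@filtBT _ _ _ _ (f (u (M q)))).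
  by apply: filt_leq (uP _); apply: leq_trans (nM q); exact: leq_maxl.
rewrite -linearB; apply: pP; apply: filtBC; apply: filt_leq (vP q); exact: leq_maxr.
Qed.

(** The way to build maps into H', H' (x) H' or through [shrink]: once preimages exist pointwise,
    injectivity gives linearity and [emb] gives continuity. *)
Lemma emb_factor V W W' (f : chom V W) (j : chom W' W) :
  emb j -> (forall v, exists w, f v = j w) ->
  exists g : chom V W', forall v, f v = j (g v).
Proof.
move=> ej /choice[g gP].
have lg : linear g.
  by move=> a x y; apply: (emb_inj ej); rewrite -gP !linearP -!gP.
have cg n : exists m, forall x, filt V m x -> filt W' n (g x).
  have [m mP] := ej n; have [p pP] := chom_cont f m.
  by exists p => x /pP; rewrite gP; exact: mP.
by exists (mk_chom lg cg).
Qed.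

End Embeddings.

(** * Contractions of tensors by linear forms *)

Section Contractions.
Variable k : fieldType.
Implicit Types V W X : cmod k.

Lemma good_cunit : good (cunit k).
Proof.
split=> [//|x hx0]; apply: fpsP => n; have := congr1 (fun f => coef f n.+1) hx0.
by change (coef (hvar * x : fps k) n.+1 = 0 -> coef x n = 0); rewrite coef_hM.
Qed.

Definition lform V W (mu : chom V (cunit k)) : chom (ctens V W) W :=
  lift (bihom_comp (cscale W) mu (chom_id W)).

Lemma lformE V W mu (v : V) (w : W) :
  lform W mu (otimes v w) = (mu v : fps k) *: w.
Proof. exact: lift_otimes. Qed.

Definition rform V W (mu : chom W (cunit k)) : chom (ctens V W) V :=
  chom_comp (lform V mu) (flip V W).

Lemma rformE V W mu (v : V) (w : W) :
  rform V mu (otimes v w) = (mu w : fps k) *: v.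
Proof. by rewrite chom_compE flipE lformE. Qed.

Lemma lform_tmap V V' W W' (mu : chom V' (cunit k)) (f : chom V V') (g : chom W W') x :
  lform W' mu (tmap f g x) = g (lform W (chom_comp mu f) x).
Proof.
by move: x; apply: ctens_ext2 => v w; rewrite tmapE !lformE linearZ.
Qed.

Lemma rform_tmap V V' W W' (mu : chom W' (cunit k)) (f : chom V V') (g : chom W W') x :
  rform V' mu (tmap f g x) = f (rform V (chom_comp mu g) x).
Proof. by rewrite chom_compE flip_natural lform_tmap. Qed.

Lemma rform_map V V' W (nu : chom W (cunit k)) (f : chom V V') x :
  rform V' nu (tmap f (chom_id W) x) = f (rform V nu x).
Proof. by move: x; apply: ctens_ext2 => v w; rewrite tmapE !rformE chomZ. Qed.
Lemma lform_map V W W' (mu : chom V (cunit k)) (g : chom W W') x :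
  lform W' mu (tmap (chom_id V) g x) = g (lform W mu x).
Proof. by move: x; apply: ctens_ext2 => v w; rewrite tmapE !lformE chomZ. Qed.

Lemma lform_rform V W (mu : chom V (cunit k)) (nu : chom W (cunit k)) x :
  nu (lform W mu x) = mu (rform V nu x).
Proof.
move: x; apply: ctens_ext2 => v w; rewrite lformE rformE !linearZ.
exact: (mulrC (mu v : fps k)).
Qed.

Lemma lform_filt V W (mu : chom V (cunit k)) n x :
  hadic V -> filt (ctens V W) n x -> filt W n (lform W mu x).
Proof.
move=> hV; apply: lift_filt; split=> v w /=; last exact: filtZ.
by move=> /hV[v' ->]; rewrite linearZ /= -scalerA; exact: filt_hX.
Qed.

Lemma otimes0l V W (w : W) : otimes (0 : V) w = 0.
Proof. exact: (bilin0l (otimes_bilin V W)). Qed.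
Lemma otimesZl V W a (v : V) (w : W) : otimes (a *: v) w = a *: otimes v w.
Proof. exact: (bilinZl (otimes_bilin V W)). Qed.
Lemma otimesZr V W a (v : V) (w : W) : otimes v (a *: w) = a *: otimes v w.
Proof. exact: (bilinZr (otimes_bilin V W)). Qed.
Lemma otimesBl V W (v v' : V) (w : W) : otimes (v - v') w = otimes v w - otimes v' w.
Proof. by rewrite (bilinDl (otimes_bilin V W)) (bilinNl (otimes_bilin V W)). Qed.
Lemma otimes_suml V W I (s : seq I) (F : I -> V) (w : W) :
  otimes (\sum_(i <- s) F i) w = \sum_(i <- s) otimes (F i) w.
Proof.
apply: (big_morph (fun v => otimes v w)) => [v v'|]; last exact: otimes0l.
exact: (bilinDl (otimes_bilin V W)).
Qed.
Lemma otimes_sumr V W I (s : seq I) (F : I -> W) (v : V) :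
  otimes v (\sum_(i <- s) F i) = \sum_(i <- s) otimes v (F i).
Proof.
apply: (big_morph (otimes v)) => [w w'|]; last exact: (bilin0r (otimes_bilin V W)).
exact: (bilinDr (otimes_bilin V W)).
Qed.

(** Replace x by a finite sum of v (x) w with v in P. There v agrees with sum_a mu_a(v) e_a modulo
    h^N, and moving the scalars mu_a(v) to the right factor produces the contractions. *)
Lemma adapted_expansion V W (P : V -> Prop) x N s : good V -> submod P ->
  (forall p, p \in s -> P p.1) -> filt (ctens V W) N (x - osum s) ->
  exists r i e mu, adapted P i e mu /\
    filt (ctens V W) N (x - \sum_(a < r) otimes (e a) (lform W (mu a) x)).
Proof.
move=> gV PP sP xs; have {}sP : forall v, v \in [seq p.1 | p <- s] -> P v.
  by move=> _ /mapP[p ps ->]; exact: sP.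
have [r [i [e [mu [ad sN]]]]] := adapted_approx gV PP N sP.
exists r, i, e, mu; split => //; apply: (filtBT xs).
apply: (@filtBT _ _ _ _ (\sum_(a < r) otimes (e a) (lform W (mu a) (osum s)))); last first.
  rewrite -sumrB; apply: filt_sum => a.
  rewrite -(bilinNr (otimes_bilin V W)) -(bilinDr (otimes_bilin V W)) -linearB.
  by apply: (otimes_modulus V W N).2; apply: lform_filt (filtBC xs); exact: gV.1.
have -> : \sum_(a < r) otimes (e a) (lform W (mu a) (osum s)) =
    \sum_(p <- s) otimes (\sum_(a < r) (mu a p.1 : fps k) *: e a) p.2.
  under eq_bigr do rewrite /osum linear_sum otimes_sumr.
  rewrite exchange_big; apply: eq_bigr => p _; rewrite otimes_suml.
  by apply: eq_bigr => a _; rewrite lformE otimesZr otimesZl.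
rewrite /osum -sumrB big_seq; elim/big_rec: _ => [|p y ps IH]; first exact: filt0.
apply: filtD => //; rewrite -otimesBl; apply: (otimes_modulus V W N).1.
by apply/gV.1; apply: sN; exact: map_f.
Qed.

Lemma submod_full V : submod (fun _ : V => True).
Proof. by []. Qed.

Lemma left_expansion V W (x : ctens V W) N : good V ->
  exists r e mu, filt (ctens V W) N (x - \sum_(a < r) otimes (e a) (lform W (mu a) x)).
Proof.
move=> gV; have [s xs] := osum_dense x N.
have [r [i [e [mu [_ H]]]]] :=
  adapted_expansion gV (@submod_full V) (fun _ _ => I) xs.
by exists r, e, mu.
Qed.

Lemma right_expansion V W (x : ctens V W) N : good W ->
  exists r e mu, filt (ctens V W) N (x - \sum_(a < r) otimes (rform V (mu a) x) (e a)).
Proof.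
move=> gW; have [r [e [mu H]]] := left_expansion (flip V W x) N gW.
exists r, e, mu; have flipN y : filt (ctens W V) N y -> filt (ctens V W) N (flip W V y).
  apply: lift_filt; split=> w v wv; [exact: (otimes_modulus V W N).2|].
  exact: (otimes_modulus V W N).1.
have := flipN _ H; rewrite linearB flipK linear_sum; congr (filt _ _ (_ - _)).
by apply: eq_bigr => a _; rewrite flipE.
Qed.

(** Modulo h^n, v is a combination of vectors e_a with coefficients mu_a(v). *)
Lemma form_detect V (v : V) n : good V ->
  (forall mu : chom V (cunit k), hdvd n (mu v)) -> hdvd n v.
Proof.
move=> gV vn; have vP : forall x, x \in [:: v] -> True by [].
have [r [i [e [mu [_ H]]]]] := adapted_approx gV (@submod_full V) n vP.
have {}H := H v (mem_head _ _).
have nP := @hdvd_submod k V n.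
rewrite -(subrK (\sum_(a < r) (mu a v : fps k) *: e a) v); apply: (submodD nP H).
apply: (submod_sum nP) => a; have [c ->] := vn (mu a).
by exists ((c : fps k) *: e a); rewrite scalerA.
Qed.

(** If h x = 0, all contractions of x vanish because W is torsion-free, and x is a limit of sums
    built from its contractions. *)
Lemma good_ctens V W : good V -> good W -> good (ctens V W).
Proof.
move=> gV gW; split=> [|x hx0]; first exact: ctens_hadic gV.1 gW.1.
apply: filt_sep => N; have [r [e [mu H]]] := left_expansion x N gV.
rewrite -[x]subr0; move: H; rewrite big1 // => a _.
rewrite (_ : lform W _ x = 0) ?(bilin0r (otimes_bilin V W)) //.
by apply: gW.2; rewrite -linearZ hx0 linear0.
Qed.

(* If f p is approximated by vectors e_a with h^{i_a} e_a in f(V1), an        *)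
(* element of V1 (x) W1 is sum_a [h^{i_a} e_a] (x) z_a; either i_a is large   *)
(* or z_a is the contraction of the image divided by a small power of h.      *)
Lemma emb_tmap V V1 W W1 (f : chom V1 V) (g : chom W1 W) :
  good V -> good W -> emb f -> emb g -> emb (tmap f g).
Proof.
move=> gV gW ef eg n; have [mf fP] := ef n; have [mg gP] := eg n.
pose M := (mf + mg)%N; exists M => x fgx.
have [m1 m1P] := chom_cont (tmap f g) M.
have [s xs] := osum_dense x (maxn n m1).
have xsn : filt (ctens V1 W1) n (x - osum s).
  by apply: filt_leq xs; exact: leq_maxl.
have fgs : filt (ctens V W) M (tmap f g (osum s)).
  rewrite -(subKr x (osum s)) linearB; apply: filtB => //.
  by apply: m1P; apply: filt_leq xs; exact: leq_maxr.
suff sn : filt (ctens V1 W1) n (osum s) by rewrite -(subrK (osum s) x); exact: filtD.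
have PP : submod (fun v => exists v1, v = f v1).
  split=> [|_ _ [v ->] [w ->]|a _ [v ->]]; first by exists 0; rewrite linear0.
    by exists (v + w); rewrite linearD.
  by exists (a *: v); rewrite linearZ.
have [|r [i [e [mu [ad sN]]]]] := adapted_approx gV PP mf (s := [seq f p.1 | p <- s]).
  by move=> _ /mapP[p _ ->]; exists p.1.
have /choice[e1 e1P] : forall a, exists v1, hvar ^+ i a *: e a = f v1.
  by move=> a; exact: (ad a).1.
have /choice[c cP] : forall ap : nat * V1, exists c : cunit k,
    mu ap.1 (f ap.2) = hvar ^+ i ap.1 *: c.
  by move=> [a v]; have [|c] := (ad a).2 (f v); [exists v|exists c].
have {}cP a v : mu a (f v) = hvar ^+ i a *: c (a, v) := cP (a, v).
pose z a := \sum_(p <- s) (c (a, p.1) : fps k) *: p.2.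
rewrite -(subrK (\sum_(a < r) otimes (e1 a) (z a)) (osum s)); apply: filtD.
  have -> : \sum_(a < r) otimes (e1 a) (z a) =
      \sum_(p <- s) otimes (\sum_(a < r) (c (a : nat, p.1) : fps k) *: e1 a) p.2.
    under eq_bigr do rewrite /z otimes_sumr.
    rewrite exchange_big; apply: eq_bigr => p _; rewrite otimes_suml.
    by apply: eq_bigr => a _; rewrite otimesZr otimesZl.
  rewrite /osum -sumrB big_seq; elim/big_rec: _ => [|p y ps IH]; first exact: filt0.
  apply: filtD => //; rewrite -otimesBl; apply: (otimes_modulus V1 W1 n).1.
  apply: fP; apply/gV.1; rewrite linearB linear_sum.
  under eq_bigr do rewrite linearZ /= -e1P scalerA mulrC.
  have := sN (f p.1) (map_f (fun p => f p.1) ps).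
  by congr (hdvd mf (_ - _)); apply: eq_bigr => a _; rewrite cP.
apply: filt_sum => a; have [mfi|imf] := leqP mf (i a).
  apply: (otimes_modulus V1 W1 n).1; apply: fP; rewrite -e1P.
  exact: filt_leq mfi (filt_hX _ _).
apply: (otimes_modulus V1 W1 n).2; apply: gP.
have hz : hvar ^+ i a *: g (z a) = lform W (mu a) (tmap f g (osum s)).
  rewrite /osum /z !linear_sum; apply: eq_bigr => p _.
  by rewrite tmapE lformE cP [g _]linearZ /= scalerA.
have [y yE] := (ctens_hadic gV.1 gW.1 _ _).1 fgs.
suff -> : g (z a) = hvar ^+ (M - i a) *: lform W (mu a) y.
  apply: filt_leq (filt_hX _ _); rewrite /M; lia.
apply: (good_inj gW (n := i a)).
rewrite hz yE linearZ scalerA -exprD subnKC //; lia.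
Qed.

(** Right contractions first approximate x by sums with left factors in f(V1), so that an adapted
    expansion of x exists. In it each contraction by mu_a is h^(i_a) g(w_a); moving h^(i_a) to the
    left turns e_a into a vector of f(V1). The image is closed, so approximation suffices. *)
Lemma tensor_image V V1 W W1 (f : chom V1 V) (g : chom W1 W) (x : ctens V W) :
  good V -> good W -> emb f -> emb g ->
  (forall nu, exists v, rform V nu x = f v) ->
  (forall n (mu : chom V (cunit k)), (forall v, hdvd n (mu (f v))) ->
    exists w, lform W mu x = hvar ^+ n *: g w) ->
  exists y, x = tmap f g y.
Proof.
move=> gV gW ef eg xr xl; apply: (emb_closed (emb_tmap gV gW ef eg)) => N.
have PP : submod (fun v => exists v1, v = f v1).
  split=> [|_ _ [v ->] [w ->]|a _ [v ->]]; first by exists 0; rewrite linear0.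
    by exists (v + w); rewrite linearD.
  by exists (a *: v); rewrite linearZ.
have [r [b [nu xN]]] := right_expansion x N gW.
pose s := [seq (rform V (nu a) x, b a) | a : 'I_r].
have [||r' [i [e [mu [ad xN']]]]] := @adapted_expansion _ _ _ x N s gV PP.
- by move=> p /mapP[a _ ->]; exact: xr.
- by rewrite /osum /s big_image.
have /choice[e1 e1P] : forall a, exists v1, hvar ^+ i a *: e a = f v1.
  by move=> a; exact: (ad a).1.
have /choice[w wP] : forall a, exists w, lform W (mu a) x = hvar ^+ i a *: g w.
  by move=> a; apply: xl => v; apply: (ad a).2; exists v.
exists (\sum_(a < r') otimes (e a) (lform W (mu a) x)) => //.
exists (\sum_(a < r') otimes (e1 a) (w a)); rewrite linear_sum.
by apply: eq_bigr => a _; rewrite tmapE wP otimesZr -otimesZl e1P.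
Qed.
End Contractions.

(** * Membership in H' *)

Section Powers.
Variable k : fieldType.
Implicit Types U V W X : cmod k.

(** f_0 (x) ... (x) f_(n-1). The inner match follows [tpow], where the first power is V itself and
    not k[[h]] (x) V. *)
Fixpoint tpmap V W (f : nat -> chom V W) n : chom (tpow V n) (tpow W n) :=
  match n with
  | 0 => chom_id (cunit k)
  | n'.+1 =>
    match n' return chom (tpow V n') (tpow W n') -> chom (tpow V n'.+1) (tpow W n'.+1) with
    | 0 => fun _ => f 0%N
    | n''.+1 => fun g => tmap g (f n''.+1)
    end (tpmap f n')
  end.

Lemma chom_zero_linear V W : linear (fun _ : V => 0 : W).
Proof. by move=> a x y; rewrite scaler0 addr0. Qed.
Lemma chom_zero_cont V W n : exists m, forall x : V, filt V m x -> filt W n 0.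
Proof. by exists 0%N => x _; exact: filt0. Qed.
Definition chom_zero V W : chom V W := mk_chom (@chom_zero_linear V W) (@chom_zero_cont V W).

Definition chom_sum V W (I : Type) (s : seq I) (F : I -> chom V W) : chom V W :=
  foldr (fun i => chom_add (F i)) (chom_zero V W) s.

Lemma chom_sumE V W (I : Type) (s : seq I) (F : I -> chom V W) x :
  chom_sum s F x = \sum_(i <- s) F i x.
Proof. by elim: s => [|i s IH]; rewrite ?big_nil ?big_cons //= -IH. Qed.

Lemma snoc_bilin V n : bilin (snoc V n).
Proof. exact: bihom_bilin. Qed.

(** [snoc] treats the first power like the higher ones, so later inductions on n need no special
    case. *)
Lemma tpow_ext V X n (f g : chom (tpow V n.+1) X) :
  (forall x v, f (snoc V n x v) = g (snoc V n x v)) -> f =1 g.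
Proof.
case: n f g => [|n] f g fg; last exact: ctens_ext.
by move=> v; have := fg (1 : fps k) v; rewrite /= scale1r.
Qed.

Lemma tpmap_snoc V W (f : nat -> chom V W) n x v :
  tpmap f n.+1 (snoc V n x v) = snoc W n (tpmap f n x) (f n v).
Proof. by case: n x => [|n] x; rewrite /= ?linearZ ?tmapE. Qed.

Lemma snoc_mapE V m n (g : chom (tpow V m) (tpow V n)) x v :
  snoc_map g (snoc V m x v) = snoc V n (g x) v.
Proof.
case: m g x => [|m] g x; last exact: lift_otimes.
rewrite /= (bilinZr (snoc_bilin V n)) -(bilinZl (snoc_bilin V n)) -linearZ.
by congr (snoc V n (g _) v); exact: mulr1.
Qed.

Lemma eq_tpmap V W (f g : nat -> chom V W) n :
  (forall i, (i < n)%N -> f i =1 g i) -> tpmap f n =1 tpmap g n.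
Proof.
elim: n => [//|n IH] fg; apply: tpow_ext => x v.
by rewrite !tpmap_snoc IH ?fg // => i ni; apply: fg; exact: ltnW.
Qed.

Lemma tpmap_idE V (f : nat -> chom V V) n x : (forall i, f i =1 id) -> tpmap f n x = x.
Proof.
move=> fid; elim: n x => [//|n IH]; apply: (@tpow_ext _ _ _ _ (chom_id _)) => x v.
by rewrite tpmap_snoc IH fid.
Qed.

Lemma tpmap_comp U V W (f : nat -> chom V W) (g : nat -> chom U V) n x :
  tpmap f n (tpmap g n x) = tpmap (fun i => chom_comp (f i) (g i)) n x.
Proof.
elim: n x => [//|n IH].
apply: (@tpow_ext _ _ _ (chom_comp (tpmap f n.+1) (tpmap g n.+1))) => x v.
by rewrite [LHS]chom_compE !tpmap_snoc IH.
Qed.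

Lemma tpmap_scale V W (c : nat -> fps k) (f : nat -> chom V W) n x :
  tpmap (fun i => chom_scale (c i) (f i)) n x = (\prod_(i < n) c i) *: tpmap f n x.
Proof.
elim: n x => [|n IH]; first by move=> x; rewrite big_ord0 scale1r.
apply: (@tpow_ext _ _ _ _ (chom_scale (\prod_(i < n.+1) c i) (tpmap f n.+1))) => x v.
rewrite -[RHS]/(_ *: tpmap f n.+1 _) !tpmap_snoc IH big_ord_recr /=.
by rewrite (bilinZl (snoc_bilin _ _)) (bilinZr (snoc_bilin _ _)) scalerA.
Qed.

Lemma tpmap_expand V W (f g : nat -> chom V W) n x :
  tpmap (fun i => chom_add (f i) (g i)) n x =
  \sum_(s : {set 'I_n}) tpmap (fun i => if mem_nat s i then f i else g i) n x.
Proof.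
elim: n x => [x|n IH].
  rewrite (bigD1 set0) //= big1 ?addr0 // => s; case/negP.
  by apply/eqP/setP => -[].
(* A subset of 'I_n.+1 is a subset of 'I_n and a boolean for the last index. *)
pose h (sb : {set 'I_n} * bool) : {set 'I_n.+1} :=
  [set i : 'I_n.+1 | if (i < n)%N then mem_nat sb.1 i else sb.2].
pose h' (s : {set 'I_n.+1}) := ([set i : 'I_n | mem_nat s i], mem_nat s n).
have memh sb i : (i < n.+1)%N ->
    mem_nat (h sb) i = if (i < n)%N then mem_nat sb.1 i else sb.2.
  by move=> ilt; rewrite {1}/mem_nat insubT inE.
have memE m (s : {set 'I_m}) (i : 'I_m) : mem_nat s i = (i \in s).
  by rewrite /mem_nat valK.
have hK : cancel h h'.
  move=> [s b]; rewrite /h' memh // ltnn /=; congr (_, _); apply/setP => i.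
  by rewrite inE memh ?ltn_ord ?memE // ltnW // ltnS ltn_ord.
have h'K : cancel h' h.
  move=> s; apply/setP => i; rewrite !inE /=; case: ltnP => [ilt|ni].
    by rewrite (memE _ _ (Ordinal ilt)) inE /= memE.
  have -> : mem_nat s n = mem_nat s i; last by rewrite memE.
  by congr (mem_nat s _); apply/eqP; rewrite eqn_leq ni -ltnS ltn_ord.
move=> x; rewrite -(chom_sumE _ (fun s : {set 'I_n.+1} =>
  tpmap (fun i => if mem_nat s i then f i else g i) n.+1)); move: x.
apply: (@tpow_ext _ _ _ _ (chom_sum _ _)) => x v.
rewrite chom_sumE (reindex h) /=; last by exists h' => ? _.
rewrite tpmap_snoc IH -(pair_bigA _ (fun s b =>
  tpmap (fun i => if mem_nat (h (s, b)) i then f i else g i) n.+1 (snoc V n x v))) /=.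
rewrite (big_morph (fun y => snoc W n y _) (id1 := 0) (op1 := +%R)); last 2 first.
- by move=> y z; exact: (bilinDl (snoc_bilin W n)).
- exact: (bilin0l (snoc_bilin W n)).
apply: eq_bigr => s _; rewrite big_bool /= !tpmap_snoc !memh // ltnn.
have E b : tpmap (fun i => if mem_nat (h (s, b)) i then f i else g i) n x =
    tpmap (fun i => if mem_nat s i then f i else g i) n x.
  by apply: eq_tpmap => i ilt y; rewrite memh ?ilt // ltnW.
by rewrite !E /= (bilinDr (snoc_bilin W n)).
Qed.
End Powers.

Section Membership.
Variables (k : fieldType) (H : cmod k) (S : hopf H).

Definition unit_map : chom (cunit k) H := bihom_app (bihom_swap (cscale H)) (aone S).
Definition unit_counit : chom H H := chom_comp unit_map (counit S).
Definition augment : chom H H := chom_add (chom_id H) (chom_scale (-1) unit_counit).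
(** [unshrink] exchanges the roles of k1 and ker eps, so the two maps compose to h in either order
    ([unshrinkK], [shrinkK]). *)
Definition shrink : chom H H := chom_add unit_counit (chom_scale hvar augment).
Definition unshrink : chom H H := chom_add (chom_scale hvar unit_counit) augment.
Definition shrinkn n : chom (tpow H n) (tpow H n) := tpmap (fun=> shrink) n.

Lemma unit_counitE x : unit_counit x = (counit S x : fps k) *: aone S.
Proof. by []. Qed.
Lemma augmentE x : augment x = x - unit_counit x.
Proof. by rewrite -[LHS]/(x + _ *: _) scaleN1r. Qed.
Lemma shrinkE x : shrink x = unit_counit x + hvar *: augment x.
Proof. by []. Qed.
Lemma unshrinkE x : unshrink x = hvar *: unit_counit x + augment x.
Proof. by []. Qed.
Lemma unit_counit1 : unit_counit (aone S) = aone S.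
Proof. by rewrite unit_counitE counit1 scale1r. Qed.
Lemma unit_counitK x : unit_counit (unit_counit x) = unit_counit x.
Proof. by rewrite (unit_counitE x) linearZ unit_counit1. Qed.
Lemma unit_counit_augment x : unit_counit (augment x) = 0.
Proof. by rewrite augmentE linearB unit_counitK subrr. Qed.
Lemma augment_unit_counit x : augment (unit_counit x) = 0.
Proof. by rewrite augmentE unit_counitK subrr. Qed.
Lemma augmentK x : augment (augment x) = augment x.
Proof. by rewrite {1}augmentE unit_counit_augment subr0. Qed.
Lemma unit_counitD x : unit_counit x + augment x = x.
Proof. by rewrite augmentE addrC subrK. Qed.
Lemma shrink_augment x : shrink (augment x) = hvar *: augment x.
Proof. by rewrite shrinkE unit_counit_augment add0r augmentK. Qed.
Lemma augment_shrink x : augment (shrink x) = hvar *: augment x.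
Proof.
rewrite shrinkE (chomD augment) (chomZ augment hvar) augment_unit_counit add0r.
by rewrite augmentK.
Qed.
Lemma unit_counit_shrink x : unit_counit (shrink x) = unit_counit x.
Proof.
rewrite shrinkE (chomD unit_counit) (chomZ unit_counit hvar) unit_counit_augment.
by rewrite scaler0 addr0 unit_counitK.
Qed.
Lemma shrink_unit_counit x : shrink (unit_counit x) = unit_counit x.
Proof. by rewrite shrinkE unit_counitK augment_unit_counit scaler0 addr0. Qed.
Lemma unshrinkK x : shrink (unshrink x) = hvar *: x.
Proof.
rewrite unshrinkE (chomD shrink) (chomZ shrink hvar) shrink_unit_counit.
by rewrite shrink_augment -scalerDr unit_counitD.
Qed.
Lemma shrinkK x : unshrink (shrink x) = hvar *: x.
Proof.
by rewrite unshrinkE unit_counit_shrink augment_shrink -scalerDr unit_counitD.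
Qed.

(** [unshrink] recovers h v from the image of v, so exactly one power of h is given up. *)
Lemma shrink_emb : good H -> emb shrink.
Proof.
move=> gH n; exists n.+1 => v /gH.1[w vw]; apply/gH.1; exists (unshrink w).
by apply: (good_inj gH (n := 1)); rewrite expr1 -shrinkK vw linearZ scalerA -exprS.
Qed.

Lemma good_tpow n : good H -> good (tpow H n.+1).
Proof. by move=> gH; elim: n => [//|n IH]; exact: good_ctens. Qed.

Lemma shrinkn_emb n : good H -> emb (shrinkn n.+1).
Proof.
move=> gH; elim: n => [|n IH]; first exact: shrink_emb.
by apply: emb_tmap => //; [exact: good_tpow|exact: shrink_emb].
Qed.

Lemma comul_iterSS n a :
  comul_iter S n.+2 a = tmap (comul_iter S n.+1) (chom_id H) (comul S a).
Proof.
elim: n a => [|n IH] a; first by rewrite tmap_id.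
rewrite -[LHS]/(tmap (comul_first S n) (chom_id H) (comul_iter S n.+2 a)) IH tmap_comp.
by apply: eq_tmap.
Qed.

Lemma comul_iterS n a :
  comul_iter S n.+1 a = @snoc_map _ H 1 n (comul_iter S n) (comul S a).
Proof.
case: n => [|n].
  have E x : lform H (chom_id (cunit k)) (tmap (counit S) (chom_id H) x) =
      @snoc_map _ H 1 0 (counit S) x.
    move: x; apply: (@ctens_ext1 _ _ _ _ _ (lform H (chom_id (cunit k)))
      (tmap (counit S) (chom_id H)) (@snoc_map _ H 1 0 (counit S))) => v w.
    by rewrite tmapE lformE; apply/esym; exact: (@snoc_mapE _ _ 1 0).
  by rewrite -E comul1l lformE [RHS]scale1r.
rewrite comul_iterSS; move: (comul S a); apply: ctens_ext => v w.
exact: etrans (tmapE _ _ _ _) (esym (@snoc_mapE _ H 1 n.+1 _ _ _)).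
Qed.

(** By the counit axiom, a (x) 1 = (id (x) eta eps)(Delta(a)): inserting 1 in a position amounts to
    applying eta eps to that leg of a longer coproduct. *)
Lemma place_comul_iter q n a :
  place S q n (comul_iter S (pcount q n) a) =
  tpmap (fun i => if q i then chom_id H else unit_counit) n (comul_iter S n a).
Proof.
elim: n a => [//|n IH] a; rewrite (comul_iterS n).
rewrite -[LHS]/((match q n as b return
      chom (tpow H (if b then (pcount q n).+1 else pcount q n)) (tpow H n.+1) with
    | true => snoc_map (place S q n)
    | false => chom_comp (snoc1 S n) (place S q n)
    end) (comul_iter S (if q n then (pcount q n).+1 else pcount q n) a)).
(* The value of q at n is frozen to a boolean b, so that the dependent match on [q n] can be
   destructed. *)
pose g b := fun i => if (if i == n then b else q i) then chom_id H else unit_counit.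
have -> : forall x, tpmap (fun i => if q i then chom_id H else unit_counit) n.+1 x =
    tpmap (g (q n)) n.+1 x.
  by move=> x; apply: eq_tpmap => i _ y; rewrite /g; case: eqP => [->|].
have gE b x : tpmap (g b) n x = tpmap (fun i => if q i then chom_id H else unit_counit) n x.
  by apply: eq_tpmap => i ilt y; rewrite /g ltn_eqF.
case: (q n).
  rewrite comul_iterS; move: (comul S a).
  apply: (@ctens_ext2 _ _ _ _ _ _ (snoc_map (place S q n))
    (@snoc_map _ H 1 _ (comul_iter S (pcount q n))) (tpmap (g true) n.+1)
    (@snoc_map _ H 1 _ (comul_iter S n))) => v w.
  rewrite !(@snoc_mapE _ H 1) (@snoc_mapE _ H _ n) tpmap_snoc gE IH.
  by rewrite /g eqxx.
pose F := lift (bihom_comp (snoc H n)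
  (chom_comp (place S q n) (comul_iter S (pcount q n))) unit_map).
have FE v c : F (otimes v c) =
    snoc H n (place S q n (comul_iter S (pcount q n) v)) ((c : fps k) *: aone S).
  exact: lift_otimes.
transitivity (F (otimes a (1 : cunit k))); first by rewrite FE [X in snoc _ _ _ X]scale1r.
rewrite -(comul1r S); move: (comul S a).
apply: (@ctens_ext2 _ _ _ _ _ _ F (tmap (chom_id H) (counit S)) (tpmap (g false) n.+1)
    (@snoc_map _ H 1 _ (comul_iter S n))) => v w.
rewrite tmapE FE (@snoc_mapE _ H 1) tpmap_snoc gE IH.
by rewrite /g eqxx.
Qed.

Lemma mem_natE n (s : {set 'I_n}) (i : 'I_n) : mem_nat s i = (i \in s).
Proof. by rewrite /mem_nat valK. Qed.

(** The alternating sum over subsets is the expansion of (id - eta eps)^(x n). *)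
Lemma deltaE n a : delta S n a = tpmap (fun=> augment) n (comul_iter S n a).
Proof.
pose c (s : {set 'I_n}) i : fps k := if mem_nat s i then 1 else -1.
have cE s : \prod_(i < n) c s i = (-1) ^+ (n - #|s|)%N.
  have -> : (n - #|s|)%N = #|~: s|.
    by rewrite [in LHS]cardsCs card_ord subKn // -[n in (_ <= n)%N]card_ord max_card.
  rewrite -prodr_const [RHS]big_mkcond /=; apply: eq_bigr => i _.
  by rewrite inE /c mem_natE; case: (i \in s).
rewrite (tpmap_expand (fun=> chom_id H) (fun=> chom_scale (-1) unit_counit)).
apply: eq_bigr => s _; rewrite [comul_set _ _ _]place_comul_iter -cE -tpmap_scale.
by apply: eq_tpmap => i _ y; rewrite /c; case: (mem_nat s i); rewrite //= scale1r.
Qed.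

Lemma place_tpmap q n w :
  tpmap (fun i => if q i then augment else unit_counit) n (place S q n w) =
  place S q n (tpmap (fun=> augment) (pcount q n) w).
Proof.
elim: n w => [//|n IH].
pose g b := fun i => if (if i == n then b else q i) then augment else unit_counit.
have gE b x : tpmap (g b) n x = tpmap (fun i => if q i then augment else unit_counit) n x.
  by apply: eq_tpmap => i ilt y; rewrite /g ltn_eqF.
have gSE x : tpmap (fun i => if q i then augment else unit_counit) n.+1 x =
    tpmap (g (q n)) n.+1 x.
  by apply: eq_tpmap => i _ y; rewrite /g; case: eqP => [->|].
pose P (b : bool) (pl : chom (tpow H (if b then (pcount q n).+1 else pcount q n)) (tpow H n.+1)) :=
  forall w, tpmap (g b) n.+1 (pl w) =
    pl (tpmap (fun=> augment) (if b then (pcount q n).+1 else pcount q n) w).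
suff : P (q n) (match q n as b return
      chom (tpow H (if b then (pcount q n).+1 else pcount q n)) (tpow H n.+1) with
    | true => snoc_map (place S q n)
    | false => chom_comp (snoc1 S n) (place S q n)
    end) by move=> h w; rewrite gSE; exact: h.
case: (q n) => /= w.
  move: w; apply: (@tpow_ext _ _ _ _ (chom_comp (tpmap (g true) n.+1) (snoc_map (place S q n)))
    (chom_comp (snoc_map (place S q n)) (tpmap (fun=> augment) (pcount q n).+1))) => x v.
  rewrite [LHS]chom_compE [RHS]chom_compE tpmap_snoc !snoc_mapE tpmap_snoc gE IH.
  by rewrite /g eqxx.
rewrite -[LHS]/(tpmap (g false) n.+1 (snoc H n (place S q n w) (aone S))).
by rewrite tpmap_snoc gE IH /g eqxx unit_counit1.
Qed.

(** From right to left, p o u = h p for p = id - eta eps, and delta_n applies p to the n legs.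
    Conversely, split each leg as k1 + ker eps: the component of the coproduct indexed by a subset s
    is [place] of delta of order |s|, hence divisible by h^|s|. *)
Lemma in_HprimeP a : good H ->
  in_Hprime S a <-> forall n, exists y, comul_iter S n.+1 a = shrinkn n.+1 y.
Proof.
move=> gH; split=> [aP n|aP [//|n] _]; last first.
  have [y aE] := aP n; exists (tpmap (fun=> augment) n.+1 y).
  rewrite deltaE aE tpmap_comp.
  transitivity (tpmap (fun=> chom_scale hvar augment) n.+1 y).
    by apply: eq_tpmap => i _ x; exact: augment_shrink.
  by rewrite tpmap_scale prodr_const card_ord.
pose A (s : {set 'I_n.+1}) i := if mem_nat s i then augment else unit_counit.
pose z := comul_iter S n.+1 a.
suff /choice[y yP] : forall s, exists y, tpmap (A s) n.+1 z = shrinkn n.+1 y.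
  exists (\sum_s y s); rewrite linear_sum -[LHS]/z.
  under eq_bigr do rewrite -yP.
  rewrite -[LHS](@tpmap_idE _ _ (fun=> chom_add augment unit_counit)); last first.
    by move=> i x; rewrite -[RHS](unit_counitD x) addrC.
  exact: tpmap_expand.
move=> s; pose m := pcount (mem_nat s) n.+1.
have AK w : tpmap (A s) n.+1 (tpmap (A s) n.+1 w) = tpmap (A s) n.+1 w.
  rewrite tpmap_comp; apply: eq_tpmap => i _ x; rewrite /A chom_compE.
  by case: ifP => _; [exact: augmentK|exact: unit_counitK].
have [y yE] : exists y, tpmap (A s) n.+1 z = hvar ^+ m *: y.
  have -> : tpmap (A s) n.+1 z = place S (mem_nat s) n.+1 (delta S m a).
    rewrite deltaE -place_tpmap place_comul_iter tpmap_comp.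
    apply: eq_tpmap => i _ x; rewrite /A; case: ifP => _ //.
    by rewrite chom_compE unit_counitK.
  have [m0|m0] := posnP m.
    by exists (place S (mem_nat s) n.+1 (delta S m a)); rewrite [X in hvar ^+ X]m0 scale1r.
  have [y ->] := aP _ m0; exists (place S (mem_nat s) n.+1 y); exact: chomZ.
(* On the image of the idempotent A_s the power of u is multiplication by h^m: u is h on the m legs
   in ker eps and 1 on the others. *)
exists (tpmap (A s) n.+1 y); rewrite -AK yE chomZ /shrinkn tpmap_comp.
pose c i : fps k := if mem_nat s i then hvar else 1.
have <- : \prod_(i < n.+1) c i = hvar ^+ m.
  rewrite /m pcount_mem -prodr_const [RHS]big_mkcond /=; apply: eq_bigr => i _.
  by rewrite /c mem_natE; case: (i \in s).
rewrite -tpmap_scale; apply: eq_tpmap => i _ x; rewrite /A /c chom_compE.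
case: ifP => _; first by rewrite shrink_augment.
by rewrite shrink_unit_counit [LHS]scale1r.
Qed.
End Membership.

(** * The Hopf algebra H' *)

Section MultiplicativityOnTensors.
Variables (k : fieldType) (H : cmod k) (S : hopf H).

Lemma comul_amul t :
  comul S (amul S t) = tmap (amul S) (amul S) (tmid H H H H (tmap (comul S) (comul S) t)).
Proof.
move: t; apply: (ctens_ext (f := chom_comp (comul S) (amul S)) (g := chom_comp
  (tmap (amul S) (amul S)) (chom_comp (tmid H H H H) (tmap (comul S) (comul S))))) => v w.
rewrite -[LHS]/(comul S (aprod S v w)) (comul_alg S).1.
by rewrite -[RHS]/(tmap _ _ (tmid H H H H (tmap (comul S) (comul S) _))) tmapE.
Qed.
(** Modulo h only the component on 1 (x) 1 survives. The explicit quotient serves both products in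
    H' and operators deforming the identity. *)
Lemma shrink_tensor_expansion x :
  tmap (shrink S) (shrink S) x = tmap (unit_counit S) (unit_counit S) x +
    hvar *: (tmap (unit_counit S) (augment S) x + tmap (augment S) (shrink S) x).
Proof.
pose e := unit_counit S; pose p := augment S; pose s := shrink S.
move: x; apply: (ctens_ext (f := tmap s s) (g := chom_add (tmap e e)
  (chom_scale hvar (chom_add (tmap e p) (tmap p s))))) => v w.
rewrite -[RHS]/(tmap e e _ + hvar *: (tmap e p _ + tmap p s _)) !tmapE.
have bb := otimes_bilin H H; rewrite {1 2}/s (shrinkE S v) (bilinDl bb).
rewrite -/e -/p -/s {1}/s (shrinkE S w) (bilinDr bb) -/e -/p.
rewrite (otimesZl hvar (p v)) (otimesZr hvar (e v)).
by rewrite [hvar *: (otimes _ _ + _)]scalerDr addrA.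
Qed.
End MultiplicativityOnTensors.

Section Subcoalgebras.
Variables (k : fieldType) (H : cmod k) (HA : in_A H) (S : hopf H).

Let gH : good H := in_A_good HA.
Let H' := Hprime S HA.
Let incl : chom H' H := Hprime_incl S HA.

Lemma incl_emb : emb incl.
Proof. by move=> n; exists n. Qed.

Lemma in_incl a : in_Hprime S a -> exists x, a = incl x.
Proof. by move=> aP; exists (HprimeMod aP). Qed.

Lemma shrink_image a : hdvd 1 (augment S a) -> exists b, a = shrink S b.
Proof.
move=> [c ac]; exists (unit_counit S a + augment S c).
rewrite (chomD (shrink S)) shrink_unit_counit shrink_augment -(chomZ (augment S)).
by rewrite -[hvar]expr1 -ac augmentK unit_counitD.
Qed.

Lemma hdvd_augment_shrink a : hdvd 1 (augment S (shrink S a)).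
Proof. by exists (augment S a); rewrite augment_shrink. Qed.

(* H' is the largest subcoalgebra contained in the image k1 + hH of shrink.   *)
Lemma subcoalgebra_in_Hprime (P : cmod k) (i : chom P H) (D : chom P (ctens P P)) :
  (forall x, hdvd 1 (augment S (i x))) ->
  (forall x, comul S (i x) = tmap i i (D x)) ->
  forall x, in_Hprime S (i x).
Proof.
move=> iaug iD x; apply/(in_HprimeP _ _ gH) => n.
have [i1 i1P] : exists i1 : chom P H, forall x, i x = shrink S (i1 x).
  by apply: (emb_factor (shrink_emb S gH)) => y; exact: shrink_image.
suff [f fP] : exists f : chom P (tpow H n.+1), forall x,
  comul_iter S n.+1 (i x) = shrinkn S n.+1 (f x) by exists (f x).
elim: n => [|n [f fP]]; first by exists i1 => y; exact: i1P.
exists (chom_comp (tmap f i1) D) => y; rewrite comul_iterSS iD.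
exact: tmap_square.
Qed.

(** The two hypotheses of [tensor_image] are checked. Right contractions of x lie in H' by the
    criterion on the left legs. If mu(H') is in h^n k[[h]], the left contraction is h^n times some
    a; dividing its coproducts by h^n, one finds that a satisfies the criterion. *)
Lemma tensor_in_Hprime (x : ctens H H) :
  (forall m n, exists y, tmap (comul_iter S m.+1) (comul_iter S n.+1) x =
                         tmap (shrinkn S m.+1) (shrinkn S n.+1) y) ->
  exists y, x = tmap incl incl y.
Proof.
move=> xP; apply: (tensor_image gH gH incl_emb incl_emb) => [nu|n mu muP].
  apply: in_incl; apply/(in_HprimeP _ _ gH) => m; have [y xy] := xP m 0%N.
  by rewrite -rform_map [tmap _ _ x]xy rform_tmap; eexists.
have claim j : exists y,
    comul_iter S j.+1 (lform H mu x) = hvar ^+ n *: shrinkn S j.+1 y.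
  have [y0 xy0] := xP 0%N j; pose y' := tmap (shrink S) (chom_id _) y0.
  have xy' : tmap (chom_id H) (comul_iter S j.+1) x = tmap (chom_id H) (shrinkn S j.+1) y'.
    by rewrite [LHS]xy0 tmap_comp; exact: eq_tmap.
  have inj m : injective (tmap (chom_id (tpow H m.+1)) (shrinkn S j.+1)).
    apply: emb_inj; apply: emb_tmap (emb_id _) (shrinkn_emb S j gH);
      exact: good_tpow.
  (* Test divisibility on forms: exchanging the two contractions leaves mu evaluated at a right
     contraction of y', which lies in H'. There [inj] cancels the powers of u on the right legs. *)
  have [y3 y3P] : hdvd n (lform _ mu y').
    apply: form_detect; first exact: good_tpow.
    move=> la; rewrite lform_rform; have [|z ->] := @in_incl (rform H la y'); last exact: muP.
    apply/(in_HprimeP _ _ gH) => m; have [y'' xy''] := xP m j.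
    exists (rform _ la y''); rewrite -!rform_map; congr (rform _ la _).
    apply: inj; rewrite (tmap_square (j := comul_iter S m.+1) (g := chom_id H)
      (j' := chom_id _) (g' := shrinkn S j.+1)) // -xy' !tmap_comp.
    transitivity (tmap (shrinkn S m.+1) (shrinkn S j.+1) y''); last exact: eq_tmap.
    by rewrite -xy''; exact: eq_tmap.
  exists y3; rewrite -lform_map xy' lform_map y3P; exact: chomZ.
have [y0 y0P] := claim 0%N.
have [|w wP] := @in_incl (shrink S y0); last by exists w; rewrite -wP.
apply/(in_HprimeP _ _ gH) => j; have [y yP] := claim j; exists y.
apply: (good_inj (good_tpow j gH) (n := n)).
have w0E : lform H mu x = hvar ^+ n *: shrink S y0 := y0P.
by rewrite -yP w0E chomZ.
Qed.

(** Coassociativity: [al] and [al'] only move brackets, hence commute with powers of u. The index is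
    written so that it computes along the induction on n. *)
Lemma comul_split m n :
  exists al al' : chom (tpow H (n + m.+1).+1) (ctens (tpow H m.+1) (tpow H n.+1)),
    (forall a, tmap (comul_iter S m.+1) (comul_iter S n.+1) (comul S a) =
               al (comul_iter S (n + m.+1).+1 a)) /\
    (forall y, al (shrinkn S (n + m.+1).+1 y) =
               tmap (shrinkn S m.+1) (shrinkn S n.+1) (al' y)).
Proof.
elim: n => [|n [al [al' [alP al'P]]]].
  by exists (chom_id _), (chom_id _); split => [a|//]; rewrite [RHS]comul_iterSS.
exists (chom_comp (assoc (tpow H m.+1) (tpow H n.+1) H) (tmap al (chom_id H))).
exists (chom_comp (assoc (tpow H m.+1) (tpow H n.+1) H) (tmap al' (chom_id H))).
split=> [a|y]; first rewrite [RHS]chom_compE.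
  rewrite -[comul_iter S (n.+1 + m.+1).+1 a]/(comul_iter S (n + m.+1).+2 a) comul_iterSS.
  rewrite [tmap al _ _](tmap_square (j := tmap (comul_iter S m.+1) (comul_iter S n.+1))
    (g := comul S) (j' := chom_id H) (g' := chom_id H)) // assoc_natural comulA tmap_comp.
  by apply: eq_tmap => // x; exact: comul_iterSS.
rewrite [LHS]chom_compE [tmap al _ _](tmap_square (g := al')
  (j := tmap (shrinkn S m.+1) (shrinkn S n.+1)) (j' := shrink S) (g' := chom_id H)) //.
by rewrite assoc_natural.
Qed.

Let g1P : exists g1 : chom H' H, forall x, incl x = shrink S (g1 x).
Proof.
apply: (emb_factor (shrink_emb S gH)) => x.
exact: ((in_HprimeP S (incl x) gH).1 (Hprime_valP x) 0%N).
Qed.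

Lemma incl_augment x : hdvd 1 (augment S (incl x)).
Proof. by have [g1 ->] := g1P; exact: hdvd_augment_shrink. Qed.

Lemma comul_Hprime : exists D : chom H' (ctens H' H'),
  forall x, comul S (incl x) = tmap incl incl (D x).
Proof.
have ei : emb (tmap incl incl) by apply: emb_tmap => //; exact: incl_emb.
have [|D DP] := emb_factor (f := chom_comp (comul S) incl) ei; last by exists D.
move=> x; apply: tensor_in_Hprime => m n.
have [al [al' [alP al'P]]] := comul_split m n.
have [y yP] := (in_HprimeP S (incl x) gH).1 (Hprime_valP x) (n + m.+1)%N.
by exists (al' y); rewrite -al'P -yP -alP.
Qed.

(** Multiplication carries H' (x) H' onto a subcoalgebra, because Delta is multiplicative, and into
    k1 + hH by [shrink_tensor_expansion]. *)
Lemma mul_Hprime : exists M : chom (ctens H' H') H',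
  forall x, amul S (tmap incl incl x) = incl (M x).
Proof.
have [D DP] := comul_Hprime; have [g1 g1E] := g1P.
suff mP : forall x, in_Hprime S (amul S (tmap incl incl x)).
  have [|M MP] := emb_factor (f := chom_comp (amul S) (tmap incl incl)) incl_emb.
    by move=> x; exact: in_incl (mP x).
  by exists M.
apply: (@subcoalgebra_in_Hprime _ (chom_comp (amul S) (tmap incl incl))
  (chom_comp (tmid H' H' H' H') (tmap D D))) => x.
  pose e := unit_counit S; pose p := augment S; pose s := shrink S.
  rewrite chom_compE (eq_tmap (g := chom_comp s g1) (g' := chom_comp s g1) g1E g1E).
  rewrite -tmap_comp; move: (tmap g1 g1 x) => {}x.
  exists (p (amul S (chom_add (tmap e p) (tmap p s) x))).
  rewrite expr1 -(chomZ p) -(chomZ (amul S)).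
  rewrite shrink_tensor_expansion -/e -/p -/s -[_ + tmap p s x]/(chom_add (tmap e p) (tmap p s) x).
  rewrite !chomD (_ : p (amul S (tmap e e x)) = 0) ?add0r //.
  move: x; apply: (ctens_ext (f := chom_comp p (chom_comp (amul S) (tmap e e)))
    (g := chom_zero _ _)) => v w.
  rewrite -[LHS]/(p (amul S (tmap e e (otimes v w)))) tmapE -/(aprod S _ _).
  have mZl a (y z : H) : aprod S (a *: y) z = a *: aprod S y z.
    by rewrite /aprod otimesZl chomZ.
  have mZr a (y z : H) : aprod S y (a *: z) = a *: aprod S y z.
    by rewrite /aprod otimesZr chomZ.
  rewrite /e !unit_counitE mZl mZr (aprod1l (hopf_algP S)) !(chomZ p).
  by rewrite /p -(unit_counit1 S) augment_unit_counit !scaler0.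
rewrite -[LHS]/(comul S (amul S (tmap incl incl x))) comul_amul.
rewrite (tmap_square (j := tmap incl incl) (g := D) (j' := tmap incl incl) (g' := D)) //.
by rewrite tmid_natural tmap_comp.
Qed.

Lemma one_Hprime : in_Hprime S (aone S).
Proof.
suff /(_ 1) : forall c, in_Hprime S (unit_map S c) by rewrite [unit_map S 1]scale1r.
apply: (@subcoalgebra_in_Hprime _ (unit_map S)
  (bihom_app (bihom_swap (cscale _)) (otimes (1 : cunit k) (1 : cunit k)))) => c.
  exists 0; rewrite scaler0 -[unit_map S c]/((c : fps k) *: aone S) chomZ.
  by rewrite -(unit_counit1 S) augment_unit_counit scaler0.
rewrite -[LHS]/(comul S ((c : fps k) *: aone S)) chomZ (comul_alg S).2.
rewrite -[in RHS]/((c : fps k) *: otimes (1 : cunit k) (1 : cunit k)) chomZ tmapE.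
by congr (_ *: otimes _ _); rewrite -[RHS]/(_ *: aone S) scale1r.
Qed.

(* With p = id - eta eps, the antipode satisfies s = eta eps - s * p for the  *)
(* convolution product, and p maps H' into hH: iterating, s is on H' an       *)
(* h-adic limit of maps H' -> H'.                                             *)
Lemma antipode_Hprime : exists A : chom H' H', forall x, antipode S (incl x) = incl (A x).
Proof.
pose e := unit_counit S; pose p := augment S; pose s := antipode S.
have [D DP] := comul_Hprime; have [M MP] := mul_Hprime.
have [o oP] := in_incl one_Hprime.
pose e' : chom H' H' := chom_comp (bihom_app (bihom_swap (cscale H')) o) (chom_comp (counit S) incl).
have e'P x : e (incl x) = incl (e' x).
  by rewrite -[RHS]/(incl (_ *: o)) chomZ -oP.
pose p' := chom_add (chom_id H') (chom_scale (-1) e').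
have p'P x : p (incl x) = incl (p' x).
  by rewrite -[RHS]/(incl (x + _ *: e' x)) chomD chomZ -e'P.
have [q qP] : exists q : chom H' H, forall x, p (incl x) = hvar *: q x.
  have eh : emb (chom_scale hvar (chom_id H)).
    move=> n; exists n.+1 => v /gH.1[w vw]; apply/gH.1; exists w.
    by apply: (good_inj gH (n := 1)); rewrite scalerA -exprD expr1.
  have [|q qP] := emb_factor (f := chom_comp p incl) eh; last by exists q.
  by move=> x; have [y yP] := incl_augment x; exists y; rewrite -[LHS]/(p (incl x)) /p yP.
have sE x : s x = e x - amul S (tmap s p (comul S x)).
  have -> : tmap s p (comul S x) = tmap s (chom_id H) (comul S x) -
      tmap s e (comul S x).
    rewrite -scaleN1r; move: (comul S x); apply: (ctens_ext (f := tmap s p)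
      (g := chom_add (tmap s (chom_id H)) (chom_scale (-1) (tmap s e)))) => v w.
    rewrite -[RHS]/(tmap s _ _ + (-1) *: tmap s e _) !tmapE -otimesZr.
    by rewrite -(bilinDr (otimes_bilin H H)).
  rewrite linearB antipodel -[_ *: aone S]/(e x) subKr.
  have -> : tmap s e (comul S x) =
      tmap s (unit_map S) (tmap (chom_id H) (counit S) (comul S x)).
    by rewrite tmap_comp; exact: eq_tmap.
  rewrite comul1r tmapE [X in otimes _ X]scale1r -[RHS]/(aprod S _ _).
  by rewrite (aprod1r (hopf_algP S)).
(* Inserting an approximation of the antipode of order N into [sE] raises the order by one, the
   extra h coming from p = h q on H'. *)
have ex N : exists (g : chom H' H') (r : chom H' H),
    forall x, s (incl x) = incl (g x) + hvar ^+ N *: r x.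
  elim: N => [|N [g [r grP]]].
    exists (chom_zero _ _), (chom_comp s incl) => x.
    by rewrite -[chom_zero _ _ x]/(0 : H') linear0 add0r scale1r.
  exists (chom_add e' (chom_scale (-1) (chom_comp M (chom_comp (tmap g p') D)))).
  exists (chom_scale (-1) (chom_comp (amul S) (chom_comp (tmap r q) D))) => x.
  rewrite sE DP tmap_comp.
  have -> : tmap (chom_comp s incl) (chom_comp p incl) (D x) =
      tmap incl incl (tmap g p' (D x)) + hvar ^+ N.+1 *: tmap r q (D x).
    move: (D x); apply: (ctens_ext (g := chom_add (chom_comp (tmap incl incl) (tmap g p'))
      (chom_scale (hvar ^+ N.+1) (tmap r q)))) => v w.
    rewrite -[RHS]/(tmap incl incl (tmap g p' _) + _ *: tmap r q _) !tmapE.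
    rewrite -[LHS]/(otimes (s (incl v)) (p (incl w))) grP (bilinDl (otimes_bilin H H)).
    by rewrite {1}(p'P w) (qP w) (otimesZl (hvar ^+ N)) (otimesZr hvar) scalerA exprSr.
  rewrite (chomD (amul S)) MP (chomZ (amul S)) opprD addrA.
  rewrite -[in RHS]/(incl (e' x + -1 *: M (tmap g p' (D x)))) chomD (chomZ incl (-1) (M _)) -e'P.
  by rewrite -[X in _ = _ + _ *: X]/(-1 *: amul S (tmap r q (D x))) !scaleN1r scalerN.
have [|A AP] := emb_factor (f := chom_comp s incl) incl_emb; last by exists A.
move=> x; apply: (emb_closed incl_emb) => n; have [g [r grP]] := ex n.
exists (incl (g x)); first by exists (g x).
by rewrite -[chom_comp s incl x]/(s (incl x)) grP addrC addKr; exact: filt_hX.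
Qed.
End Subcoalgebras.

Section TensorAlgebras.
Variable k : fieldType.
Implicit Types V W X : cmod k.

Lemma amul_hom V W (A : alg_ops V) (B : alg_ops W) (f : chom V W) t :
  {morph f : x y / aprod A x y >-> aprod B x y} ->
  f (amul A t) = amul B (tmap f f t).
Proof.
move=> fM; move: t.
by apply: ctens_ext2 => x y; rewrite tmapE; exact: fM.
Qed.

Lemma aprod_alg_tens V W (A : alg_ops V) (B : alg_ops W) x y :
  aprod (alg_tens A B) x y = tmap (amul A) (amul B) (tmid V W V W (otimes x y)).
Proof. by []. Qed.

Lemma tmap_alg_hom V V' W W' (A : alg_ops V) (A' : alg_ops V') (B : alg_ops W)
    (B' : alg_ops W') (f : chom V V') (g : chom W W') :
  is_alg_hom A A' f -> is_alg_hom B B' g ->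
  is_alg_hom (alg_tens A B) (alg_tens A' B') (tmap f g).
Proof.
move=> [fM f1] [gM g1]; split=> [x y|]; last by rewrite tmapE f1 g1.
rewrite !aprod_alg_tens -tmapE tmid_natural.
by apply: tmap_square => t; exact: amul_hom.
Qed.
End TensorAlgebras.

Section HprimeHopf.
Variables (k : fieldType) (H : cmod k) (HA : in_A H) (S : hopf H).

Let gH : good H := in_A_good HA.
Let H' := Hprime S HA.
Let incl : chom H' H := Hprime_incl S HA.

Lemma Hprime_topfree : topfree H'.
Proof.
apply: hcomplete_topfree; apply: (closed_image_hcomplete gH (j := incl)).
  exact: emb_inj (incl_emb HA S).
exact: emb_closed (incl_emb HA S).
Qed.

(** The axioms are identities checked in H, since the inclusion and its tensor powers are
    injective. *)
Lemma Hprime_hopf : exists S' : hopf H', is_hopf_hom S' S incl.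
Proof.
have [M MP] := mul_Hprime HA S; have [D DP] := comul_Hprime HA S.
have [A AP] := antipode_Hprime HA S; have [o oP] := in_incl HA (one_Hprime HA S).
rewrite -/incl in MP DP AP oP.
have ei : emb incl := incl_emb HA S.
have inj := emb_inj ei.
have ei2 : emb (tmap incl incl) := emb_tmap gH gH ei ei.
have inj2 := emb_inj ei2.
pose B := AlgOps M o.
have mE x y : incl (aprod B x y) = aprod S (incl x) (incl y).
  by rewrite -[LHS]/(incl (M (otimes x y))) -MP tmapE.
have BP : is_alg B.
  by split=> [x y z|x|x]; apply: inj; rewrite !mE;
    [exact: aprodA (hopf_algP S) _ _ _|rewrite -oP; exact: aprod1l (hopf_algP S) _|
     rewrite -oP; exact: aprod1r (hopf_algP S) _].
have iB : is_alg_hom B S incl by [].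
have iB2 := tmap_alg_hom iB iB.
have DB : is_alg_hom B (alg_tens B B) D.
  split=> [x y|]; apply: inj2; rewrite -DP.
    by rewrite mE (comul_alg S).1 !DP iB2.1.
  by rewrite -oP (comul_alg S).2 tmapE -oP.
pose c := chom_comp (counit S) incl.
have cM x y : c (aprod B x y) = (c x : fps k) * (c y : fps k).
  by rewrite -[LHS]/(counit S (incl _)) mE counitM.
have c1 : c (aone B) = (1 : fps k) by rewrite -[LHS]/(counit S (incl o)) -oP counit1.
have i3 : injective (tmap incl (tmap incl incl)).
  by apply: emb_inj; apply: emb_tmap => //; exact: good_ctens.
have DA x : assoc H' H' H' (tmap D (chom_id H') (D x)) = tmap (chom_id H') D (D x).
  apply: i3; rewrite -assoc_natural.
  rewrite (tmap_square (j := comul S) (g := incl) (j' := chom_id _) (g' := incl)) // -DP comulA.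
  by rewrite DP; apply: tmap_square => // y; rewrite DP.
have il : injective (tmap (chom_id (cunit k)) incl).
  by apply: emb_inj; apply: emb_tmap => //; [exact: good_cunit|exact: emb_id].
have ir : injective (tmap incl (chom_id (cunit k))).
  by apply: emb_inj; apply: emb_tmap => //; [exact: good_cunit|exact: emb_id].
have Dl x : tmap c (chom_id H') (D x) = otimes (1 : cunit k) x.
  apply: il; rewrite tmapE -[RHS](comul1l S) DP.
  exact: tmap_square.
have Dr x : tmap (chom_id H') c (D x) = otimes x (1 : cunit k).
  apply: ir; rewrite tmapE -[RHS](comul1r S) DP.
  exact: tmap_square.
have Al x : amul B (tmap A (chom_id H') (D x)) = (c x : fps k) *: aone B.
  apply: inj; rewrite chomZ -[incl (amul B _)]/(incl (M _)) -MP -oP.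
  rewrite -[RHS](antipodel S) DP; congr (amul S _).
  by apply: tmap_square => // y; rewrite AP.
have Ar x : amul B (tmap (chom_id H') A (D x)) = (c x : fps k) *: aone B.
  apply: inj; rewrite chomZ -[incl (amul B _)]/(incl (M _)) -MP -oP.
  rewrite -[RHS](antipoder S) DP; congr (amul S _).
  by apply: tmap_square => // y; rewrite AP.
by exists (Hopf BP DB cM c1 DA Dl Dr Al Ar); split.
Qed.
End HprimeHopf.

(** * Conjugation by the R-matrix *)

Section Multiplications.
Variables (k : fieldType) (V : cmod k) (A : alg_ops V).

Lemma aprod_bilin : bilin (aprod A).
Proof.
have bb := otimes_bilin V V.
by split=> *; rewrite /aprod ?(bilinDl bb) ?(bilinDr bb) ?(bilinZl bb) ?(bilinZr bb)
  ?linearD ?chomZ.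
Qed.

Lemma aprod_cont n : exists m, is_modulus (aprod A) n m.
Proof.
have [m mP] := chom_cont (amul A) n; exists m; have [o1 o2] := otimes_modulus V V m.
by split=> v w vw; apply: mP; [exact: o1|exact: o2].
Qed.

Definition aprod_bihom : bihom V V V := Bihom aprod_bilin aprod_cont.
Definition lmul a : chom V V := bihom_app aprod_bihom a.
Definition rmul a : chom V V := bihom_app (bihom_swap aprod_bihom) a.
Definition conjugation a b : chom V V := chom_comp (rmul b) (lmul a).

Lemma conjE a b x : conjugation a b x = aprod A (aprod A a x) b. Proof. by []. Qed.

Hypothesis AP : is_alg A.
Local Notation "x ** y" := (aprod A x y) (at level 40, left associativity).
Local Notation e := (aone A).
Let mA : associative (aprod A) := aprodA AP.
Let m1l := aprod1l AP.
Let m1r := aprod1r AP.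

Lemma aprod_inv_uniq u v w : v ** u = e -> u ** w = e -> v = w.
Proof. by move=> vu uw; rewrite -[v]m1r -uw mA vu m1l. Qed.

Lemma conjK a b : b ** a = e -> cancel (conjugation a b) (conjugation b a).
Proof. by move=> ba x; rewrite !conjE !mA ba m1l -mA ba m1r. Qed.

Lemma conj_alg_hom a b : a ** b = e -> b ** a = e -> is_alg_hom A A (conjugation a b).
Proof.
move=> ab ba; split=> [x y|]; rewrite !conjE; last by rewrite m1r.
by rewrite !mA -[_ ** b ** a]mA ba m1r.
Qed.

Lemma conjM a b c d x : conjugation (a ** b) (d ** c) x = conjugation a c (conjugation b d x).
Proof. by rewrite !conjE !mA. Qed.
(** With a = 1 + h r: a x b - x = (a x - x a) b = h (r x - x r) b. *)
Lemma conj_deform a b : a ** b = e -> hdvd 1%N (a - e) ->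
  exists N : chom V V, forall x, conjugation a b x = x + hvar *: N x.
Proof.
move=> ab [r]; rewrite expr1 => rE; have bb := aprod_bilin.
exists (chom_comp (rmul b) (chom_add (lmul r) (chom_scale (-1) (rmul r)))) => x.
rewrite -[RHS]/(x + hvar *: ((r ** x + (-1) *: (x ** r)) ** b)) scaleN1r conjE.
rewrite -(bilinZl bb) scalerBr -(bilinZl bb) -(bilinZr bb) -rE.
have -> : (a - e) ** x - x ** (a - e) = a ** x - x ** a.
  rewrite (bilinDl bb a) (bilinDr bb x a) (bilinNl bb) (bilinNr bb) m1l m1r.
  by rewrite opprB addrA subrK.
by rewrite (bilinDl bb) (bilinNl bb) -[x ** a ** b]mA ab m1r addrC subrK.
Qed.
Lemma inv_deform a b : b ** a = e -> hdvd 1%N (a - e) -> hdvd 1%N (b - e).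
Proof.
move=> ba [r rE]; exists (- (b ** r)); have bb := aprod_bilin.
by rewrite scalerN -(bilinZr bb) -rE (bilinDr bb) (bilinNr bb) ba m1r opprB.
Qed.
End Multiplications.

Section TensorConjugation.
Variable k : fieldType.
Implicit Types U V W X : cmod k.

Lemma alg_hom_comp V W X (A : alg_ops V) (B : alg_ops W) (C : alg_ops X)
    (f : chom W X) (g : chom V W) :
  is_alg_hom B C f -> is_alg_hom A B g -> is_alg_hom A C (chom_comp f g).
Proof.
by move=> [fM f1] [gM g1]; split=> [x y|]; rewrite [LHS]chom_compE ?gM ?fM ?g1 ?f1.
Qed.

Lemma alg_hom_conj V W (A : alg_ops V) (B : alg_ops W) (f : chom V W) a b x :
  is_alg_hom A B f -> f (conjugation A a b x) = conjugation B (f a) (f b) (f x).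
Proof. by move=> [fM _]; rewrite !conjE !fM. Qed.

(** Turns a factorisation of an element, such as R_13 R_23, into a composite of conjugations; the
    value f b is forced, being the inverse of f a. *)
Lemma alg_hom_conj_prod V W (A : alg_ops V) (B : alg_ops W) (f g g' : V -> W) a b x :
  is_alg B -> is_alg_hom A B f -> is_alg_hom A B g -> is_alg_hom A B g' ->
  aprod A a b = aone A -> aprod A b a = aone A -> f a = aprod B (g a) (g' a) ->
  f (conjugation A a b x) = conjugation B (g a) (g b) (conjugation B (g' a) (g' b) (f x)).
Proof.
move=> BP [fM f1] [gM g1] [g'M g'1] ab ba fa.
have fb : f b = aprod B (g' b) (g b).
  apply: (aprod_inv_uniq BP (u := f a)); first by rewrite -fM ba.
  rewrite fa -(aprodA BP) [X in aprod B _ X](aprodA BP) -g'M ab g'1.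
  by rewrite (aprod1l BP) -gM ab.
by rewrite -(conjM BP) -fa -fb !conjE !fM.
Qed.

Lemma alg_hom_ext V W X (A : alg_ops (ctens V W)) (B : alg_ops X) (f : chom (ctens V W) X) :
  (forall v w v' w', f (aprod A (otimes v w) (otimes v' w')) =
     aprod B (f (otimes v w)) (f (otimes v' w'))) ->
  {morph f : x y / aprod A x y >-> aprod B x y}.
Proof.
move=> fM x y; move: x; apply: (ctens_ext2 (f := f) (g := rmul A y)
  (f' := rmul B (f y)) (g' := f)) => v w.
move: y; apply: (ctens_ext2 (f := f) (g := lmul A (otimes v w))
  (f' := lmul B (f (otimes v w))) (g' := f)) => v' w'.
exact: fM.
Qed.

Lemma is_alg_ext V W (T : alg_ops (ctens V W)) :
  (forall v w v' w' v'' w'', let x := otimes v w in let y := otimes v' w' in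
     let z := otimes v'' w'' in aprod T x (aprod T y z) = aprod T (aprod T x y) z) ->
  (forall v w, aprod T (aone T) (otimes v w) = otimes v w) ->
  (forall v w, aprod T (otimes v w) (aone T) = otimes v w) -> is_alg T.
Proof.
move=> TA T1l T1r; split=> [x y z|x|x].
- move: x; apply: (ctens_ext (f := rmul T (aprod T y z))
    (g := chom_comp (rmul T z) (rmul T y))) => v w.
  rewrite -[LHS]/(aprod T (otimes v w) (aprod T y z)).
  rewrite -[RHS]/(aprod T (aprod T (otimes v w) y) z).
  move: y; apply: (ctens_ext (f := chom_comp (lmul T (otimes v w)) (rmul T z))
    (g := chom_comp (rmul T z) (lmul T (otimes v w)))) => v' w'.
  rewrite -[LHS]/(aprod T (otimes v w) (aprod T (otimes v' w') z)).
  rewrite -[RHS]/(aprod T (aprod T (otimes v w) (otimes v' w')) z).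
  move: z; apply: (ctens_ext (f := chom_comp (lmul T (otimes v w)) (lmul T (otimes v' w')))
    (g := lmul T (aprod T (otimes v w) (otimes v' w')))) => v'' w''.
  exact: TA.
- by move: x; apply: (ctens_ext (f := lmul T (aone T)) (g := chom_id _)); exact: T1l.
- by move: x; apply: (ctens_ext (f := rmul T (aone T)) (g := chom_id _)); exact: T1r.
Qed.

Lemma alg_tensP V W (A : alg_ops V) (B : alg_ops W) :
  is_alg A -> is_alg B -> is_alg (alg_tens A B).
Proof.
move=> AP BP; apply: is_alg_ext => [v w v' w' v'' w'' /=|v w|v w].
- by rewrite !aprod_tens (aprodA AP) (aprodA BP).
- by rewrite aprod_tens (aprod1l AP) (aprod1l BP).
- by rewrite aprod_tens (aprod1r AP) (aprod1r BP).
Qed.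

Lemma flip_alg_hom V W (A : alg_ops V) (B : alg_ops W) :
  is_alg_hom (alg_tens A B) (alg_tens B A) (flip V W).
Proof.
split; last by rewrite flipE.
by apply: alg_hom_ext => v w v' w'; rewrite aprod_tens !flipE aprod_tens.
Qed.

Lemma assocV_alg_hom U V W (A : alg_ops U) (B : alg_ops V) (C : alg_ops W) :
  is_alg_hom (alg_tens A (alg_tens B C)) (alg_tens (alg_tens A B) C) (assocV U V W).
Proof.
split; last by rewrite assocVE.
apply: alg_hom_ext => u t u' t'.
set T := alg_tens A (alg_tens B C); set T' := alg_tens _ C.
pose o u := bihom_app (otimes_bihom U (ctens V W)) u.
move: t; apply: (ctens_ext2 (f := chom_comp (assocV U V W) (rmul T (otimes u' t')))
  (g := o u) (f' := chom_comp (rmul T' (assocV U V W (otimes u' t'))) (assocV U V W))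
  (g' := o u)) => v w.
move: t'; apply: (ctens_ext2 (f := chom_comp (assocV U V W) (lmul T (otimes u (otimes v w))))
  (g := o u') (f' := chom_comp (lmul T' (assocV U V W (otimes u (otimes v w)))) (assocV U V W))
  (g' := o u')) => v' w'.
rewrite -[LHS]/(assocV U V W (aprod T (otimes u (otimes v w)) (otimes u' (otimes v' w')))).
rewrite -[RHS]/(aprod T' (assocV U V W (otimes u (otimes v w)))
  (assocV U V W (otimes u' (otimes v' w')))).
by rewrite !(aprod_tens, assocVE).
Qed.

Lemma conj_id_tens V W (A : alg_ops V) (B : alg_ops W) a b x : is_alg A ->
  tmap (chom_id V) (conjugation B a b) x =
  conjugation (alg_tens A B) (otimes (aone A) a) (otimes (aone A) b) x.
Proof.
move=> AP; move: x; apply: ctens_ext => v w; rewrite conjE !aprod_tens tmapE.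
by rewrite (aprod1l AP) (aprod1r AP).
Qed.

Lemma conj_tens_id V W (A : alg_ops V) (B : alg_ops W) a b x : is_alg B ->
  tmap (conjugation A a b) (chom_id W) x =
  conjugation (alg_tens A B) (otimes a (aone B)) (otimes b (aone B)) x.
Proof.
move=> BP; move: x; apply: ctens_ext => v w; rewrite conjE !aprod_tens tmapE.
by rewrite (aprod1l BP) (aprod1r BP).
Qed.
End TensorConjugation.

Section AdBraiding.
Variables (k : fieldType) (H : cmod k) (S : hopf H) (R Rinv : tens2 H).
Hypothesis RP : is_Rmatrix S R Rinv.

Let SP := hopf_algP S.
Let A2P : is_alg (alg2 S) := alg_tensP SP SP.
Let A3P : is_alg (alg3 S) := alg_tensP A2P SP.

Definition Adc : chom (tens2 H) (tens2 H) := conjugation (alg2 S) R Rinv.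
Definition Adcinv : chom (tens2 H) (tens2 H) := conjugation (alg2 S) Rinv R.

Lemma AdcK : cancel Adc Adcinv.
Proof. exact: conjK (Rmatrix_invl RP). Qed.
Lemma AdcinvK : cancel Adcinv Adc.
Proof. exact: conjK (Rmatrix_invr RP). Qed.

Let flip12_hom : is_alg_hom (alg3 S) (alg3 S) (flip12 H).
Proof. by apply: tmap_alg_hom; [exact: flip_alg_hom|]. Qed.

Let elt23_hom : is_alg_hom (alg_tens S (alg2 S)) (alg3 S) (assocV H H H).
Proof. exact: assocV_alg_hom. Qed.

Let comul_id_hom : is_alg_hom (alg2 S) (alg3 S) (comul_id S).
Proof. by apply: tmap_alg_hom; [exact: comul_alg|]. Qed.

Let id_comul_hom : is_alg_hom (alg2 S) (alg3 S) (id_comul S).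
Proof.
have fh : is_alg_hom (alg2 S) (alg_tens S (alg2 S)) (tmap (chom_id H) (comul S)).
  by apply: tmap_alg_hom; [|exact: comul_alg].
exact: alg_hom_comp elt23_hom fh.
Qed.

Lemma op23_Adc x : op23 Adc x = conjugation (alg3 S) (elt23 S R) (elt23 S Rinv) x.
Proof.
rewrite -[LHS]/(assocV H H H (tmap (chom_id H) Adc (assoc H H H x))).
rewrite (conj_id_tens _ _ _ _ SP) (alg_hom_conj _ _ _ elt23_hom) assocK.
by [].
Qed.

Let flip12K : involutive (flip12 H).
Proof. by apply: tmap_cancel; [exact: flipK|]. Qed.

Lemma op13_Adc x : op13 Adc x = conjugation (alg3 S) (elt13 S R) (elt13 S Rinv) x.
Proof.
rewrite -[LHS]/(flip12 H (op23 Adc (flip12 H x))) op23_Adc.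
by rewrite (alg_hom_conj _ _ _ flip12_hom) flip12K.
Qed.

Lemma op12_Adc x : op12 Adc x = conjugation (alg3 S) (elt12 S R) (elt12 S Rinv) x.
Proof. exact: conj_tens_id. Qed.

Let e23_hom : is_alg_hom (alg2 S) (alg3 S) (elt23 S).
Proof.
split; last exact: elt23_hom.2.
by move=> x y; rewrite /elt23 -elt23_hom.1 aprod_tens (aprod1l SP).
Qed.
Let e13_hom : is_alg_hom (alg2 S) (alg3 S) (elt13 S).
Proof.
by split=> [x y|]; rewrite /elt13 ?e23_hom.1 ?e23_hom.2 ?flip12_hom.1 ?flip12_hom.2.
Qed.
Let e12_hom : is_alg_hom (alg2 S) (alg3 S) (elt12 S).
Proof. by split=> // x y; rewrite /elt12 aprod_tens (aprod1l SP). Qed.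

Lemma Adc_braiding : braiding_identities S Adc.
Proof.
split=> [|a|x|x].
- split; first exact: (conj_alg_hom A2P (Rmatrix_invr RP) (Rmatrix_invl RP)).
  by exists Adcinv; split; [exact: AdcK|exact: AdcinvK].
- exact: Rmatrix_comul RP a.
- rewrite op13_Adc op23_Adc; exact: (alg_hom_conj_prod x A3P comul_id_hom e13_hom e23_hom
    (Rmatrix_invr RP) (Rmatrix_invl RP) (Rmatrix_comul_id RP)).
- rewrite op13_Adc op12_Adc; exact: (alg_hom_conj_prod x A3P id_comul_hom e13_hom e12_hom
    (Rmatrix_invr RP) (Rmatrix_invl RP) (Rmatrix_id_comul RP)).
Qed.

Lemma Adc1 : Adc (aone (alg2 S)) = aone (alg2 S).
Proof. exact: (conj_alg_hom A2P (Rmatrix_invr RP) (Rmatrix_invl RP)).2. Qed.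
Lemma Adcinv1 : Adcinv (aone (alg2 S)) = aone (alg2 S).
Proof. exact: (conj_alg_hom A2P (Rmatrix_invl RP) (Rmatrix_invr RP)).2. Qed.

Lemma Adcinv_deform : hdvd 1 (R - aone (alg2 S)) ->
  exists N : chom (tens2 H) (tens2 H), forall x, Adcinv x = x + hvar *: N x.
Proof.
move=> R1; apply: (conj_deform A2P (Rmatrix_invl RP)).
exact: (inv_deform A2P (Rmatrix_invl RP) R1).
Qed.

Lemma Adc_deform : hdvd 1 (R - aone (alg2 S)) ->
  exists N : chom (tens2 H) (tens2 H), forall x, Adc x = x + hvar *: N x.
Proof.
by move=> R1; apply: (conj_deform A2P (Rmatrix_invr RP)).
Qed.
End AdBraiding.

(** * Legs of tensor powers *)

Section LegOperators.
Variable k : fieldType.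
Implicit Types X Y Z : cmod k.

(** [op23] for three different factors, as needed once the legs have become tensor powers of H;
    [leg13] likewise generalises [op13]. *)
Definition leg23 X Z Y (F : chom (ctens Z Y) (ctens Z Y)) :
    chom (ctens (ctens X Z) Y) (ctens (ctens X Z) Y) :=
  chom_comp (assocV X Z Y) (chom_comp (tmap (chom_id X) F) (assoc X Z Y)).

Definition leg13 X Z Y (F : chom (ctens X Y) (ctens X Y)) :
    chom (ctens (ctens X Z) Y) (ctens (ctens X Z) Y) :=
  chom_comp (tmap (flip Z X) (chom_id Y))
    (chom_comp (leg23 Z F) (tmap (flip X Z) (chom_id Y))).

Lemma leg23_natural X X' Z Z' Y Y' (f : chom X X') (g : chom Z Z') (e : chom Y Y')
    (F : chom (ctens Z' Y') (ctens Z' Y')) (F' : chom (ctens Z Y) (ctens Z Y)) :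
  (forall x, F (tmap g e x) = tmap g e (F' x)) ->
  forall x, leg23 X' F (tmap (tmap f g) e x) = tmap (tmap f g) e (leg23 X F' x).
Proof.
move=> FF' x; rewrite -[LHS]/(assocV _ _ _ (tmap (chom_id X') F (assoc _ _ _ _))).
rewrite assoc_natural (tmap_square (j := f) (g := chom_id X) (j' := tmap g e) (g' := F')) //.
by rewrite assocV_natural.
Qed.

Lemma leg13_natural X X' Z Z' Y Y' (f : chom X X') (g : chom Z Z') (e : chom Y Y')
    (F : chom (ctens X' Y') (ctens X' Y')) (F' : chom (ctens X Y) (ctens X Y)) :
  (forall x, F (tmap f e x) = tmap f e (F' x)) ->
  forall x, leg13 Z' F (tmap (tmap f g) e x) = tmap (tmap f g) e (leg13 Z F' x).
Proof.
move=> FF' x; have fl X1 X2 Z1 Z2 (f1 : chom X1 X2) (g1 : chom Z1 Z2) (y : ctens (ctens X1 Z1) Y) :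
    tmap (flip X2 Z2) (chom_id Y') (tmap (tmap f1 g1) e y) =
    tmap (tmap g1 f1) e (tmap (flip X1 Z1) (chom_id Y) y).
  by apply: tmap_square => // z; exact: flip_natural.
rewrite -[LHS]/(tmap (flip Z' X') (chom_id Y')
  (leg23 Z' F (tmap (flip X' Z') (chom_id Y') (tmap (tmap f g) e x)))).
by rewrite fl (leg23_natural _ FF') fl.
Qed.

Lemma chom_comp_cancel V W X (f : chom V W) (f' : chom W V) (g : chom W X) (g' : chom X W) :
  cancel f f' -> cancel g g' -> cancel (chom_comp g f) (chom_comp f' g').
Proof. by move=> fK gK x; exact: etrans (congr1 f' (gK (f x))) (fK x). Qed.

Lemma chom_comp_square V W X V' W' X' (f : chom V W) (g : chom W X) (i : chom V' V)
    (j : chom W' W) (l : chom X' X) (f' : chom V' W') (g' : chom W' X') :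
  (forall x, f (i x) = j (f' x)) -> (forall x, g (j x) = l (g' x)) ->
  forall x, chom_comp g f (i x) = l (chom_comp g' f' x).
Proof. by move=> fi gj x; exact: etrans (congr1 g (fi x)) (gj (f' x)). Qed.

Lemma leg23_cancel X Z Y (F G : chom (ctens Z Y) (ctens Z Y)) :
  cancel F G -> cancel (leg23 X F) (leg23 X G).
Proof.
move=> FK; have tK : cancel (tmap (chom_id X) F) (tmap (chom_id X) G).
  exact: tmap_cancel.
exact: (chom_comp_cancel (chom_comp_cancel (@assocK _ X Z Y) tK) (@assocVK _ X Z Y)).
Qed.

Lemma leg13_cancel X Z Y (F G : chom (ctens X Y) (ctens X Y)) :
  cancel F G -> cancel (leg13 Z F) (leg13 Z G).
Proof.
move=> FK; have fK X1 X2 : cancel (tmap (flip X1 X2) (chom_id Y)) (tmap (flip X2 X1) (chom_id Y)).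
  by apply: tmap_cancel => //; exact: flipK.
exact: (chom_comp_cancel (chom_comp_cancel (fK X Z) (leg23_cancel (X := Z) FK)) (fK Z X)).
Qed.
End LegOperators.

(** * Stability of H' (x) H' under a braiding *)

Section BraidingPreservesHprime.
Variables (k : fieldType) (H : cmod k) (HA : in_A H) (S : hopf H).

Let gH : good H := in_A_good HA.
Let H' := Hprime S HA.
Let incl : chom H' H := Hprime_incl S HA.
Let s := shrink S.

(** Write u (x) u = e (x) e + h Y with e = eta eps. B fixes the first term and changes h Y by h^2 N
    Y, and h^2 is (u (x) u) composed with the square of [unshrink]. Thus B1 = id + (v (x) v) N Y
    with v = [unshrink]. *)
Lemma deform_shrink (B N : chom (ctens H H) (ctens H H)) :
  (forall x, B x = x + hvar *: N x) ->
  B (otimes (aone S) (aone S)) = otimes (aone S) (aone S) ->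
  exists B1 : chom (ctens H H) (ctens H H), forall x, B (tmap s s x) = tmap s s (B1 x).
Proof.
move=> BN B1; pose e := unit_counit S; pose p := augment S; pose v := unshrink S.
pose Y := chom_add (tmap e p) (tmap p s).
have vvE z : hvar ^+ 2 *: z = tmap s s (tmap v v z).
  rewrite tmap_comp; move: z; apply: (ctens_ext (f := chom_scale (hvar ^+ 2) (chom_id _))) => a b.
  rewrite -[LHS]/(hvar ^+ 2 *: otimes a b) tmapE -[RHS]/(otimes (s (v a)) (s (v b))).
  by rewrite /s /v !unshrinkK (otimesZl hvar) (otimesZr hvar) scalerA.
have Bee x : B (tmap e e x) = tmap e e x.
  move: x; apply: ctens_ext1 => a b; rewrite tmapE !unit_counitE.
  by rewrite otimesZl otimesZr !(chomZ B) B1.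
exists (chom_add (chom_id _) (chom_comp (tmap v v) (chom_comp N Y))) => x.
have sE : tmap s s x = tmap e e x + hvar *: Y x := shrink_tensor_expansion S x.
apply: (@etrans _ _ (tmap s s (x + tmap v v (N (Y x))))); last by [].
rewrite (chomD (tmap s s)) -vvE sE (chomD B) Bee (chomZ B hvar) BN.
by rewrite [hvar *: (Y x + _)]scalerDr scalerA addrA.
Qed.

Variables B B' : chom (tens2 H) (tens2 H).
Hypothesis BP : braiding_identities S B.
Hypothesis B'K : cancel B' B.

(* B acts on X (x) Y, compatibly with d (x) d' and preserving the image of    *)
(* u (x) u'.                                                                  *)
Definition transported X Y (d : chom H X) (d' : chom H Y) (u : chom X X) (u' : chom Y Y) :=
  exists F F' F1 F1' : chom (ctens X Y) (ctens X Y),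
  [/\ cancel F F' /\ cancel F' F,
      forall x, tmap d d' (B x) = F (tmap d d' x),
      forall x, F (tmap u u' x) = tmap u u' (F1 x) &
      forall x, F' (tmap u u' x) = tmap u u' (F1' x)].

Lemma leg_transport X Y Z (d : chom H X) (d' : chom H Y) (f : chom H Z)
    (F : chom (ctens X Y) (ctens X Y)) x :
  (forall x, tmap d d' (B x) = F (tmap d d' x)) ->
  tmap (tmap d f) d' (op13 B x) = leg13 Z F (tmap (tmap d f) d' x).
Proof. by move=> FB; rewrite (leg13_natural f (F' := B)). Qed.

(** In (Delta (x) id) B = B_13 B_23 (Delta (x) id), F transports the factor B_13 to the block X and
    G the factor B_23 to the new leg. *)
Lemma transported_left X Y (d : chom H X) (d' : chom H Y) u u' :
  transported d d' u u' -> transported (chom_id H) d' s u' ->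
  transported (chom_comp (tmap d (chom_id H)) (comul S)) d' (tmap u s) u'.
Proof.
move=> [F [F' [F1 [F1' [[FK F'K] FB Fu Fu']]]]] [G [G' [G1 [G1' [[GK G'K] GB Gu Gu']]]]].
exists (chom_comp (leg13 H F) (leg23 X G)), (chom_comp (leg23 X G') (leg13 H F')).
exists (chom_comp (leg13 H F1) (leg23 X G1)), (chom_comp (leg23 X G1') (leg13 H F1')).
have E x : tmap (chom_comp (tmap d (chom_id H)) (comul S)) d' x =
    tmap (tmap d (chom_id H)) d' (comul_id S x).
  by rewrite tmap_comp; apply: eq_tmap.
split=> [|x|x|x].
- split; first exact: (chom_comp_cancel (leg23_cancel (X := X) GK) (leg13_cancel (Z := H) FK)).
  exact: (chom_comp_cancel (leg13_cancel (Z := H) F'K) (leg23_cancel (X := X) G'K)).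
- rewrite !E (braiding_comul_id BP) (leg_transport _ _ FB).
  by apply: congr1; apply/esym; apply: leg23_natural.
- exact: (chom_comp_square (leg23_natural u Gu) (leg13_natural s Fu)).
- exact: (chom_comp_square (leg13_natural s Fu') (leg23_natural u Gu')).
Qed.

Lemma transported_right X Y (d : chom H X) (d' : chom H Y) u u' :
  transported d d' u u' -> transported d (chom_id H) u s ->
  transported d (chom_comp (tmap d' (chom_id H)) (comul S)) u (tmap u' s).
Proof.
move=> [F [F' [F1 [F1' [[FK F'K] FB Fu Fu']]]]] [G [G' [G1 [G1' [[GK G'K] GB Gu Gu']]]]].
(* T K is K read with the bracketing X (x) (Y (x) H), in which the new leg belongs to the right
   block. *)
pose T (K : chom (ctens (ctens X Y) H) (ctens (ctens X Y) H)) :=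
  chom_comp (assoc X Y H) (chom_comp K (assocV X Y H)).
pose op F := tmap (V := ctens X Y) (V' := ctens X Y) F (chom_id H).
have TK (K K' : chom (ctens (ctens X Y) H) (ctens (ctens X Y) H)) :
    cancel K K' -> cancel (T K) (T K').
  move=> KK; exact: (chom_comp_cancel (chom_comp_cancel (@assocVK _ X Y H) KK) (@assocK _ X Y H)).
have Tu (K K1 : chom (ctens (ctens X Y) H) (ctens (ctens X Y) H)) :
    (forall x, K (tmap (tmap u u') s x) = tmap (tmap u u') s (K1 x)) ->
    forall x, T K (tmap u (tmap u' s) x) = tmap u (tmap u' s) (T K1 x).
  move=> KK x; rewrite -[LHS]/(assoc X Y H (K (assocV X Y H _))) assocV_natural KK.
  by rewrite assoc_natural.
exists (T (chom_comp (leg13 Y G) (op F))), (T (chom_comp (op F') (leg13 Y G'))).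
exists (T (chom_comp (leg13 Y G1) (op F1))), (T (chom_comp (op F1') (leg13 Y G1'))).
have opK (K K' : chom (ctens X Y) (ctens X Y)) : cancel K K' -> cancel (op K) (op K').
  by move=> KK; exact: tmap_cancel.
have opu (K K1 : chom (ctens X Y) (ctens X Y)) :
    (forall x, K (tmap u u' x) = tmap u u' (K1 x)) ->
    forall x, op K (tmap (tmap u u') s x) = tmap (tmap u u') s (op K1 x).
  by move=> KK x; apply: tmap_square.
have E x : tmap d (chom_comp (tmap d' (chom_id H)) (comul S)) x =
    assoc X Y H (tmap (tmap d d') (chom_id H) (id_comul S x)).
  rewrite assoc_natural -[id_comul S x]/(assocV H H H (tmap (chom_id H) (comul S) x)).
  by rewrite assocVK tmap_comp; apply: eq_tmap.
split=> [|x|x|x].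
- split; apply: TK; first exact: (chom_comp_cancel (opK _ _ FK) (leg13_cancel (Z := Y) GK)).
  exact: (chom_comp_cancel (leg13_cancel (Z := Y) G'K) (opK _ _ F'K)).
- rewrite !E (braiding_id_comul BP).
  have TE K z : T K (assoc X Y H z) = assoc X Y H (K z).
    exact: (congr1 (fun t => assoc X Y H (K t)) (assocK z)).
  have opB z : op F (tmap (tmap d d') (chom_id H) z) =
      tmap (tmap d d') (chom_id H) (op12 B z) by apply: tmap_square.
  have legB z : leg13 Y G (tmap (tmap d d') (chom_id H) z) =
      tmap (tmap d d') (chom_id H) (op13 B z).
    exact: (leg13_natural d' (F' := B) (fun z => esym (GB z))).
  apply: (etrans _ (esym (TE (chom_comp (leg13 Y G) (op F)) _))).
  apply: (congr1 (assoc X Y H)).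
  rewrite [RHS]chom_compE.
  apply: (etrans (esym (legB _))).
  apply: (congr1 (leg13 Y G)).
  exact: (esym (opB _)).
- by apply: Tu; exact: (chom_comp_square (opu _ _ Fu) (leg13_natural u' Gu)).
- by apply: Tu; exact: (chom_comp_square (leg13_natural u' Gu') (opu _ _ Fu')).
Qed.
Lemma eq_transported X Y (d d1 : chom H X) (d' d1' : chom H Y) u u' :
  d =1 d1 -> d' =1 d1' -> transported d d' u u' -> transported d1 d1' u u'.
Proof.
move=> dd dd' [F [F' [F1 [F1' [FK FB Fu Fu']]]]]; exists F, F', F1, F1'; split=> // x.
by rewrite -!(eq_tmap dd dd').
Qed.

Hypothesis Bs : transported (chom_id H) (chom_id H) s s.

Lemma transported_comul_iter m n : transported (comul_iter S m.+1) (comul_iter S n.+1)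
  (shrinkn S m.+1) (shrinkn S n.+1).
Proof.
have sym : forall q x, chom_comp (tmap (comul_iter S q.+1) (chom_id H)) (comul S) x =
    comul_iter S q.+2 x by move=> q x; rewrite comul_iterSS.
elim: n => [|n IH].
  elim: m => [//|m IH].
  exact: (eq_transported (sym m) (frefl _) (transported_left IH Bs)).
have Bm : transported (comul_iter S m.+1) (chom_id H) (shrinkn S m.+1) s.
  elim: m {IH} => [//|m IH].
  exact: (eq_transported (sym m) (frefl _) (transported_left IH Bs)).
exact: (eq_transported (frefl _) (sym n) (transported_right IH Bm)).
Qed.

Lemma braiding_Hprime y :
  (exists z, B (tmap incl incl y) = tmap incl incl z) /\
  (exists z, B' (tmap incl incl y) = tmap incl incl z).
Proof.
have gex n : exists g : chom H' (tpow H n.+1),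
    forall x, comul_iter S n.+1 (incl x) = shrinkn S n.+1 (g x).
  apply: (emb_factor (f := chom_comp (comul_iter S n.+1) incl) (shrinkn_emb S n gH)) => x.
  exact: ((in_HprimeP S (incl x) gH).1 (Hprime_valP x) n).
pose g n := projT1 (cid (gex n)); have gP n := projT2 (cid (gex n)).
have E m n : tmap (comul_iter S m.+1) (comul_iter S n.+1) (tmap incl incl y) =
    tmap (shrinkn S m.+1) (shrinkn S n.+1) (tmap (g m) (g n) y).
  by apply: tmap_square => x; exact: gP.
split; apply: tensor_in_Hprime => m n;
  have [F [F' [F1 [F1' [[FK F'K] FB Fu Fu']]]]] := transported_comul_iter m n.
  by exists (F1 (tmap (g m) (g n) y)); rewrite FB E Fu.
(* As B B' = id and F' inverts F, the operator F' transports B'. *)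
by exists (F1' (tmap (g m) (g n) y)); rewrite -[LHS]FK -FB B'K E Fu'.
Qed.
End BraidingPreservesHprime.

(** * Restriction to H' and comparison with the flip *)

Section Restrict.
Variables (k : fieldType) (H K : cmod k) (S : hopf H) (T : hopf K) (i : chom K H).
Hypotheses (iST : is_hopf_hom T S i) (i2_inj : injective (tmap i i))
  (i3_inj : injective (tmap (tmap i i) i)).
Variables (B : chom (tens2 H) (tens2 H)) (B1 B1' : chom (tens2 K) (tens2 K)).
Hypotheses (BP : braiding_identities S B)
  (B1P : forall x, B (tmap i i x) = tmap i i (B1 x))
  (B1K : cancel B1 B1') (B1'K : cancel B1' B1).

Lemma restrict_braiding_identities : braiding_identities T B1.
Proof.
have [iA iD _ _] := iST.
have iA2 : is_alg_hom (alg2 T) (alg2 S) (tmap i i) by exact: tmap_alg_hom.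
have [[BM Bone] _] := braiding_aut BP.
have i12 x : tmap (tmap i i) i (op12 B1 x) = op12 B (tmap (tmap i i) i x).
  by apply/esym; apply: tmap_square.
have i23 x : tmap (tmap i i) i (op23 B1 x) = op23 B (tmap (tmap i i) i x).
  by apply/esym; apply: (leg23_natural i (F' := B1)).
have i13 x : tmap (tmap i i) i (op13 B1 x) = op13 B (tmap (tmap i i) i x).
  by apply/esym; apply: (leg13_natural i (F' := B1)).
have iDid x : tmap (tmap i i) i (comul_id T x) = comul_id S (tmap i i x).
  by apply: tmap_square => // y; rewrite iD.
have idiD x : tmap (tmap i i) i (id_comul T x) = id_comul S (tmap i i x).
  rewrite -[id_comul S _]/(assocV H H H (tmap (chom_id H) (comul S) (tmap i i x))).
  rewrite (tmap_square (j := i) (g := chom_id K) (j' := tmap i i) (g' := comul T)) //.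
  by rewrite assocV_natural.
split=> [|a|x|x].
- split; last by exists B1'.
  split=> [x y|]; apply: i2_inj; apply: (etrans (esym (B1P _))).
    apply: (etrans (congr1 B (iA2.1 x y))); apply: (etrans (BM _ _)).
    apply: (etrans _ (esym (iA2.1 _ _))); exact: (congr2 (aprod (alg2 S)) (B1P x) (B1P y)).
  apply: (etrans (congr1 B iA2.2)); apply: (etrans Bone); exact: (esym iA2.2).
- by apply: i2_inj; rewrite -B1P -iD (braiding_comul BP) iD flip_natural.
- by apply: i3_inj; rewrite iDid -B1P (braiding_comul_id BP) i13 i23 iDid.
- by apply: i3_inj; rewrite idiD -B1P (braiding_id_comul BP) i13 i12 idiD.
Qed.
End Restrict.

Section NotFlip.
Variables (k : fieldType) (H : cmod k) (S : hopf H) (B N : chom (tens2 H) (tens2 H)).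
Hypotheses (gH : good H) (BN : forall x, B x = x + hvar *: N x)
  (Bone : B (aone (alg2 S)) = aone (alg2 S)).

(* After removing the counit part and dividing a by a power of h, reduction   *)
(* modulo h gives a (x) 1 = 1 (x) a with eps(a) = 0.                          *)
Lemma deform_not_flip a : B (otimes a (aone S)) = otimes (aone S) a ->
  exists c : fps k, a = c *: aone S.
Proof.
move=> Ba; exists (counit S a); pose b := augment S a.
have gH2 : good (tens2 H) := good_ctens gH gH.
have Bb : B (otimes b (aone S)) = otimes (aone S) b.
  rewrite /b augmentE unit_counitE otimesBl otimesZl linearB (chomZ B) Bone Ba.
  rewrite (bilinDr (otimes_bilin H H)) (bilinNr (otimes_bilin H H)).
  by rewrite otimesZr.
suff b0 : b = 0 by rewrite -unit_counitE -[LHS](unit_counitD S) -/b b0 addr0.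
apply: filt_sep => n; apply/gH.1; elim: n => [|n [c bc]]; first by exists b; rewrite scale1r.
have Bc : B (otimes c (aone S)) = otimes (aone S) c.
  by apply: (good_inj gH2 (n := n)); rewrite -(chomZ B) -otimesZl -otimesZr -bc.
have ec : counit S c = 0.
  apply: (good_inj (good_cunit k) (n := n)); rewrite -chomZ -bc scaler0.
  have := unit_counit_augment S a; rewrite -/b => /(congr1 (counit S)).
  by rewrite unit_counitE chomZ counit1 linear0 => <-; apply/esym; exact: mulr1.
have := congr1 (rform H (counit S)) Bc.
rewrite BN (chomD (rform H (counit S))) (chomZ (rform _ _) hvar) !rformE ec.
rewrite counit1 scale1r scale0r => /eqP; rewrite addr_eq0 => /eqP cE.
exists (- rform H (counit S) (N (otimes c (aone S)))).
by rewrite bc [X in _ *: X = _]cE exprSr -scalerA !scalerN.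
Qed.
End NotFlip.

Theorem theorem2p1 (k : fieldType) (char0 : [pchar k] =i pred0)
    (H : cmod k) (HA : in_A H) (S : hopf H)
    (R Rinv : tens2 H) (RP : is_Rmatrix S R Rinv)
    (R1 : hdvd 1 (R - aone (alg2 S))) :
  let incl := Hprime_incl S HA in
  exists (S' : hopf (Hprime S HA))
         (B : chom (tens2 (Hprime S HA)) (tens2 (Hprime S HA))),
    [/\ topfree (Hprime S HA),
        is_hopf_hom S' S incl &
        injective (tmap incl incl)] /\
    [/\ is_alg_aut (alg2 S') B,
        forall x, tmap incl incl (B x) = Ad S R Rinv (tmap incl incl x),
        braiding_identities S' B &
        (exists a : H, in_Hprime S a /\ forall c : fps k, a <> c *: aone S) ->
          is_braiding S' B].
Proof.
move=> incl; have gH := in_A_good HA.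
have [S' S'P] := Hprime_hopf HA S.
have ei : emb incl := incl_emb HA S.
have ei2 : emb (tmap incl incl) := emb_tmap gH gH ei ei.
have i2 := emb_inj ei2.
have i3 : injective (tmap (tmap incl incl) incl).
  by apply: emb_inj; apply: emb_tmap => //; exact: good_ctens.
have [N NP] := Adc_deform RP R1; have [N' N'P] := Adcinv_deform RP R1.
have [F1 F1P] := deform_shrink NP (Adc1 RP).
have [F1' F1'P] := deform_shrink N'P (Adcinv1 RP).
have AK := AdcK RP; have AinvK := AdcinvK RP.
have Bs : transported (Adc S R Rinv) (chom_id H) (chom_id H) (shrink S) (shrink S).
  exists (Adc S R Rinv), (Adcinv S R Rinv), F1, F1'.
  split.
  - exact: (conj AK AinvK).
  - move=> x.
    exact: (etrans (tmap_id _) (congr1 (Adc S R Rinv) (esym (tmap_id x)))).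
  - exact: F1P.
  - exact: F1'P.
have stable := braiding_Hprime (HA := HA) (Adc_braiding RP) AinvK Bs.
have [B BE] := emb_factor (f := chom_comp (Adc S R Rinv) (tmap incl incl)) ei2
  (fun y => (stable y).1).
have [B' B'E] := emb_factor (f := chom_comp (Adcinv S R Rinv) (tmap incl incl)) ei2
  (fun y => (stable y).2).
have {}BE x : Adc S R Rinv (tmap incl incl x) = tmap incl incl (B x) := BE x.
have {}B'E x : Adcinv S R Rinv (tmap incl incl x) = tmap incl incl (B' x) := B'E x.
have BK : cancel B B' by move=> x; apply: i2; rewrite -B'E -BE AK.
have B'K : cancel B' B by move=> x; apply: i2; rewrite -BE -B'E AinvK.
have BP := restrict_braiding_identities S'P i2 i3 (Adc_braiding RP) BE BK B'K.
exists S', B; split; first by split; [exact: Hprime_topfree|exact: S'P|exact: i2].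
split; [exact: braiding_aut BP|by move=> x; rewrite -BE|exact: BP|].
move=> [a [aP na]]; split; first exact: BP.
(* If H' were scalar, its flip would be the identity; the nonscalar a excludes this. Were B the
   flip, Ad(R) would send a (x) 1 to 1 (x) a, making a scalar. *)
move=> Bflip; have [x ax] := in_incl HA aP; have [[_ i1] _ _ _] := S'P.
have [c ac] : exists c : fps k, a = c *: aone S; last exact: na ac.
apply: (deform_not_flip gH NP (Adc1 RP)).
have := BE (otimes x (aone S')); rewrite Bflip flipE !tmapE i1.
by rewrite -[Hprime_incl S HA x]ax.
Qed.
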